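(* Let $\nu>1$, let $\mathfrak{D}=\{z\in\mathbb{C}:|z|<1\}$, and let $\mathfrak{F}\mathfrak{B}_\nu$ be the Fock–Bargmann space of all analytic functions $\phi$ on $\mathfrak{D}$ that are square integrable with respect to $d\mu_\nu(z)=(1-|z|^{2})^{2\nu-2}\,dx\,dy$. Let $\mathbb{A}=\frac{d}{dz}$ and let $\mathbb{A}^{*}=z^{2}\frac{d}{dz}+2\nu z$ be its adjoint. For $p\in\mathbb{N}=\{0,1,2,\dots\}$ let $\mathfrak{F}\mathfrak{B}_{\nu,p}$ be the closed subspace of $\mathfrak{F}\mathfrak{B}_\nu$ spanned by the orthonormal family $$\mathbb{P}_n(z)=\sqrt{\frac{(2\nu)_n}{n!}}\;z^{n},\qquad n=p,p+1,\dots,\qquad (2\nu)_n=\frac{\Gamma(2\nu+n)}{\Gamma(2\nu)},$$ and let $\mathbb{H}_p=(\mathbb{A}^{*})^{p}\mathbb{A}^{p+1}$ be the linear, unbounded, densely defined shift operator acting on $\mathfrak{F}\mathfrak{B}_{\nu,p}$ with domain $D(\mathbb{H}_p)=\{\phi\in\mathfrak{F}\mathfrak{B}_\nu:\mathbb{H}_p\phi\in\mathfrak{F}\mathfrak{B}_\nu\}\cap\mathfrak{F}\mathfrak{B}_{\nu,p}$, whose adjoint in $\mathfrak{F}\mathfrak{B}_{\nu,p}$ is given by $\mathbb{H}_p^{*}\mathbb{P}_n=\omega_{n,p}\mathbb{P}_{n+1}$, where $$\omega_{n,p}=\sqrt{(n+1)(2\nu+n)}\,\prod_{j=1}^{p}(n-j+1)(2\nu+n-j),\qquad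 n\ge p\ge0.$$ Then for all $p\ge0$, $\mathbb{H}_p$ is chaotic.
   Context: The inner product on $\mathfrak{F}\mathfrak{B}_\nu$ is $\langle\phi,\psi\rangle=\frac{2\nu-1}{\pi}\int_{\mathfrak{D}}\phi(z)\overline{\psi(z)}(1-|z|^{2})^{2\nu-2}\,dx\,dy$, $z=x+iy$; the $\mathbb{P}_n$, $n\ge0$, form an orthonormal basis for it. Powers of an operator $\mathbb{A}$ have their natural domains $D(\mathbb{A}^{m})=\{\phi\in D(\mathbb{A}):\mathbb{A}\phi\in D(\mathbb{A}^{m-1})\}$, and $D(\mathbb{A}^{\infty})=\bigcap_{n\ge0}D(\mathbb{A}^{n})$. Chaotic: a linear, unbounded, densely defined operator $\mathbb{T}$ on a Banach space $\mathbb{X}$ is chaotic if (1) $\mathbb{T}^{n}$ is closed for every positive integer $n$; (2) there is $\phi\in D(\mathbb{T}^{\infty})$ whose orbit $\{\phi,\mathbb{T}\phi,\mathbb{T}^{2}\phi,\dots\}$ is dense in $\mathbb{X}$; (3) the set of periodic points $\{\phi\in\mathbb{X}:\exists\, m\ge1,\ \phi\in D(\mathbb{T}^{m}),\ \mathbb{T}^{m}\phi=\phi\}$ is dense in $\mathbb{X}$. *)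

(* Defs.v *)
From HB Require Import structures.
From mathcomp Require Import all_boot all_order all_algebra.
From mathcomp Require Import all_classical all_reals all_analysis.
From mathcomp Require Import complex.

Set Implicit Arguments.
Unset Strict Implicit.
Unset Printing Implicit Defensive.

Import Order.TTheory GRing.Theory Num.Theory.
Import numFieldNormedType.Exports.

Local Open Scope classical_set_scope.
Local Open Scope ring_scope.
Local Open Scope complex_scope.

(* [R[i]^o] is [R[i]] as a normed module over itself: it carries the topology,
   and [derive1] on it is the complex derivative. *)
Notation cplx R := (R[i]^o) (only parsing).

(* A normed space is a subset [X] of a complex vector space [V] together with a
   function [N] that is a norm on [X].  A partial operator is a pair [(D, T)]:
   [D] is its domain, and the values of [T] outside [D] are never used. *)

Section Chaos.
Variables (R : realType) (V : lmodType R[i]).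
Implicit Types (X D S : set V) (N : V -> R) (T : V -> V).

Definition subspace X : Prop :=
  X 0 /\ forall (a : R[i]) x y, X x -> X y -> X (a *: x + y).

Definition norm_on X N : Prop :=
  [/\ forall x, X x -> N x = 0 -> x = 0,
      forall (a : R[i]) x, X x -> N (a *: x) = complex.Re `|a| * N x
    & forall x y, X x -> X y -> N (x + y) <= N x + N y].

Definition norm_cvg N (u : nat -> V) (x : V) : Prop :=
  (fun k => N (u k - x)) @ \oo --> (0 : R).

Definition norm_cauchy N (u : nat -> V) : Prop :=
  forall e : R, 0 < e -> exists k0 : nat, forall k l : nat,
    (k0 <= k)%N -> (k0 <= l)%N -> N (u k - u l) < e.

Definition banach_space X N : Prop :=
  [/\ subspace X, norm_on X N
    & forall u, (forall k, X (u k)) -> norm_cauchy N u ->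
        exists2 x, X x & norm_cvg N u x].

Definition dense_in X N S : Prop :=
  S `<=` X /\
  forall x (e : R), X x -> 0 < e -> exists2 y, S y & N (x - y) < e.

Definition closed_span X N (v : nat -> V) : set V :=
  [set x | X x /\ forall e : R, 0 < e -> exists (m : nat) (c : nat -> R[i]),
     N (x - \sum_(n < m) c n *: v n) < e].

Definition linear_operator X D T : Prop :=
  [/\ subspace D, D `<=` X, forall x, D x -> X (T x)
    & forall (a : R[i]) x y, D x -> D y -> T (a *: x + y) = a *: T x + T y].

Definition unbounded N D T : Prop :=
  ~ exists M : R, forall x, D x -> N (T x) <= M * N x.

Fixpoint pow_dom X D T (m : nat) : set V :=
  if m is m'.+1 then [set x | D x /\ pow_dom X D T m' (T x)] else X.

Definition infty_dom X D T : set V := \bigcap_(m in [set: nat]) pow_dom X D T m.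

(* Sequential closedness of the graph in [X * X], which is metrizable. *)
Definition closed_operator X N D T : Prop :=
  forall (u : nat -> V) (x y : V), (forall k, D (u k)) -> X x -> X y ->
    norm_cvg N u x -> norm_cvg N (fun k => T (u k)) y -> D x /\ T x = y.

Definition orbit T (x : V) : set V := [set iter n T x | n in [set: nat]].

Definition periodic_points X D T : set V :=
  [set x | exists m : nat,
     [/\ (1 <= m)%N, pow_dom X D T m x & iter m T x = x]].

(* The first two conjuncts are the standing assumptions of the notion: a linear,
   unbounded, densely defined operator on a Banach space. *)
Definition chaotic X N D T : Prop :=
  [/\ banach_space X N,
      [/\ linear_operator X D T, unbounded N D T & dense_in X N D],
      forall n : nat, (1 <= n)%N ->
        closed_operator X N (pow_dom X D T n) (iter n T),
      exists2 x, infty_dom X D T x & dense_in X N (orbit T x)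
    & dense_in X N (periodic_points X D T)].

End Chaos.

(* A function on the disc is represented by the function on the whole plane that
   extends it by 0, so that [=] is equality of functions on the disc; recall that
   [f \_ U] is [f] on [U] and 0 elsewhere. *)

Section FockBargmann.
Variable R : realType.
Implicit Types (nu : R) (p n : nat) (phi psi : cplx R -> cplx R).

Definition disc : set (cplx R) := [set z | `|z| < 1].

Definition on_disc phi : cplx R -> cplx R := phi \_ disc.

Definition analytic_on (U : set (cplx R)) phi : Prop :=
  forall z0 : cplx R, U z0 -> exists c : nat -> cplx R,
    \forall z \near z0, series (fun k => c k * (z - z0) ^+ k) @ \oo --> phi z.

Definition area := (@lebesgue_measure R \x @lebesgue_measure R)%E.

Definition pt (xy : measurableTypeR R * measurableTypeR R) : cplx R :=
  (xy.1 : R) +i* (xy.2 : R).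

Definition weight nu (z : cplx R) : R :=
  (1 - complex.Re `|z| ^+ 2) `^ (2 * nu - 2).

Definition square_integrable nu phi : Prop :=
  area.-integrable (pt @^-1` disc)
    (fun xy => (complex.Re `|phi (pt xy)| ^+ 2 * weight nu (pt xy))%:E).

Definition disc_integral (f : cplx R -> cplx R) : cplx R :=
  (\int[area]_(xy in pt @^-1` disc) complex.Re (f (pt xy)))
  +i* (\int[area]_(xy in pt @^-1` disc) complex.Im (f (pt xy))).

Definition fb_inner nu phi psi : cplx R :=
  ((2 * nu - 1) / pi)%:C *
  disc_integral (fun z => phi z * conjc (psi z) * (weight nu z)%:C).

Definition fb_norm nu phi : R := Num.sqrt (complex.Re (fb_inner nu phi phi)).

Definition FB nu : set (cplx R -> cplx R) :=
  [set phi | [/\ on_disc phi = phi, analytic_on disc phi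
             & square_integrable nu phi]].

Definition Gamma (s : R) : R :=
  \int[@lebesgue_measure R]_(t in `]0, +oo[) (t `^ (s - 1) * expR (- t)).

Definition poch (a : R) n : R := Gamma (a + n%:R) / Gamma a.

Definition bbP nu n : cplx R -> cplx R :=
  on_disc (fun z => (Num.sqrt (poch (2 * nu) n / n`!%:R))%:C * z ^+ n).

Definition FBp nu p : set (cplx R -> cplx R) :=
  closed_span (FB nu) (fb_norm nu) (fun k => bbP nu (p + k)).

(* [derive1 phi] is meaningful on the open disc for [phi] analytic there, and it
   only depends on the values of [phi] near the point. *)
Definition opA phi : cplx R -> cplx R := on_disc (derive1 phi).

Definition opAstar nu phi : cplx R -> cplx R :=
  on_disc (fun z => z ^+ 2 * derive1 phi z + (2 * nu)%:C * z * phi z).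

Definition opH nu p phi : cplx R -> cplx R :=
  iter p (opAstar nu) (iter p.+1 opA phi).

Definition dom_opH nu p : set (cplx R -> cplx R) :=
  [set phi | FB nu phi /\ FB nu (opH nu p phi)] `&` FBp nu p.

End FockBargmann.

(* Main.v *)
(* On power series f = sum_n a_n z^n the operator H_p is a backward weighted
   shift, (H_p f)_n = w_n a_(n+1), with w_n = 0 for n < p and w_n >= n + 1 for
   n >= p.  The monomials are orthogonal for any radial weight, because the
   plane measure is invariant under the rotation by (3 + 4i)/5, which is not a
   root of unity; so the norm of f is a weighted l^2 norm of (a_n), whose
   weights, the squared norms of z^n, are decreasing and decay slower than any
   geometric sequence r^(2n) with r < 1.  These two facts are all that is needed
   about them.  An element of FB_(nu,p) is a limit of polynomials, hence equal
   almost everywhere, and by continuity everywhere, to the sum of the power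
   series with the limit coefficients; Cauchy's theorem is not needed.
   The right inverse S of the shift divides by w_n, so S^k shrinks a polynomial
   by a factor k!.  Hence sum_k S^(k m) b is a point of period m close to the
   polynomial b for large m, and sum_j S^(n_j) q_j has a dense orbit when (q_j)
   runs infinitely often through a dense sequence of polynomials and (n_j) grows
   fast enough. *)

Require Import Defs.
From HB Require Import structures.
From mathcomp Require Import all_boot all_order all_algebra.
From mathcomp Require Import all_classical all_reals all_analysis.
From mathcomp Require Import measurable_realfun.
From mathcomp Require Import complex ring lra zify.

Set Implicit Arguments.
Unset Strict Implicit.
Unset Printing Implicit Defensive.

Import Order.TTheory GRing.Theory Num.Theory.
Import numFieldNormedType.Exports.

Local Open Scope classical_set_scope.
Local Open Scope ring_scope.
Local Open Scope complex_scope.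

(** * Power series on the disc *)

Section ComplexModulus.
Variable R : realType.
Implicit Types z w : R[i].

(** The natural domain of a power demands that all intermediate images be square integrable; the
    obstacle is to recover this from the last image alone. It works because w_n >= 1 for n >= p and
    the squared norms g_n of z^n decrease: the tail of the i-th image is dominated, entry by entry,
    by that of the n-th one. Closedness of the powers, the periodic points and the dense orbit all
    rely on this. The slow decay of g_n has another role: it forces a sequence of finite weighted
    l^2 norm to have radius of convergence at least 1. The l^2 form of the norm is a Parseval
    identity obtained in two limits, over partial sums at a radius r < 1 and then over r, since
    partial sums are uniformly bounded only on smaller discs. Smallness of a superposition is
    measured by coefficient bounds c 2^(-l). As S^k q with q of degree below d lives at indices l <
    k + d, such a bound costs a factor 2^(k + d), which k! absorbs. *)

Definition cabs z : R := complex.Re `|z|.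

(** The norm of [R[i]] takes values in [R[i]] itself; most laws of the real-valued [cabs] are read
    off from it through the injective embedding of the reals. *)
Lemma normr_cabs z : `|z| = (cabs z)%:C.
Proof. by rewrite /cabs normc_def. Qed.

Lemma cabsE z : cabs z = Num.sqrt (complex.Re z ^+ 2 + complex.Im z ^+ 2).
Proof. by rewrite /cabs normc_def. Qed.

Lemma cabs_sqr z : cabs z ^+ 2 = complex.Re z ^+ 2 + complex.Im z ^+ 2.
Proof. by rewrite cabsE sqr_sqrtr// addr_ge0// sqr_ge0. Qed.

Lemma cabs_ge0 z : 0 <= cabs z.
Proof. by rewrite cabsE sqrtr_ge0. Qed.
Hint Resolve cabs_ge0 : core.

Lemma cabs0 : cabs 0 = 0.
Proof. by apply: complexI; rewrite -normr_cabs normr0. Qed.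

Lemma cabs1 : cabs 1 = 1.
Proof. by apply: complexI; rewrite -normr_cabs normr1. Qed.

Lemma cabs_eq0 z : (cabs z == 0) = (z == 0).
Proof. by rewrite -[RHS]normr_eq0 normr_cabs eq_complex/= eqxx andbT. Qed.

Lemma cabs_gt0 z : (0 < cabs z) = (z != 0).
Proof. by rewrite lt_def cabs_eq0 cabs_ge0 andbT. Qed.

Lemma cabsM z w : cabs (z * w) = cabs z * cabs w.
Proof. by apply: complexI; rewrite rmorphM/= -!normr_cabs normrM. Qed.

Lemma cabsX z n : cabs (z ^+ n) = cabs z ^+ n.
Proof. by apply: complexI; rewrite rmorphXn/= -!normr_cabs normrX. Qed.

Lemma cabsN z : cabs (- z) = cabs z.
Proof. by apply: complexI; rewrite -!normr_cabs normrN. Qed.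

Lemma cabsBC z w : cabs (z - w) = cabs (w - z).
Proof. by rewrite -opprB cabsN. Qed.

Lemma cabsV z : cabs z^-1 = (cabs z)^-1.
Proof. by apply: complexI; rewrite fmorphV/= -!normr_cabs normfV. Qed.

Lemma cabsD z w : cabs (z + w) <= cabs z + cabs w.
Proof. by rewrite -lecR rmorphD/= -!normr_cabs ler_normD. Qed.

Lemma cabsB z w : cabs (z - w) <= cabs z + cabs w.
Proof. by rewrite (le_trans (cabsD _ _))// cabsN. Qed.

Lemma cabs_triangle w z v : cabs (z - v) <= cabs (z - w) + cabs (w - v).
Proof. by apply: le_trans (cabsD _ _); rewrite addrA subrK. Qed.

Lemma cabs_sum I (r : seq I) (P : pred I) (F : I -> R[i]) :
  cabs (\sum_(i <- r | P i) F i) <= \sum_(i <- r | P i) cabs (F i).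
Proof.
elim/big_ind2 : _ => //; first by rewrite cabs0.
by move=> x1 x2 y1 y2 h1 h2; apply: le_trans (cabsD _ _) (lerD h1 h2).
Qed.

Lemma cabs_real (x : R) : cabs x%:C = `|x|.
Proof. by rewrite cabsE/= expr0n addr0 sqrtr_sqr. Qed.

Lemma cabs_nat n : cabs n%:R = n%:R.
Proof. by apply: complexI; rewrite -normr_cabs normr_nat rmorph_nat. Qed.

Lemma normr_Re z : `|complex.Re z| <= cabs z.
Proof.
by rewrite cabsE -sqrtr_sqr ler_sqrt ?lerDl ?addr_ge0 ?sqr_ge0.
Qed.

Lemma normr_Im z : `|complex.Im z| <= cabs z.
Proof.
by rewrite cabsE -sqrtr_sqr ler_sqrt ?lerDr ?addr_ge0 ?sqr_ge0.
Qed.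

Lemma cabs_le_ReIm z : cabs z <= `|complex.Re z| + `|complex.Im z|.
Proof.
rewrite {1}[z]complexE; apply: le_trans (cabsD _ _) _.
by rewrite cabsM !cabs_real (_ : cabs 'i = 1) ?mul1r// cabsE/= expr0n/=
  expr1n add0r sqrtr1.
Qed.

Lemma disc_cabs (z : cplx R) : disc z <-> cabs z < 1.
Proof.
by rewrite /disc/= normr_cabs -[1]/(1%:C) ltcR.
Qed.

(** Neighbourhoods are given by complex radii; a positive complex number is real, so real radii
    describe the same filter. *)
Lemma nbhs_cabs (z0 : cplx R) (P : set (cplx R)) :
  nbhs z0 P <-> exists2 e : R, 0 < e & forall z, cabs (z - z0) < e -> P z.
Proof.
apply: iff_trans (@nbhs_normP R[i] (R[i]^o) z0 P) _; split => [[e e0 eP]|[e e0 eP]].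
  have er : e = (complex.Re e)%:C.
    by rewrite RRe_real// ger0_real// ltW.
  exists (complex.Re e); first by move: e0; rewrite /= {1}er -[0]/(0%:C) ltcR.
  move=> z zz0; apply: eP; rewrite /ball_ /= normr_cabs er ltcR.
  by rewrite cabsBC.
exists e%:C; first by rewrite /= -[0]/(0%:C) ltcR.
by move=> z; rewrite /ball_ /= normr_cabs ltcR cabsBC => /eP.
Qed.

Lemma cvgn_distP (u : nat -> R) (l : R) :
  u @ \oo --> l <->
  forall e : R, 0 < e -> exists N, forall n, (N <= n)%N -> `|u n - l| < e.
Proof.
split=> [/cvgrPdist_lt ul e /ul[N _ NP]|ul].
  by exists N => n /NP/=; rewrite distrC.
apply/cvgrPdist_lt => e /ul[N NP]; exists N => // n /NP.
by rewrite distrC.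
Qed.

Lemma cvg_cabs (u : nat -> cplx R) (l : cplx R) :
  u @ \oo --> l <-> (fun n => cabs (u n - l)) @ \oo --> (0 : R).
Proof.
split => [ul|/cvgn_distP ul].
  apply/cvgn_distP => e e0.
  have [|N _ NP] := ul [set z | cabs (z - l) < e].
    by apply/nbhs_cabs; exists e.
  by exists N => n /NP/=; rewrite subr0 ger0_norm.
move=> P /nbhs_cabs[e e0 eP]; have [N NP] := ul e e0.
by exists N => // n /NP; rewrite subr0 ger0_norm// => /eP.
Qed.

Lemma cvgcD (u v : nat -> cplx R) (l m : cplx R) :
  u @ \oo --> l -> v @ \oo --> m -> (fun n => u n + v n) @ \oo --> l + m.
Proof.
move=> /cvg_cabs/cvgn_distP ul /cvg_cabs/cvgn_distP vm.
apply/cvg_cabs/cvgn_distP => e e0.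
have [N1 h1] := ul (e / 2) (divr_gt0 e0 (ltr0Sn _ _)).
have [N2 h2] := vm (e / 2) (divr_gt0 e0 (ltr0Sn _ _)).
exists (maxn N1 N2) => n; rewrite geq_max => /andP[/h1 {}h1 /h2 {}h2].
move: h1 h2; rewrite !subr0 !ger0_norm// opprD addrACA => h1 h2.
by rewrite (splitr e); apply: le_lt_trans (cabsD _ _) (ltrD h1 h2).
Qed.

Lemma cvgcMl (a : cplx R) (u : nat -> cplx R) (l : cplx R) :
  u @ \oo --> l -> (fun n => a * u n) @ \oo --> a * l.
Proof.
move=> /cvg_cabs/cvgn_distP ul; apply/cvg_cabs/cvgn_distP => e e0.
have a0 : 0 < cabs a + 1 by rewrite ltr_wpDl.
have [N NP] := ul (e / (cabs a + 1)) (divr_gt0 e0 a0).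
exists N => n /NP; rewrite -mulrBr !subr0 !ger0_norm// cabsM ltr_pdivlMr// mulrC.
by apply: le_lt_trans; rewrite ler_wpM2r// lerDl.
Qed.

Lemma cvgcMr (a : cplx R) (u : nat -> cplx R) (l : cplx R) :
  u @ \oo --> l -> (fun n => u n * a) @ \oo --> l * a.
Proof.
move=> ul; rewrite mulrC (_ : (fun n => _) = (fun n => a * u n)); last first.
  by apply/funext => n; rewrite mulrC.
exact: cvgcMl.
Qed.

Lemma cvgcB (u v : nat -> cplx R) (l m : cplx R) :
  u @ \oo --> l -> v @ \oo --> m -> (fun n => u n - v n) @ \oo --> l - m.
Proof.
move=> ul vm; have {}vm := cvgcMl (a := -1) vm; rewrite -[- m]mulN1r.
under [X in X @ _ --> _]eq_fun do rewrite -mulN1r.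
exact: cvgcD.
Qed.

End ComplexModulus.
#[export] Hint Extern 0 (is_true (0 <= cabs _)) => exact: cabs_ge0 : core.

(** * Complex series dominated by a geometric sequence *)

Section GeometricSeries.
Variable R : realType.

Lemma geometric_sum_le (q : R) (N n : nat) : 0 <= q < 1 ->
  \sum_(N <= i < n) q ^+ i <= q ^+ N / (1 - q).
Proof.
move=> /andP[q0 q1]; have q1' : 0 < 1 - q by rewrite subr_gt0.
have [Nn|/ltnW nN] := leqP N n; last first.
  by rewrite big_geq// divr_ge0// ?exprn_ge0// ltW.
rewrite ler_pdivlMr//.
suff -> : (\sum_(N <= i < n) q ^+ i) * (1 - q) = q ^+ N - q ^+ n.
  by rewrite gerBl exprn_ge0.
rewrite mulr_suml -[RHS]opprB -(telescope_sumr (fun i => q ^+ i))// -sumrN.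
by apply: eq_bigr => i _; rewrite opprB mulrBr mulr1 exprSr.
Qed.

Lemma ler_cvgn_norm (V : normedModType R) (u : nat -> V) l y (B : R) N :
  u @ \oo --> l -> (forall n, (N <= n)%N -> `|u n - y| <= B) -> `|l - y| <= B.
Proof.
move=> ul uB; have h : (fun n => `|u n - y|) @ \oo --> `|l - y|.
  by apply: cvg_norm; apply: cvgB => //; exact: cvg_cst.
have := cvg_lim (@Rhausdorff R) h => <-.
by apply: limr_le; [apply: cvgP h|exists N].
Qed.

Lemma geometric_tail (v : nat -> R) (M q : R) : 0 <= q < 1 ->
  (forall n, `|v n| <= M * q ^+ n) ->
  cvgn (series v) /\
  forall N, `|limn (series v) - \sum_(i < N) v i| <= M * (q ^+ N / (1 - q)).
Proof.
move=> /[dup] qq /andP[q0 q1] vM.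
have M0 : 0 <= M by have := vM 0%N; rewrite expr0 mulr1; apply: le_trans.
have cv : cvgn (series v).
  apply: normed_cvg; apply: (@series_le_cvg _ _ (geometric M q)).
  - by move=> n; rewrite normr_ge0.
  - by move=> n; rewrite geometric_ge0.
  - exact: vM.
  - by apply: is_cvg_geometric_series; rewrite ger0_norm.
split => // N; apply: (@ler_cvgn_norm _ (series v) _ _ _ N cv) => n Nn.
rewrite /series/= -(big_mkord xpredT) (big_cat_nat (n := N))//= addrAC subrr add0r.
apply: le_trans (ler_norm_sum _ _ _) _.
apply: le_trans (_ : \sum_(N <= i < n) M * q ^+ i <= _).
  by apply: ler_sum => i _.
by rewrite -mulr_sumr ler_wpM2l// geometric_sum_le.
Qed.

Lemma cvg_complex (u : nat -> cplx R) (a b : R) :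
  (fun n => complex.Re (u n)) @ \oo --> a -> (fun n => complex.Im (u n)) @ \oo --> b ->
  u @ \oo --> (a +i* b : cplx R).
Proof.
move=> /cvgn_distP ua /cvgn_distP ub; apply/cvg_cabs/cvgn_distP => e e0.
have [N1 h1] := ua (e / 2) (divr_gt0 e0 (ltr0Sn _ _)).
have [N2 h2] := ub (e / 2) (divr_gt0 e0 (ltr0Sn _ _)).
exists (maxn N1 N2) => n; rewrite geq_max => /andP[/h1 {}h1 /h2 {}h2].
rewrite subr0 ger0_norm//; apply: le_lt_trans (cabs_le_ReIm _) _; rewrite (splitr e).
by apply: ltrD; move: h1 h2; case: (u n).
Qed.

Lemma Re_sum (I : Type) (r : seq I) (P : pred I) (F : I -> R[i]) :
  complex.Re (\sum_(i <- r | P i) F i) = \sum_(i <- r | P i) complex.Re (F i).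
Proof. by elim/big_rec2 : _ => // i x y _ <-; case: (F i); case: y. Qed.

Lemma Im_sum (I : Type) (r : seq I) (P : pred I) (F : I -> R[i]) :
  complex.Im (\sum_(i <- r | P i) F i) = \sum_(i <- r | P i) complex.Im (F i).
Proof. by elim/big_rec2 : _ => // i x y _ <-; case: (F i); case: y. Qed.

(** [limn] has a default value when the partial sums diverge; convergence is supplied separately,
    through [geo_dominated] or a limit fed to [csumE]. *)
Definition csum (u : nat -> cplx R) : cplx R := limn (series u).

Definition geo_dominated (u : nat -> cplx R) :=
  exists M q : R, 0 <= q < 1 /\ forall n, cabs (u n) <= M * q ^+ n.

Lemma csumE (u : nat -> cplx R) l : series u @ \oo --> l -> csum u = l.
Proof. by move=> /(cvg_lim (@norm_hausdorff _ _)). Qed.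

Lemma cvg_csum u : geo_dominated u -> series u @ \oo --> csum u.
Proof.
move=> [M [q [qq uM]]].
have [h1 _] := @geometric_tail (fun n => complex.Re (u n)) M q qq
  (fun n => le_trans (normr_Re _) (uM n)).
have [h2 _] := @geometric_tail (fun n => complex.Im (u n)) M q qq
  (fun n => le_trans (normr_Im _) (uM n)).
suff h : series u @ \oo --> ((limn (series (fun n => complex.Re (u n)))) +i*
                    (limn (series (fun n => complex.Im (u n)))) : cplx R).
  by rewrite (csumE h).
apply: cvg_complex.
- rewrite (_ : (fun n => _) = series (fun n => complex.Re (u n)))//.
  by apply/funext => n; rewrite /series/= Re_sum.
- rewrite (_ : (fun n => _) = series (fun n => complex.Im (u n)))//.
  by apply/funext => n; rewrite /series/= Im_sum.
Qed.

Lemma cabs_lim_le (u : nat -> cplx R) (l y : cplx R) (B : R) N :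
  u @ \oo --> l -> (forall n, (N <= n)%N -> cabs (u n - y) <= B) ->
  cabs (l - y) <= B.
Proof.
move=> /cvg_cabs/cvgn_distP ul uB; apply/ler_addgt0Pr => e e0.
have [N1 h1] := ul e e0.
apply: le_trans (cabs_triangle (u (maxn N N1)) _ _) _; rewrite addrC.
apply: lerD; first by apply: uB; rewrite leq_maxl.
have := h1 (maxn N N1) (leq_maxr _ _).
by rewrite subr0 ger0_norm// cabsBC => /ltW.
Qed.

Lemma csum_tail (u : nat -> cplx R) (M q : R) : 0 <= q < 1 ->
  (forall n, cabs (u n) <= M * q ^+ n) ->
  forall N, cabs (csum u - \sum_(i < N) u i) <= M * (q ^+ N / (1 - q)).
Proof.
move=> /[dup] qq /andP[q0 q1] uM N.
have M0 : 0 <= M by have := uM 0%N; rewrite expr0 mulr1; apply: le_trans.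
apply: (@cabs_lim_le (series u) _ _ _ N).
  by apply: cvg_csum; exists M, q.
move=> n Nn.
rewrite /series/= -(big_mkord xpredT) (big_cat_nat (n := N))//= addrAC subrr add0r.
apply: le_trans (cabs_sum _ _ _) _.
apply: le_trans (_ : \sum_(N <= i < n) M * q ^+ i <= _).
  by apply: ler_sum => i _.
by rewrite -mulr_sumr ler_wpM2l// geometric_sum_le.
Qed.

Lemma csum_linear (a : R[i]) (u v : nat -> cplx R) : geo_dominated u -> geo_dominated v ->
  csum (fun n => a * u n + v n) = a * csum u + csum v.
Proof.
move=> /cvg_csum cu /cvg_csum cv; apply: csumE.
rewrite (_ : series _ = (fun n => a * series u n + series v n)).
  exact: cvgcD (cvgcMl cu) cv.
by apply/funext => n; rewrite /series/= mulr_sumr -big_split.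
Qed.

End GeometricSeries.

Section PowerSeries.
Variable R : realType.
Implicit Types (a b : nat -> cplx R) (z h : cplx R).

(* The radius of convergence of [sum_n a n z^n] is at least 1. *)
Definition adm a := forall r : R, 0 <= r < 1 ->
  exists M : R, forall n, cabs (a n) * r ^+ n <= M.

Definition psum a : cplx R -> cplx R := on_disc (fun z => csum (fun n => a n * z ^+ n)).

Lemma on_discT (phi : cplx R -> cplx R) z : cabs z < 1 -> on_disc phi z = phi z.
Proof. by move=> /disc_cabs z1; rewrite /on_disc patchT// inE. Qed.

Lemma on_discF (phi : cplx R -> cplx R) z : ~ cabs z < 1 -> on_disc phi z = 0.
Proof. by move=> z1; rewrite /on_disc patchC// inE => /disc_cabs. Qed.

Lemma on_disc_ext (phi psi : cplx R -> cplx R) :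
  (forall z, cabs z < 1 -> phi z = psi z) -> on_disc phi = on_disc psi.
Proof.
move=> e; apply/funext => z; have [z1|z1] := pselect (cabs z < 1).
  by rewrite !on_discT// e.
by rewrite !on_discF.
Qed.

Lemma on_disc_idem (phi : cplx R -> cplx R) : on_disc (on_disc phi) = on_disc phi.
Proof. by apply: on_disc_ext => z z1; rewrite on_discT. Qed.

(** Boundedness at the larger radius [r = (1 + rho) / 2] turns into decay at [rho], with ratio
    [rho / r < 1]. *)
Lemma adm_geometric a (rho : R) : adm a -> 0 <= rho < 1 ->
  exists M q : R, 0 <= q < 1 /\ forall n, cabs (a n) * rho ^+ n <= M * q ^+ n.
Proof.
move=> aa /andP[r0 r1].
pose r := (1 + rho) / 2.
have r_gt0 : 0 < r by rewrite /r; lra.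
have [|M aM] := aa r; first by rewrite /r; lra.
exists M, (rho / r); split.
  by rewrite divr_ge0 ?(ltW r_gt0)//= ltr_pdivrMr// mul1r /r; lra.
move=> n; rewrite expr_div_n mulrA ler_pdivlMr ?exprn_gt0// mulrAC.
by rewrite ler_wpM2r ?exprn_ge0.
Qed.

Lemma adm_geo_dominated a z : adm a -> cabs z < 1 -> geo_dominated (fun n => a n * z ^+ n).
Proof.
move=> aa z1; have [|M [q [qq aM]]] := adm_geometric aa (_ : 0 <= cabs z < 1).
  by rewrite cabs_ge0.
by exists M, q; split => // n; rewrite cabsM cabsX.
Qed.

(** Binomial coefficients beyond [n] vanish, so every range [L > n] will do; the sum can then be cut
    at an index that does not depend on [n]. *)
Lemma exprDn_wide (S : comNzRingType) (x y : S) n L : (n < L)%N ->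
  (x + y) ^+ n = \sum_(k < L) 'C(n, k)%:R * x ^+ (n - k) * y ^+ k.
Proof.
move=> nL; rewrite exprDn (big_ord_widen L (fun k => x ^+ (n - k) * y ^+ k *+ 'C(n, k)))//.
rewrite big_mkcond/=; apply: eq_bigr => k _; case: ifPn => [_|].
  by rewrite -mulrA mulr_natl.
by rewrite -leqNgt => /bin_small ->; rewrite !mul0r.
Qed.

(** The terms of index k >= K satisfy t^k <= (t/d)^K d^k because t <= d; what remains after taking
    out (t/d)^K is part of the expansion of (x + d)^n. Summed over n, this becomes the Taylor
    remainder in [recentre]. *)
Lemma binomial_tail z0 h (x t d : R) n K : cabs z0 <= x -> cabs h <= t -> t <= d -> 0 < d ->
  cabs ((z0 + h) ^+ n - \sum_(k < K) 'C(n, k)%:R * z0 ^+ (n - k) * h ^+ k)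
    <= (t / d) ^+ K * (x + d) ^+ n.
Proof.
move=> zx ht td d0.
have x0 : 0 <= x by apply: le_trans zx.
have t0 : 0 <= t by apply: le_trans ht.
have td1 : 0 <= t / d <= 1 by rewrite divr_ge0 ?(ltW d0)//= ler_pdivrMr// mul1r.
pose L := (n.+1 + K)%N.
rewrite (@exprDn_wide _ z0 h n L) ?(@exprDn_wide _ x d n L) ?leq_addr//.
rewrite -!(big_mkord xpredT (fun k => 'C(n, k)%:R * z0 ^+ (n - k) * h ^+ k)).
rewrite (big_cat_nat (n := K) (m := 0) (p := L)) ?leq_addl//= addrAC subrr add0r.
apply: le_trans (cabs_sum _ _ _) _.
rewrite mulr_sumr -(big_mkord xpredT (fun k => (t / d) ^+ K * ('C(n, k)%:R * x ^+ (n - k) * d ^+ k))).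
rewrite [leRHS](big_cat_nat (n := K)) ?leq_addl//=.
apply: ler_wpDl.
  apply: sumr_ge0 => k _; rewrite mulr_ge0 ?exprn_ge0 ?(andP td1).1//.
  by rewrite !mulr_ge0 ?exprn_ge0 ?ler0n// ltW.
rewrite big_nat_cond [leRHS]big_nat_cond; apply: ler_sum => k /andP[/andP[Kk _] _].
rewrite !cabsM !cabsX cabs_nat.
apply: le_trans (_ : _ <= 'C(n, k)%:R * x ^+ (n - k) * t ^+ k) _.
  by rewrite ler_pM ?mulr_ge0 ?exprn_ge0 ?ler0n// ?ler_wpM2l// ?lerXn2r// nnegrE.
have -> : t ^+ k = (t / d) ^+ k * d ^+ k.
  by rewrite -exprMn divfK// gt_eqF.
rewrite mulrCA ler_wpM2r//.
  by rewrite !mulr_ge0 ?exprn_ge0 ?ler0n// ltW.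
by rewrite -(subnK Kk) exprD ler_piMl ?exprn_ge0 ?(andP td1).1// exprn_ile1 ?(andP td1).1 ?(andP td1).2.
Qed.

Lemma csum_recl (u : nat -> cplx R) : u 0%N = 0 -> geo_dominated u ->
  csum (fun n => u n.+1) = csum u.
Proof.
move=> u0 /cvg_csum/cvg_cabs/cvgn_distP cu; apply: csumE; apply/cvg_cabs/cvgn_distP => e /cu[N NP].
exists N => n Nn; have := NP n.+1 (leqW Nn).
by rewrite /series/= big_nat_recl// u0 add0r.
Qed.

Lemma geo_dominated_le u (v : nat -> cplx R) (B : R) :
  geo_dominated u -> (forall n, cabs (v n) <= B * cabs (u n)) -> geo_dominated v.
Proof.
move=> [M [q [qq uM]]] vB; have [B0|B0] := leP 0 B.
  exists (B * M), q; split => // n; apply: le_trans (vB n) _.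
  by rewrite -mulrA ler_wpM2l.
exists 0, 0; split; first by rewrite lexx ltr01.
move=> n; rewrite mul0r; apply: le_trans (vB n) _.
by rewrite mulr_le0_ge0 ?(ltW B0).
Qed.

Lemma cvg_series_lincomb (K : nat) (u : nat -> nat -> cplx R) (c h : nat -> cplx R) :
  (forall k, series (u k) @ \oo --> c k) ->
  series (fun n => \sum_(k < K) u k n * h k) @ \oo --> \sum_(k < K) c k * h k.
Proof.
move=> uc; elim: K => [|K IH].
  rewrite big_ord0 (_ : series _ = cst 0); first exact: cvg_cst.
  by apply/funext => n; rewrite /series/= big1// => i _; rewrite big_ord0.
rewrite big_ord_recr/= (_ : series _ = (fun n =>
   series (fun n => \sum_(k < K) u k n * h k) n + series (u K) n * h K)).
  exact: cvgcD IH (cvgcMr (uc K)).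
apply/funext => n; rewrite /series/= mulr_suml -big_split/=.
by apply: eq_bigr => i _; rewrite big_ord_recr.
Qed.

(* Recentring at [z0]; the case [K = 1] gives continuity, [K = 2] the
   derivative, and [K -> oo] analyticity. *)
Lemma recentre a z0 : adm a -> cabs z0 < 1 ->
  exists (d C : R) (c : nat -> cplx R), [/\ 0 < d, cabs z0 + d < 1,
    c 0%N = csum (fun n => a n * z0 ^+ n),
    c 1%N = csum (fun n => n.+1%:R * a n.+1 * z0 ^+ n) &
    forall h K, cabs h <= d ->
      cabs (csum (fun n => a n * (z0 + h) ^+ n) - \sum_(k < K) c k * h ^+ k)
        <= C * (cabs h / d) ^+ K].
Proof.
move=> aa z1; pose d := (1 - cabs z0) / 2.
have d0 : 0 < d by rewrite /d; lra.
have zd1 : cabs z0 + d < 1 by rewrite /d; lra.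
have [|M [q [qq aM]]] := adm_geometric aa (_ : 0 <= cabs z0 + d < 1).
  by rewrite zd1 addr_ge0// ltW.
(* [u k n] is what a_n z^n contributes to the coefficient of h^k at z = z0 + h. *)
pose u k n := a n * ('C(n, k)%:R * z0 ^+ (n - k)).
have ud k : geo_dominated (u k).
  exists (M / d ^+ k), q; split => // n.
  rewrite -mulrAC ler_pdivlMr ?exprn_gt0//; apply: le_trans (aM n).
  rewrite /u cabsM -mulrA ler_wpM2l//.
  (* One term of the expansion of (|z0| + d)^n is at most the whole sum; this is the source of the
     factor d^(-k). *)
  rewrite (@exprDn_wide _ (cabs z0) d n (n.+1 + k.+1)%N) ?leq_addr//.
  have kn : (k < n.+1 + k.+1)%N by rewrite leq_addl.
  rewrite (bigD1 (Ordinal kn))//= cabsM cabs_nat cabsX lerDl.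
  by apply: sumr_ge0 => i _; rewrite !mulr_ge0 ?exprn_ge0 ?ler0n// ltW.
exists d, (M / (1 - q)), (fun k => csum (u k)); split => //.
- by congr csum; apply/funext => n; rewrite /u bin0 mul1r subn0.
- rewrite -csum_recl//; last by rewrite /u bin_small// mul0r mulr0.
  by congr csum; apply/funext => n; rewrite /u bin1 subn1/= mulrA [_ * a _]mulrC.
move=> h K hd.
have gz : geo_dominated (fun n => a n * (z0 + h) ^+ n).
  by apply: adm_geo_dominated => //; apply: le_lt_trans (cabsD _ _) _; lra.
have cl := @cvg_series_lincomb K u (fun k => csum (u k)) (fun k => h ^+ k) (fun k => cvg_csum (ud k)).
pose w n := a n * (z0 + h) ^+ n - \sum_(k < K) u k n * h ^+ k.
have wb n : cabs (w n) <= (M * (cabs h / d) ^+ K) * q ^+ n.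
  have -> : w n = a n * ((z0 + h) ^+ n - \sum_(k < K) 'C(n, k)%:R * z0 ^+ (n - k) * h ^+ k).
    by rewrite /w mulrBr mulr_sumr; congr (_ - _); apply: eq_bigr => k _; rewrite /u !mulrA.
  rewrite cabsM; apply: le_trans (ler_wpM2l (cabs_ge0 _) (binomial_tail n K (lexx _) (lexx _) hd d0)) _.
  rewrite mulrCA mulrC [M * _ * _]mulrAC ler_wpM2r// exprn_ge0// divr_ge0//; exact: ltW.
have -> : csum (fun n => a n * (z0 + h) ^+ n) - \sum_(k < K) csum (u k) * h ^+ k = csum w.
  apply/esym/csumE; rewrite (_ : series w = fun n => series (fun n => a n * (z0 + h) ^+ n) n -
     series (fun n => \sum_(k < K) u k n * h ^+ k) n).
    exact: cvgcB (cvg_csum gz) cl.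
  by apply/funext => n; rewrite /series/= -sumrB.
have := csum_tail qq wb 0; rewrite big_ord0 subr0 expr0.
by move=> /le_trans; apply; rewrite mul1r [leLHS]mulrAC.
Qed.

End PowerSeries.

(** * Derivatives, analyticity and continuity of power series *)

Section PowerSeriesCalculus.
Variable R : realType.
Implicit Types (a b : nat -> cplx R) (z h : cplx R).

(** Each of the n + 1 terms of 1 + q + ... + q^n is at least q^n. *)
Lemma natmul_exp_le (q : R) n : 0 <= q < 1 -> n.+1%:R * q ^+ n <= 1 / (1 - q).
Proof.
move=> /[dup] qq /andP[q0 q1].
apply: le_trans (_ : \sum_(0 <= i < n.+1) q ^+ i <= _).
  rewrite -[n.+1 in leLHS]card_ord -sum1_card natr_sum mulr_suml big_mkord.
  by apply: ler_sum => i _; rewrite mul1r ler_wiXn2l ?q0 ?ltW// -ltnS.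
by have := geometric_sum_le 0 n.+1 qq; rewrite expr0.
Qed.

(** A factor of order n is absorbed by the decay that [adm_geometric] provides, so it leaves the
    radius of convergence unharmed. This covers d/dz and the factor m + 2 nu of [astar]. *)
Lemma adm_growth a b (A : R) : adm a -> 0 <= A ->
  (forall n, cabs (b n) <= A * n.+1%:R * cabs (a n)) -> adm b.
Proof.
move=> aa A0 ba r rr; have [M [q [qq aM]]] := adm_geometric aa rr.
have M0 : 0 <= M.
  by have := aM 0%N; rewrite !expr0 !mulr1; apply: le_trans.
exists (A * (M * (1 / (1 - q)))) => n.
have r0 : 0 <= r ^+ n by rewrite exprn_ge0// (andP rr).1.
apply: le_trans (ler_wpM2r r0 (ba n)) _.
rewrite -!mulrA ler_wpM2l//.
apply: le_trans (ler_wpM2l (ler0n _ _) (aM n)) _.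
by rewrite mulrCA ler_wpM2l// natmul_exp_le.
Qed.

Lemma adm_shift a : adm a -> adm (fun n => a n.+1).
Proof.
move=> aa r /andP[r0 r1]; have [->|r_neq0] := eqVneq r 0.
  exists (cabs (a 1%N)) => n; rewrite expr0n; case: n => [|n]; rewrite ?mulr1//= mulr0//.
have [|M aM] := aa r; first by rewrite r0.
have {}r0 : 0 < r by rewrite lt_def r_neq0.
by exists (M / r) => n; rewrite ler_pdivlMr// -mulrA -exprSr.
Qed.

Lemma adm_unshift a : adm a -> adm (fun n => if n is m.+1 then a m else 0).
Proof.
move=> aa r rr; have [M aM] := aa r rr.
have M0 : 0 <= M by apply: le_trans (aM 0%N); rewrite expr0 mulr1.
exists M => -[|n]; first by rewrite cabs0 mul0r.
apply: le_trans (aM n); rewrite exprS mulrCA ler_piMl//.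
  by rewrite mulr_ge0// exprn_ge0// (andP rr).1.
by rewrite ltW// (andP rr).2.
Qed.

Lemma psum_lin (c : R[i]) a b : adm a -> adm b ->
  psum (fun n => c * a n + b n) = c *: psum a + psum b.
Proof.
move=> aa ab; apply/funext => z; rewrite fctE/= /psum.
have [z1|z1] := pselect (cabs z < 1); last first.
  by rewrite scalrfctE !on_discF// addr0 scaler0.
rewrite scalrfctE !on_discT//.
rewrite -[_ *: _]/(c * _) -csum_linear; try exact: adm_geo_dominated.
by congr csum; apply/funext => n; rewrite mulrDl mulrA.
Qed.

Lemma psum0 : psum (fun=> 0 : cplx R) = 0.
Proof.
apply/funext => z; rewrite /psum; have [z1|z1] := pselect (cabs z < 1); last exact: on_discF.
rewrite on_discT//; apply: csumE; rewrite (_ : series _ = cst 0); first exact: cvg_cst.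
by apply/funext => n; rewrite /series/= big1// => i _; rewrite mul0r.
Qed.

Lemma psum_recentre a z0 : adm a -> cabs z0 < 1 ->
  exists (d C : R) (c : nat -> cplx R), [/\ 0 < d, cabs z0 + d < 1,
    c 0%N = psum a z0,
    c 1%N = psum (fun n => n.+1%:R * a n.+1) z0 &
    forall z K, cabs (z - z0) <= d ->
      cabs (psum a z - \sum_(k < K) c k * (z - z0) ^+ k)
        <= C * (cabs (z - z0) / d) ^+ K].
Proof.
move=> aa z1; have [d [C [c [d0 zd c0 c1 H]]]] := recentre aa z1.
exists d, C, c; split => //; try by rewrite /psum on_discT.
move=> z K zz; have := H _ K zz; rewrite (addrC z0) subrK /psum on_discT//.
by have := cabs_triangle z0 z 0; rewrite !subr0; lra.
Qed.

Lemma psum_analytic a : adm a -> analytic_on (@disc R) (psum a).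
Proof.
move=> aa z0 /disc_cabs z1; have [d [C [c [d0 zd _ _ H]]]] := psum_recentre aa z1.
exists c; apply/nbhs_cabs; exists d => // z zz.
apply/cvg_cabs/cvgn_distP => e e0.
set q := cabs (z - z0) / d in H *.
have qq : 0 <= q by rewrite divr_ge0// ltW.
have q1 : `|q| < 1 by rewrite ger0_norm// ltr_pdivrMr// mul1r.
have /cvgn_distP/(_ e e0)[N NP] := @cvg_geometric R C q q1.
exists N => n Nn; rewrite subr0 ger0_norm// cabsBC.
have := H z n (ltW zz); rewrite /series/= big_mkord => /le_lt_trans; apply.
have := NP n Nn; rewrite subr0 /geometric/=; apply: le_lt_trans.
exact: ler_norm.
Qed.

Lemma derive1_psum a z : adm a -> cabs z < 1 ->
  derive1 (psum a) z = psum (fun n => n.+1%:R * a n.+1) z.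
Proof.
move=> aa z1; have [d [C [c [d0 zd c0 c1 H]]]] := psum_recentre aa z1.
have C0 : 0 <= C.
  by have := H z 0%N; rewrite subrr cabs0 expr0 mulr1 => /(_ (ltW d0)); apply: le_trans.
rewrite /derive1 -c1; apply: cvg_lim; first exact: norm_hausdorff.
move=> P /nbhs_cabs[e e0 eP].
(* The punctured neighbourhoods of the limit in [derive1] become ordinary ones with the premise
   [h != 0]. *)
apply: (_ : nbhs (0 : cplx R) [set h | h != 0 -> P (h^-1 *: (psum a (h + z) - psum a z))]).
have C1 : 0 < C + 1 by rewrite ltr_wpDl.
(* The second bound makes C |h| / d^2 < e; [C + 1] replaces [C] because [C] may be 0. *)
apply/nbhs_cabs; exists (Num.min d (e * d ^+ 2 / (C + 1))).
  by rewrite lt_min d0 divr_gt0// mulr_gt0// exprn_gt0.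
move=> h; rewrite subr0 lt_min => /andP[hd he] h0; apply: eP.
have := H (h + z) 2%N; rewrite addrK => /(_ (ltW hd)).
rewrite !big_ord_recl big_ord0 /= expr0 mulr1 addr0 c0 /bump/= expr1 => Hh.
have h0' : 0 < cabs h by rewrite cabs_gt0.
rewrite -(ltr_pM2l h0') -cabsM mulrBr.
rewrite -[_ *: _]/(h^-1 * _) mulVKf// [h * _]mulrC.
move: Hh; rewrite opprD addrA => /le_lt_trans; apply.
rewrite expr_div_n mulrA ltr_pdivrMr ?exprn_gt0// expr2 mulrA mulrC -!mulrA ltr_pM2l// mulrC.
move: he; rewrite ltr_pdivlMr//; apply: le_lt_trans.
by rewrite ler_wpM2l// lerDl.
Qed.

Lemma opA_psum a : adm a -> opA (psum a) = psum (fun n => n.+1%:R * a n.+1).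
Proof.
move=> aa; rewrite /opA [RHS]/psum -[RHS]on_disc_idem; apply: on_disc_ext => z z1.
by rewrite derive1_psum.
Qed.

Lemma csum_unshift (u : nat -> cplx R) z : geo_dominated u ->
  csum (fun n => if n is m.+1 then u m else 0) = csum u.
Proof.
move=> /cvg_csum/cvg_cabs/cvgn_distP cu; apply: csumE; apply/cvg_cabs/cvgn_distP => e /cu[N NP].
exists N.+1 => -[//|n] Nn; have := NP n Nn.
by rewrite /series/= big_nat_recl// add0r.
Qed.

Lemma adm_deriv a : adm a -> adm (fun n => n.+1%:R * a n.+1).
Proof.
move=> /adm_shift aa; apply: (adm_growth aa ler01) => n.
by rewrite cabsM cabs_nat mul1r.
Qed.

(** On monomials, z^2 d/dz + 2 nu z sends z^m to (m + 2 nu) z^(m+1). *)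
Definition astar (nu : R) a n : cplx R :=
  if n is m.+1 then (m%:R + 2 * nu)%:C * a m else 0.

Lemma adm_astar nu a : 0 <= nu -> adm a -> adm (astar nu a).
Proof.
move=> nu0 aa; apply: adm_unshift; apply: (adm_growth aa (_ : 0 <= 1 + 2 * nu)).
  by rewrite addr_ge0// mulr_ge0.
move=> n; rewrite cabsM ler_wpM2r// cabs_real.
have nu2 : 0 <= 2 * nu by rewrite mulr_ge0.
rewrite ger0_norm; last by rewrite addr_ge0.
rewrite [leRHS]mulrDl mul1r; apply: lerD; first by rewrite ler_nat.
by rewrite ler_peMr// ler1n.
Qed.

(** Rests on the factorisation z^2 f' + 2 nu z f = z (2 nu f + z f'): the outer z shifts the
    coefficients, and z f' multiplies the n-th one by n. *)
Lemma opAstar_psum nu a : 0 <= nu -> adm a -> opAstar nu (psum a) = psum (astar nu a).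
Proof.
move=> nu0 aa; rewrite /opAstar [RHS]/psum; apply: on_disc_ext => z z1.
rewrite derive1_psum// /psum !on_discT//.
have g1 := adm_geo_dominated aa z1.
have g2 := adm_geo_dominated (adm_deriv aa) z1.
have g3 : geo_dominated (fun n => n%:R * a n * z ^+ n).
  apply: adm_geo_dominated => //; apply: (adm_growth aa ler01) => n.
  by rewrite cabsM cabs_nat mul1r ler_wpM2r// ler_nat.
have -> : csum (fun n => astar nu a n * z ^+ n) =
   z * csum (fun n => (n%:R + 2 * nu)%:C * a n * z ^+ n).
  have g4 : geo_dominated (fun n => (n%:R + 2 * nu)%:C * a n * z ^+ n * z).
    apply: (geo_dominated_le (B := cabs z)
      (u := fun n => (n%:R + 2 * nu)%:C * a n * z ^+ n)); last first.
      by move=> n; rewrite [leLHS]cabsM mulrC.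
    exact: (adm_geo_dominated (adm_shift (adm_astar nu0 aa))).
  rewrite (_ : (fun n => _) = (fun n => if n is m.+1 then
      (m%:R + 2 * nu)%:C * a m * z ^+ m * z else 0)); last first.
    by apply/funext => -[|n]; rewrite /astar ?mul0r// exprSr mulrA.
  rewrite csum_unshift//; apply: csumE.
  rewrite [z * _]mulrC (_ : series _ = fun n => series (fun n => (n%:R + 2 * nu)%:C * a n * z ^+ n) n * z).
    by apply: cvgcMr; apply: cvg_csum; apply: (adm_geo_dominated (adm_shift (adm_astar nu0 aa))).
  by apply/funext => n; rewrite /series/= mulr_suml.
have -> : csum (fun n => (n%:R + 2 * nu)%:C * a n * z ^+ n) =
   (2 * nu)%:C * csum (fun n => a n * z ^+ n) + csum (fun n => n%:R * a n * z ^+ n).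
  rewrite -csum_linear//; congr csum; apply/funext => n.
  by rewrite rmorphD/= rmorph_nat addrC !mulrDl mulrA.
have <- : z * csum (fun n => n.+1%:R * a n.+1 * z ^+ n) = csum (fun n => n%:R * a n * z ^+ n).
  rewrite -[RHS]csum_recl ?mul0r//; apply/esym/csumE.
  rewrite (_ : series _ = fun n => z * series (fun n => n.+1%:R * a n.+1 * z ^+ n) n).
    by apply: cvgcMl; apply: cvg_csum.
  by apply/funext => n; rewrite /series/= mulr_sumr; apply: eq_bigr => i _; rewrite exprS mulrCA.
by ring.
Qed.

(** [analytic_on] gives only pointwise convergence near z0. Convergence at the single point z0 + r
    bounds |c_k| r^k, so closer to z0 the series is dominated by a geometric one and everything
    after the constant term is small. *)
Lemma analytic_continuous (phi : cplx R -> cplx R) (U : set (cplx R)) z0 :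
  analytic_on U phi -> U z0 -> forall e : R, 0 < e ->
  exists2 d : R, 0 < d & forall z, cabs (z - z0) < d -> cabs (phi z - phi z0) < e.
Proof.
move=> an Uz e e0; have [c /nbhs_cabs[d d0 dP]] := an _ Uz.
pose r := d / 2; have r0 : 0 < r by rewrite divr_gt0.
have rd : r < d by rewrite /r; lra.
have [M cM] : exists M, forall k, cabs (c k) * r ^+ k <= M.
  have := dP (z0 + r%:C); rewrite addrAC subrr add0r cabs_real gtr0_norm// => /(_ rd).
  move=> /cvg_cabs/cvgn_distP/(_ 1 ltr01)[N NP].
  (* From [N] on, a term is the difference of two partial sums within 1 of the limit, hence at most
     2; the earlier terms enter the maximum. *)
  exists (\big[Num.max/2]_(k < N) (cabs (c k) * r ^+ k)) => k.
  have [kN|Nk] := ltnP k N.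
    exact: (le_bigmax _ (fun k : 'I_N => cabs (c k) * r ^+ k) (Ordinal kN)).
  apply: le_trans (bigmax_ge_id _ _ _ _).
  have h1 := NP k Nk; have h2 := NP k.+1 (leqW Nk).
  move: h1 h2; rewrite !subr0 !ger0_norm// /series/= big_nat_recr//=.
  set s := \sum_(_ <= _ < _) _; set t := c k * _; set p := phi _.
  have -> : cabs (c k) * r ^+ k = cabs t.
    by rewrite /t cabsM cabsX cabs_real gtr0_norm.
  have -> : cabs t = cabs ((s + t - p) - (s - p)).
    by congr cabs; ring.
  move=> h1 h2; apply: le_trans (cabsB _ _) _; lra.
have phi0 : phi z0 = c 0%N.
  have := dP z0; rewrite subrr cabs0 => /(_ d0)/csumE <-; apply: csumE.
  apply/cvg_cabs/cvgn_distP => e' e'0; exists 1%N => -[//|n] _.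
  rewrite /series/= big_nat_recl//= big1 ?addr0; last first.
    by move=> i _; rewrite expr0n mulr0.
  by rewrite expr0 mulr1 subrr cabs0 subr0 normr0.
have M0 : 0 <= M by apply: le_trans (cM 0%N); rewrite expr0 mulr1.
(* With q = |z - z0| / r, the first bound gives 1 - q > 1/2 and the second (M + 1) q < e / 4. *)
pose d' := Num.min (r / 2) (e * r / (4 * (M + 1))).
exists d'.
  by rewrite lt_min !divr_gt0 ?mulr_gt0 ?ltr_wpDl.
move=> z; rewrite lt_min => /andP[zr ze].
have zd : cabs (z - z0) < d by lra.
set h := z - z0 in zr ze zd *.
pose q := cabs h / r.
have qq : 0 <= q < 1.
  by rewrite divr_ge0 ?(ltW r0)//= ltr_pdivrMr// mul1r; lra.
have /csumE <- := dP _ zd; rewrite phi0.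
have uM n : cabs (c n * h ^+ n) <= M * q ^+ n.
  rewrite cabsM cabsX /q expr_div_n mulrA ler_pdivlMr ?exprn_gt0//.
  by rewrite mulrAC ler_wpM2r// exprn_ge0.
have := csum_tail qq uM 1; rewrite big_ord_recl big_ord0 addr0 expr0 mulr1 expr1.
move=> /le_lt_trans; apply.
have qh : q < 1 / 2 by rewrite /q ltr_pdivrMr//; lra.
have qe : q < e / (4 * (M + 1)).
  by rewrite /q ltr_pdivrMr// mulrAC.
have M1 : 0 < 4 * (M + 1) by lra.
move: qe; rewrite ltr_pdivlMr// => qe.
have q1 : 0 < 1 - q by lra.
rewrite mulrA ltr_pdivrMr//.
have q0 : 0 <= q by case/andP: qq.
have : M * q <= (M + 1) * q by rewrite ler_wpM2r// lerDl.
have : e * (1 / 2) < e * (1 - q) by rewrite ltr_pM2l//; lra.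
lra.
Qed.

End PowerSeriesCalculus.

(** * Measure in the plane *)

Section PlaneRotation.
Variable R : realType.
Local Notation T := (measurableTypeR R * measurableTypeR R)%type.
Local Notation mu := (@lebesgue_measure R).

(** The translated measure agrees with Lebesgue measure on half-open intervals, and this determines
    it. *)
Lemma lebesgue_measure_translate (c : R) (A : set R) : measurable A ->
  mu ((fun x => x + c) @^-1` A) = mu A.
Proof.
move=> mA.
have mt : measurable_fun setT ((fun x => x + c) : measurableTypeR R -> measurableTypeR R).
  by apply: measurable_funD => //; exact: measurable_cst.
pose m := isMeasurableFun.Build _ _ _ _ _ mt.
pose t : {mfun _ >-> _} := HB.pack (fun x : measurableTypeR R => (x + c : measurableTypeR R)) m.
rewrite [RHS](_ : _ = pushforward mu t A)//.
apply: lebesgue_measure_unique => //= _ [[a b]] _ <-.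
rewrite /pushforward (_ : _ @^-1` _ = [set` `](a - c), (b - c)]]).
  rewrite !lebesgue_measure_itv/= !lte_fin ltrD2r; case: ifP => // _.
  by rewrite -!EFinB; congr (_%:E); ring.
by apply/seteqP; split => x /=; rewrite !in_itv/= ltrBlDr lerBrDr.
Qed.

Lemma measurable_shear1 (a : R) : measurable_fun setT (fun p : T => (p.1 + a * p.2, p.2) : T).
Proof.
apply: measurable_fun_pair; last exact: measurable_snd.
by apply: measurable_funD => //; apply: measurable_funM => //; exact: measurable_snd.
Qed.

Lemma measurable_shear2 (a : R) : measurable_fun setT (fun p : T => (p.1, p.2 + a * p.1) : T).
Proof.
apply: measurable_fun_pair; first exact: measurable_fst.
by apply: measurable_funD => //; apply: measurable_funM => //; exact: measurable_fst.
Qed.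

Lemma area_shear2 (a : R) (A : set T) : measurable A ->
  @area R ((fun p : T => (p.1, p.2 + a * p.1) : T) @^-1` A) = @area R A.
Proof.
move=> mA; rewrite /area /product_measure1; apply: eq_integral => x _ /=.
rewrite -(lebesgue_measure_translate (a * x) (measurable_xsection x mA)).
by rewrite !xsectionE.
Qed.

(** This shear translates horizontal sections, so the area is first written with the other order of
    integration; both orders agree by uniqueness of the product measure. *)
Lemma area_shear1 (a : R) (A : set T) : measurable A ->
  @area R ((fun p : T => (p.1 + a * p.2, p.2) : T) @^-1` A) = @area R A.
Proof.
have swap X : measurable X -> @area R X = (mu \x^ mu)%E X.
  move=> mX; apply: product_measure_unique => // B C mB mC; exact: product_measure2E.
move=> mA; rewrite !swap//; last first.
  by rewrite -[X in measurable X]setTI; apply: measurable_shear1.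
rewrite /product_measure2; apply: eq_integral => y _ /=.
rewrite -(lebesgue_measure_translate (a * y) (measurable_ysection y mA)).
by rewrite !ysectionE.
Qed.

(** The triple 3, 4, 5 gives rational cosine and sine and the rational half-angle tangent 1/2, which
    is, up to sign, the parameter of the outer shears in [rotpE]. *)
Definition rotz : R[i] := (3 / 5) +i* (4 / 5).

Definition rotp (p : T) : T := (3 / 5 * p.1 - 4 / 5 * p.2, 4 / 5 * p.1 + 3 / 5 * p.2).

Lemma pt_rotp p : pt (rotp p) = rotz * pt p.
Proof. by rewrite /pt /rotz; simpc; congr (_ +i* _); rewrite addrC. Qed.

(* A rotation is a product of three shears. *)
Lemma rotpE : rotp = (fun p : T => (p.1 + (- (1 / 2)) * p.2, p.2) : T) \o
  (fun p : T => (p.1, p.2 + (4 / 5) * p.1) : T) \o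
  (fun p : T => (p.1 + (- (1 / 2)) * p.2, p.2) : T).
Proof.
apply/funext => -[x y] /=; rewrite /rotp/=; by congr pair; lra.
Qed.

Lemma measurable_rotp : measurable_fun setT rotp.
Proof.
rewrite rotpE; apply: measurableT_comp (measurable_shear1 _).
by apply: measurableT_comp (measurable_shear2 _); exact: measurable_shear1.
Qed.

Lemma area_rotp (A : set T) : measurable A -> @area R (rotp @^-1` A) = @area R A.
Proof.
move=> mA; rewrite rotpE !comp_preimage area_shear1; last first.
  rewrite -[X in measurable X]setTI; apply: measurable_shear2 => //.
  by rewrite -[X in measurable X]setTI; apply: measurable_shear1.
rewrite area_shear2 ?area_shear1//.
by rewrite -[X in measurable X]setTI; apply: measurable_shear1.
Qed.

Lemma cabs_rotz : cabs rotz = 1.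
Proof.
by rewrite cabsE/= (_ : _ + _ = 1) ?sqrtr1//; lra.
Qed.

(* [(3 + 4i)^k] is congruent to [3 + 4i] modulo 5. *)
Lemma rotz_expS_neq1 k : rotz ^+ k.+1 != 1.
Proof.
have [x [y h]] : exists x y : int, (5 ^+ k.+1)%:C * rotz ^+ k.+1 =
    ((5 * x + 3)%:~R : R) +i* ((5 * y + 4)%:~R : R).
  elim: k => [|k [x [y IH]]].
    exists 0, 0; rewrite !expr1 /rotz !mulr0 !add0r; simpc.
    by congr (_ +i* _); lra.
  (* (3 + 4i)^2 = -7 + 24i, where -7 = 5(-2) + 3 and 24 = 5(4) + 4; the terms in x and y come from
     (3 + 4i)(x + iy). *)
  exists (3 * x - 4 * y - 2), (4 * x + 3 * y + 4).
  rewrite exprS [rotz ^+ _]exprS rmorphM/= mulrACA IH /rotz; simpc.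
  by congr (_ +i* _); rewrite !(rmorphD, rmorphM, rmorphN)/=; lra.
apply/negP => /eqP e; move: h; rewrite e mulr1 => -[_ /esym/eqP].
by rewrite intr_eq0 => /eqP; lia.
Qed.

End PlaneRotation.

(** * Measurability of continuous functions on the disc *)

Section PlaneMeasurability.
Variable R : realType.
Local Notation T := (measurableTypeR R * measurableTypeR R)%type.
Local Notation mu := (@lebesgue_measure R).

Definition ptball (p : T) (e : R) : set T :=
  [set` `](p.1 - e), (p.1 + e)[] `*` [set` `](p.2 - e), (p.2 + e)[].

Lemma ptballP (p q : T) (e : R) :
  ptball p e q <-> `|q.1 - p.1| < e /\ `|q.2 - p.2| < e.
Proof.
rewrite /ptball/= !in_itv/= !ltr_distl.
by split => -[/andP[? ?] /andP[? ?]]; split; apply/andP.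
Qed.

Lemma measurable_ptball p e : measurable (ptball p e).
Proof. by apply: measurableX; exact: measurable_itv. Qed.

(** Squares with rational centre and half-side 1/(k+1) form a countable base; the union runs over
    codes of those contained in [U], all other numbers giving the empty set. *)
Lemma open_measurable_plane (U : set T) :
  (forall p, U p -> exists2 e : R, 0 < e & ptball p e `<=` U) -> measurable U.
Proof.
move=> oU.
pose box (t : rat * rat * nat) := ptball (ratr t.1.1, ratr t.1.2) (t.2.+1%:R^-1).
pose F n := if unpickle n is Some t then
  (if `[< box t `<=` U >] then box t else set0) else set0.
have -> : U = \bigcup_n F n.
  apply/seteqP; split => [p Up|p [n _]]; last first.
    rewrite /F; case: unpickle => // t; case: asboolP => // tU; exact: tU.
  have [e e0 eU] := oU p Up.
  (* A square of half-side below e/2 that contains [p] stays within the square of half-side [e]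
     about [p]. *)
  have [k ke] : exists k : nat, k.+1%:R^-1 < e / 2 :> R.
    have [k _ kP] := near_infty_natSinv_lt (PosNum (divr_gt0 e0 (ltr0Sn R 1))).
    by exists k; exact: (kP k (leqnn _)).
  set v : R := k.+1%:R^-1 in ke.
  have v0 : 0 < v by rewrite invr_gt0.
  have ke2 (x : R) : x - v < x + v by lra.
  have [x] := @rat_in_itvoo R (p.1 - v) (p.1 + v) (ke2 _).
  have [y] := @rat_in_itvoo R (p.2 - v) (p.2 + v) (ke2 _).
  rewrite !in_itv/= -!ltr_distl => hy hx.
  exists (pickle (x, y, k)); first exact: I.
  rewrite /F pickleK.
  have bU : box (x, y, k) `<=` U.
    move=> q /ptballP/=; rewrite -/v => -[qx qy]; apply: eU; apply/ptballP; split.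
      by apply: le_lt_trans (ler_distD (ratr x) _ _) _; lra.
    by apply: le_lt_trans (ler_distD (ratr y) _ _) _; lra.
  by rewrite asboolT//; apply/ptballP => /=; rewrite ![`|_ - ratr _|]distrC.
apply: bigcupT_measurable => n; rewrite /F; case: unpickle => // t.
by case: ifP => // _; exact: measurable_ptball.
Qed.

Definition subdisc (r : R) : set T := [set p | cabs (pt p) < r].

Lemma preimage_disc : (@pt R) @^-1` (@disc R) = subdisc 1.
Proof. by apply/seteqP; split => p /disc_cabs. Qed.

Lemma cabs_pt_le (p q : T) : cabs (pt p - pt q) <= `|p.1 - q.1| + `|p.2 - q.2|.
Proof. exact: le_trans (cabs_le_ReIm _) _. Qed.

Definition continuous_disc (f : cplx R -> R) := forall z0 (e : R), cabs z0 < 1 -> 0 < e ->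
  exists2 d : R, 0 < d & forall z, cabs (z - z0) < d -> `|f z - f z0| < e.

Lemma continuous_disc_measurable (f : cplx R -> R) (r : R) : r <= 1 ->
  continuous_disc f -> measurable_fun (subdisc r) (f \o @pt R).
Proof.
move=> r1 cf _; have mD : measurable (subdisc r).
  apply: open_measurable_plane => p Dp.
  exists ((r - cabs (pt p)) / 2); first by rewrite divr_gt0 ?subr_gt0.
  move=> q /ptballP[q1 q2]; rewrite /subdisc/=.
  have := cabs_triangle (pt p) (pt q) 0; rewrite !subr0 => /le_lt_trans; apply.
  have := cabs_pt_le q p; lra.
suff : measurable_fun (subdisc r) (f \o @pt R) by apply.
move=> _.
apply: (measurability _ (RGenOInfty.measurableE R)) => //.
move=> /= _ [_ [a ->] <-]; rewrite preimage_itvoy.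
apply: open_measurable_plane => p [Dp /= fp].
have [|d d0 dP] := cf (pt p) (f (pt p) - a) (lt_le_trans Dp r1); first by rewrite subr_gt0.
exists (Num.min (d / 2) ((r - cabs (pt p)) / 2)).
  by rewrite lt_min !divr_gt0 ?subr_gt0.
move=> q /ptballP; rewrite !lt_min => -[/andP[q1 q2] /andP[q3 q4]].
have qp := cabs_pt_le q p; split.
  have := cabs_triangle (pt p) (pt q) 0; rewrite !subr0 => /le_lt_trans; apply; lra.
have /dP : cabs (pt q - pt p) < d by lra.
by rewrite /= ltr_distlC; lra.
Qed.

Lemma measurable_subdisc r : r <= 1 -> measurable (subdisc r).
Proof.
move=> r1; apply: open_measurable_plane => p Dp.
exists ((r - cabs (pt p)) / 2); first by rewrite divr_gt0 ?subr_gt0.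
move=> q /ptballP[q1 q2]; rewrite /subdisc/=.
have := cabs_triangle (pt p) (pt q) 0; rewrite !subr0 => /le_lt_trans; apply.
have := cabs_pt_le q p; lra.
Qed.

Lemma area_rect (a b c d : R) : a < b -> c < d ->
  @area R ([set` `]a, b[] `*` [set` `]c, d[]) = ((b - a) * (d - c))%:E.
Proof.
move=> ab cd; rewrite /area product_measure1E//; try exact: measurable_itv.
rewrite -[LHS]/(mu [set` `]a, b[] * mu [set` `]c, d[])%E.
by rewrite !lebesgue_measure_itv/= !lte_fin ab cd -!EFinB -EFinM.
Qed.

Lemma area_subdisc_lty r : r <= 1 -> (@area R (subdisc r) < +oo)%E.
Proof.
move=> r1; apply: (@le_lt_trans _ _ (@area R (ptball (0, 0) 1))).
  apply: le_measure; rewrite ?inE; [exact: measurable_subdisc|exact: measurable_ptball|].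
  move=> p Dp; apply/ptballP; rewrite /= !subr0.
  split; [apply: le_lt_trans (lt_le_trans Dp r1); exact: (normr_Re (pt p))|].
  apply: le_lt_trans (lt_le_trans Dp r1); exact: (normr_Im (pt p)).
by rewrite /ptball area_rect ?ltry//; lra.
Qed.

Definition cmeasurable (f : cplx R -> cplx R) :=
  measurable_fun (subdisc 1) (fun p => complex.Re (f (pt p))) /\
  measurable_fun (subdisc 1) (fun p => complex.Im (f (pt p))).

Lemma cmeasurable_analytic f : analytic_on (@disc R) f -> cmeasurable f.
Proof.
move=> an; split.
- apply: (@continuous_disc_measurable (fun z => complex.Re (f z))) => // z0 e /disc_cabs z1 e0.
  have [d d0 dP] := analytic_continuous an z1 e0; exists d => // z /dP.
  apply: le_lt_trans; have := normr_Re (f z - f z0).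
  by case: (f z) => ? ?; case: (f z0).
- apply: (@continuous_disc_measurable (fun z => complex.Im (f z))) => // z0 e /disc_cabs z1 e0.
  have [d d0 dP] := analytic_continuous an z1 e0; exists d => // z /dP.
  apply: le_lt_trans; have := normr_Im (f z - f z0).
  by case: (f z) => ? ?; case: (f z0).
Qed.

Lemma cmeasurableD f g : cmeasurable f -> cmeasurable g -> cmeasurable (fun z => f z + g z).
Proof.
move=> [f1 f2] [g1 g2]; split.
  rewrite (_ : (fun p => _) = (fun p => complex.Re (f (pt p))) \+ (fun p => complex.Re (g (pt p)))).
    exact: measurable_funD.
  by apply/funext => p /=; case: (f _) => ? ?; case: (g _).
rewrite (_ : (fun p => _) = (fun p => complex.Im (f (pt p))) \+ (fun p => complex.Im (g (pt p)))).
  exact: measurable_funD.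
by apply/funext => p /=; case: (f _) => ? ?; case: (g _).
Qed.

Lemma cmeasurableM f g : cmeasurable f -> cmeasurable g -> cmeasurable (fun z => f z * g z).
Proof.
move=> [f1 f2] [g1 g2]; split.
  rewrite (_ : (fun p => _) = (fun p => complex.Re (f (pt p)) * complex.Re (g (pt p)))
     \- (fun p => complex.Im (f (pt p)) * complex.Im (g (pt p)))).
    by apply: measurable_funB; apply: measurable_funM.
  by apply/funext => p /=; case: (f _) => ? ?; case: (g _) => ? ?; simpc.
rewrite (_ : (fun p => _) = (fun p => complex.Re (f (pt p)) * complex.Im (g (pt p)))
     \+ (fun p => complex.Im (f (pt p)) * complex.Re (g (pt p)))).
  by apply: measurable_funD; apply: measurable_funM.
by apply/funext => p /=; case: (f _) => ? ?; case: (g _) => ? ?; simpc.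
Qed.

Lemma cmeasurable_cst c : cmeasurable (fun=> c).
Proof. by split; exact: measurable_cst. Qed.

Lemma cmeasurable_id : cmeasurable id.
Proof. by split; apply: measurable_funTS; [exact: measurable_fst|exact: measurable_snd]. Qed.

Lemma cmeasurableX f n : cmeasurable f -> cmeasurable (fun z => f z ^+ n).
Proof.
move=> mf; elim: n => [|n IH]; first by under eq_fun do rewrite expr0; exact: cmeasurable_cst.
by under eq_fun do rewrite exprS; exact: cmeasurableM.
Qed.

Lemma cmeasurable_conj f : cmeasurable f -> cmeasurable (fun z => conjc (f z)).
Proof.
move=> [f1 f2]; split.
  by rewrite (_ : (fun p => _) = (fun p => complex.Re (f (pt p))))//; apply/funext => p; case: (f _).
rewrite (_ : (fun p => _) = \- (fun p => complex.Im (f (pt p)))); last first.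
  by apply/funext => p /=; case: (f _).
exact: measurable_funN.
Qed.

Lemma cmeasurable_sum N (f : nat -> cplx R -> cplx R) : (forall n, cmeasurable (f n)) ->
  cmeasurable (fun z => \sum_(n < N) f n z).
Proof.
move=> mf; elim: N => [|N IH]; first by under eq_fun do rewrite big_ord0; exact: cmeasurable_cst.
by under eq_fun do rewrite big_ord_recr; exact: cmeasurableD.
Qed.

Lemma cmeasurable_cabs2 f : cmeasurable f -> measurable_fun (subdisc 1) (fun p => cabs (f (pt p)) ^+ 2).
Proof.
move=> [f1 f2]; under eq_fun do rewrite cabs_sqr.
by apply: measurable_funD; apply: measurable_funX.
Qed.

Lemma measurable_weight nu : measurable_fun (subdisc 1) (fun p => weight nu (pt p)).
Proof.
have /= m := cmeasurable_cabs2 cmeasurable_id.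
rewrite /weight; apply: (measurableT_comp (measurable_powR _)).
by apply: measurable_funB => //; exact: measurable_cst.
Qed.

End PlaneMeasurability.

(** * The weighted norm of a power series *)

Section Orthogonality.
Variables (R : realType) (nu : R).
Hypothesis hnu : 1 < nu.
Local Notation T := (measurableTypeR R * measurableTypeR R)%type.
Local Notation mu := (@area R).
Local Notation W := (weight nu).

Lemma weight_ge0 z : 0 <= W z.
Proof. exact: powR_ge0. Qed.

Lemma weight_le1 z : cabs z < 1 -> W z <= 1.
Proof.
move=> z1; rewrite /weight -/(cabs z).
have z2 : 0 <= 1 - cabs z ^+ 2 <= 1.
  by rewrite subr_ge0 exprn_ile1 ?(ltW z1)//= gerBl exprn_ge0.
have nu2 : 0 <= 2 * nu - 2 by move: hnu; lra.
rewrite -[leRHS](congr1 (fun f => f (2 * nu - 2)) (powR1 R)); case/andP: z2 => z2 z3.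
by apply: ge0_ler_powR => //; rewrite nnegrE.
Qed.

Lemma weight_rot z : W (rotz R * z) = W z.
Proof. by rewrite /weight -/(cabs _) cabsM cabs_rotz mul1r. Qed.

Lemma integrable_bounded (r M : R) (h : T -> R) : r <= 1 ->
  measurable_fun (subdisc 1) h -> (forall p, subdisc r p -> `|h p| <= M) ->
  mu.-integrable (subdisc r) (EFin \o h).
Proof.
move=> r1 mh hM.
apply: measurable_bounded_integrable; first exact: measurable_subdisc.
- exact: area_subdisc_lty.
- apply: measurable_funS mh; first exact: measurable_subdisc.
  by move=> p; rewrite /subdisc/= => /lt_le_trans; apply.
- by exists M; split; [exact: num_real|move=> x Mx p /hM /le_trans; apply; exact: ltW].
Qed.

(** Change of variables: the image of [area] under [rotp] is [area], and discs about 0 are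
    invariant. *)
Lemma Rintegral_rot (h : cplx R -> R) (r M : R) : r <= 1 ->
  measurable_fun (subdisc 1) (h \o @pt R) ->
  (forall p, subdisc r p -> `|h (pt p)| <= M) ->
  \int[mu]_(p in subdisc r) h (pt p) = \int[mu]_(p in subdisc r) h (rotz R * pt p).
Proof.
move=> r1 mh hM; have mD := measurable_subdisc r1.
have rotD : @rotp R @^-1` subdisc r = subdisc r.
  by apply/seteqP; split => p; rewrite /subdisc/= pt_rotp cabsM cabs_rotz mul1r.
(* Extended by 0 off the disc, the integrand is measurable on the whole plane and can be composed
   with the rotation. *)
pose f : T -> \bar R := (EFin \o (h \o @pt R)) \_ (subdisc r).
have mf : measurable_fun setT f.
  apply: (iffLR (measurable_restrictT _ _)); first exact: mD.
  apply/measurable_EFinP.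
  apply: measurable_funS mh; first exact: measurable_subdisc.
  by move=> p; rewrite /subdisc/= => /lt_le_trans; apply.
have fE p : subdisc r p -> f p = (h (pt p))%:E by move=> Dp; rewrite /f patchT// inE.
have fr p : subdisc r p -> f (rotp p) = (h (rotz R * pt p))%:E.
  by move=> Dp; rewrite fE ?pt_rotp//; move: Dp; rewrite -{1}rotD.
have mr := @measurable_rotp R.
have mfr : measurable_fun setT (f \o @rotp R) by exact: measurableT_comp.
have ie : mu.-integrable (@rotp R @^-1` subdisc r) (f \o @rotp R).
  rewrite rotD; apply: (@eq_integrable _ _ _ _ _ mD (EFin \o (fun p => h (rotz R * pt p)))).
    by move=> p; rewrite inE => Dp /=; rewrite fr.
  apply: measurable_bounded_integrable => //; first exact: area_subdisc_lty.
    apply/measurable_EFinP; apply: (eq_measurable_fun (f \o @rotp R)).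
      by move=> p; rewrite inE => Dp /=; rewrite fr.
    exact: measurable_funTS.
  exists M; split; [exact: num_real|move=> x Mx p Dp].
  rewrite /= -pt_rotp; apply: le_trans (hM _ _) (ltW Mx).
  by move: Dp; rewrite -{1}rotD.
rewrite /Rintegral; congr fine.
transitivity (\int[mu]_(p in subdisc r) f p)%E.
  by apply: eq_integral => p; rewrite inE => /fE.
transitivity (\int[pushforward mu (@rotp R)]_(p in subdisc r) f p)%E.
  apply: eq_measure_integral => A mA _; rewrite /pushforward; exact/esym/area_rotp.
apply: etrans (integral_pushforward mr mf ie mD) _.
by rewrite rotD; apply: eq_integral => p; rewrite inE => Dp /=; rewrite fr.
Qed.

(** Real-valued on purpose: letting [c] run through all complex numbers makes real integrals carry
    the full information of the complex one. *)
Definition mono (c : R[i]) n m (z : cplx R) : R :=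
  complex.Re (c * z ^+ n * conjc z ^+ m) * W z.

Lemma mono_bound c n m p : subdisc 1 p -> `|mono c n m (pt p)| <= cabs c.
Proof.
rewrite /subdisc/= => z1; rewrite /mono normrM [`|W _|]ger0_norm ?weight_ge0//.
apply: le_trans (_ : _ <= cabs c * 1) _; last by rewrite mulr1.
apply: ler_pM; rewrite ?weight_ge0 ?weight_le1//.
apply: le_trans (normr_Re _) _; rewrite !cabsM !cabsX.
have -> : cabs (conjc (pt p)) = cabs (pt p) by rewrite /cabs normcJ.
by rewrite -mulrA ler_piMr// -exprD exprn_ile1// ltW.
Qed.

Lemma measurable_mono c n m : measurable_fun (subdisc 1) (mono c n m \o @pt R).
Proof.
rewrite /mono; apply: measurable_funM; last exact: measurable_weight.
have h : cmeasurable (fun z : cplx R => c * z ^+ n * conjc z ^+ m).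
  apply: cmeasurableM; last by apply: cmeasurableX; apply: cmeasurable_conj; exact: cmeasurable_id.
  by apply: cmeasurableM; [exact: cmeasurable_cst|apply: cmeasurableX; exact: cmeasurable_id].
by case: h.
Qed.

Lemma integrable_mono r c n m : r <= 1 ->
  mu.-integrable (subdisc r) (EFin \o (mono c n m \o @pt R)).
Proof.
move=> r1; apply: (integrable_bounded (M := cabs c)) => //; first exact: measurable_mono.
by move=> p Dp; apply: mono_bound; exact: lt_le_trans Dp r1.
Qed.

(** As |rotz| = 1, common powers of [rotz] and its conjugate cancel, and a positive power of one of
    them is left. *)
Lemma rotz_mixed_neq1 n m : n != m -> rotz R ^+ n * conjc (rotz R) ^+ m != 1.
Proof.
have u : rotz R * conjc (rotz R) = 1.
  by rewrite -sqr_normc normr_cabs cabs_rotz expr1n.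
rewrite neq_ltn => /orP[nm|mn].
- rewrite -(subnKC (ltnW nm)) exprD mulrA -exprMn u expr1n mul1r.
  rewrite -rmorphXn -(rmorph1 (@conjc R)) (inj_eq (can_inj (@conjcK R))).
  by case: (m - n)%N (subn_gt0 n m) => [|k _]; rewrite ?nm// rotz_expS_neq1.
- rewrite -(subnK (ltnW mn)) exprD -mulrA -exprMn u expr1n mulr1.
  by case: (n - m)%N (subn_gt0 m n) => [|k _]; rewrite ?mn// rotz_expS_neq1.
Qed.

(* The integral [J c] of [Re (c z^n conj(z)^m)] is additive in [c] and, by
   rotation, [J c = J (c v)] for some [v <> 1]; hence [J (c (1 - v)) = 0]. *)
Lemma mono_orthogonal r c n m : r <= 1 -> n != m ->
  \int[mu]_(p in subdisc r) mono c n m (pt p) = 0.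
Proof.
move=> r1 nm; have mD := measurable_subdisc r1.
pose v := rotz R ^+ n * conjc (rotz R) ^+ m.
have v1 : 1 - v != 0 by rewrite subr_eq0 eq_sym rotz_mixed_neq1.
pose d := c / (1 - v).
have -> : c = d - d * v by rewrite -[X in X - _]mulr1 -mulrBr /d divfK.
transitivity (\int[mu]_(p in subdisc r) (mono d n m (pt p) - mono (d * v) n m (pt p))).
  apply: eq_Rintegral => p _; rewrite /mono -mulrBl; congr (_ * _).
  by rewrite 2!mulrBl; case: (d * _ * _) => ? ?; case: (_ * _ * _).
rewrite RintegralB//; try exact: integrable_mono.
apply/eqP; rewrite subr_eq0; apply/eqP.
have db p : subdisc r p -> `|mono d n m (pt p)| <= cabs d.
  by move=> Dp; apply: mono_bound; exact: lt_le_trans Dp r1.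
apply: etrans (Rintegral_rot r1 (measurable_mono d n m) db) _.
apply: eq_Rintegral => p _; rewrite /mono weight_rot; congr (complex.Re _ * _).
by rewrite /v rmorphM !exprMn; ring.
Qed.

(** For [r = 1] the value is the Beta integral pi B(n + 1, 2 nu - 1). Radii below 1 serve the limits
    behind Parseval's identity. *)
Definition moment (r : R) n : R := \int[mu]_(p in subdisc r) (cabs (pt p ^+ n) ^+ 2 * W (pt p)).

Definition energy (r : R) (f : cplx R -> cplx R) : \bar R :=
  (\int[mu]_(p in subdisc r) (cabs (f (pt p)) ^+ 2 * W (pt p))%:E)%E.

Lemma Rintegral_sum r N (h : nat -> T -> R) : r <= 1 ->
  (forall n, mu.-integrable (subdisc r) (EFin \o h n)) ->
  mu.-integrable (subdisc r) (EFin \o (fun p => \sum_(n < N) h n p)) /\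
  \int[mu]_(p in subdisc r) (\sum_(n < N) h n p) = \sum_(n < N) \int[mu]_(p in subdisc r) h n p.
Proof.
move=> r1 ih; have mD := measurable_subdisc r1; elim: N => [|N [IH1 IH2]].
  split.
    under eq_fun do rewrite big_ord0.
    exact: integrable0.
  under eq_Rintegral do rewrite big_ord0.
  by rewrite big_ord0 Rintegral_cst// mul0r.
split.
  rewrite (_ : _ \o _ = (EFin \o (fun p => \sum_(n < N) h n p)%R) \+ (EFin \o h N))%E.
    exact: integrableD.
  by apply/funext => p /=; rewrite big_ord_recr.
under eq_Rintegral do rewrite big_ord_recr.
by rewrite RintegralD// IH2 big_ord_recr.
Qed.

Lemma cabs_sqr_conj (w : R[i]) : cabs w ^+ 2 = complex.Re (w * conjc w).
Proof. by rewrite cabs_sqr; case: w => x y; simpc; rewrite /= !expr2. Qed.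

Lemma cabs2_sum_mono N (b : nat -> cplx R) z :
  cabs (\sum_(n < N) b n * z ^+ n) ^+ 2 * W z =
  \sum_(n < N) \sum_(m < N) mono (b n * conjc (b m)) n m z.
Proof.
have -> : cabs (\sum_(n < N) b n * z ^+ n) ^+ 2 =
    \sum_(n < N) \sum_(m < N) complex.Re (b n * conjc (b m) * z ^+ n * conjc z ^+ m).
  rewrite cabs_sqr_conj rmorph_sum/= mulr_suml Re_sum.
  apply: eq_bigr => n _; rewrite mulr_sumr Re_sum; apply: eq_bigr => m _.
  by rewrite rmorphM rmorphXn/=; congr complex.Re; ring.
rewrite mulr_suml; apply: eq_bigr => n _; rewrite mulr_suml.
by apply: eq_bigr.
Qed.

Lemma mono_diag (b : R[i]) n z : mono (b * conjc b) n n z = cabs b ^+ 2 * (cabs (z ^+ n) ^+ 2 * W z).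
Proof.
rewrite /mono mulrA; congr (_ * _).
rewrite -mulrA -exprMn -!sqr_normc !normr_cabs -!rmorphXn -rmorphM/= cabsX.
by rewrite exprAC.
Qed.

(** Squaring the sum gives a double sum of [mono], whose off-diagonal integrals vanish by
    [mono_orthogonal]. *)
Lemma energy_poly r N (b : nat -> cplx R) : r <= 1 ->
  energy r (fun z => \sum_(n < N) b n * z ^+ n) =
  (\sum_(n < N) cabs (b n) ^+ 2 * moment r n)%:E.
Proof.
move=> r1; have mD := measurable_subdisc r1.
have H1 n := @Rintegral_sum r N (fun m p => mono (b n * conjc (b m)) n m (pt p)) r1
  (fun m => integrable_mono _ _ _ r1).
have H2 := @Rintegral_sum r N (fun n p => \sum_(m < N) mono (b n * conjc (b m)) n m (pt p)) r1
  (fun n => (H1 n).1).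
transitivity (\int[mu]_(p in subdisc r)
   (\sum_(n < N) \sum_(m < N) mono (b n * conjc (b m)) n m (pt p))%:E)%E.
  by rewrite /energy; apply: eq_integral => p _; rewrite cabs2_sum_mono.
rewrite -[LHS]fineK; last by apply: integrable_fin_num => //; exact: H2.1.
congr EFin; rewrite -[LHS]/(Rintegral _ _ _) H2.2; apply: eq_bigr => n _.
rewrite (H1 n).2 (bigD1 n)//= big1 ?addr0; last first.
  by move=> m mn; apply: mono_orthogonal => //; rewrite eq_sym.
under eq_Rintegral do rewrite mono_diag.
rewrite RintegralZl//.
have := integrable_mono 1 n n r1; apply: eq_integrable => // p _ /=.
by rewrite -[1 in LHS](mulr1 1) -{2}(rmorph1 (@conjc R)) mono_diag cabs1 expr1n mul1r.
Qed.

End Orthogonality.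

(** * Bounds on the moments, and Parseval's identity for power series *)

Section Energy.
Variables (R : realType) (nu : R).
Hypothesis hnu : 1 < nu.
Local Notation T := (measurableTypeR R * measurableTypeR R)%type.
Local Notation mu := (@area R).
Local Notation W := (weight nu).

Lemma measurable_energy r f : r <= 1 -> cmeasurable f ->
  measurable_fun (subdisc r) (fun p => cabs (f (pt p)) ^+ 2 * W (pt p)).
Proof.
move=> r1 mf; apply: (@measurable_funS _ _ _ _ (subdisc 1)); first exact: measurable_subdisc.
  by move=> p; rewrite /subdisc/= => /lt_le_trans; apply.
by apply: measurable_funM; [exact: cmeasurable_cabs2|exact: measurable_weight].
Qed.

Lemma energy_integrand_ge0 f p : 0 <= cabs (f (pt p)) ^+ 2 * W (pt p).
Proof. by rewrite mulr_ge0 ?exprn_ge0 ?weight_ge0. Qed.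

Lemma energy_ge0 r f : (0 <= energy nu r f)%E.
Proof. by apply: integral_ge0 => p _; rewrite lee_fin energy_integrand_ge0. Qed.

Lemma integrable_moment r n : r <= 1 ->
  mu.-integrable (subdisc r) (EFin \o (fun p => cabs (pt p ^+ n) ^+ 2 * W (pt p))).
Proof.
move=> r1; have := integrable_mono hnu 1 n n r1; apply: eq_integrable => [|p _ /=].
  exact: measurable_subdisc.
by rewrite -[1 in LHS](mulr1 1) -{2}(rmorph1 (@conjc R)) mono_diag cabs1 expr1n mul1r.
Qed.

Lemma energy_expr n : energy nu 1 (fun z => z ^+ n) = (moment nu 1 n)%:E.
Proof.
rewrite /moment /Rintegral fineK//; apply: integrable_fin_num; first exact: measurable_subdisc.
exact: integrable_moment.
Qed.

Lemma moment_ge0 r n : 0 <= moment nu r n.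
Proof. by apply: Rintegral_ge0 => p _; rewrite mulr_ge0 ?exprn_ge0 ?weight_ge0. Qed.

Lemma moment_le r n : r <= 1 -> moment nu r n <= moment nu 1 n.
Proof.
move=> r1; rewrite /moment /Rintegral fine_le//.
- by apply: integrable_fin_num; [exact: measurable_subdisc|exact: integrable_moment].
- by apply: integrable_fin_num; [exact: measurable_subdisc|exact: integrable_moment].
apply: ge0_subset_integral; rewrite ?inE; [exact: measurable_subdisc|exact: measurable_subdisc| | |].
- apply/measurable_EFinP; apply: (@measurable_energy 1 (fun z => z ^+ n)) => //.
  by apply: cmeasurableX; exact: cmeasurable_id.
- by move=> p _; rewrite lee_fin mulr_ge0 ?exprn_ge0 ?weight_ge0.
- by move=> p; rewrite /subdisc/= => /lt_le_trans; apply.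
Qed.

Lemma moment_dec n : moment nu 1 n.+1 <= moment nu 1 n.
Proof.
apply: le_Rintegral; [exact: measurable_subdisc|exact: integrable_moment|exact: integrable_moment|].
move=> p; rewrite /subdisc/= => z1; rewrite ler_wpM2r ?weight_ge0//.
rewrite ler_sqr ?nnegrE// !cabsX exprS ler_piMl ?exprn_ge0//; exact: ltW.
Qed.

Lemma weight_lower_bound s z : cabs z <= s -> s < 1 ->
  0 < (1 - s ^+ 2) `^ (2 * nu - 2) <= W z.
Proof.
move=> zs s1; have s0 : 0 <= s by apply: le_trans zs.
have h : 0 < 1 - s ^+ 2 by rewrite subr_gt0 exprn_ilt1.
rewrite powR_gt0//=; rewrite /weight -/(cabs z).
have h1 : 1 - s ^+ 2 <= 1 - cabs z ^+ 2 by rewrite lerB// ler_sqr ?nnegrE.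
apply: ge0_ler_powR => //; rewrite ?nnegrE; first by move: hnu; lra.
  exact: ltW.
exact: le_trans (ltW h) h1.
Qed.

(** Rectangles inside the disc have an explicit area; they yield both the lower bound on the moments
    and the definiteness of the norm. *)
Lemma energy_ge_rect f (a b c d k : R) : cmeasurable f -> a < b -> c < d -> 0 <= k ->
  (forall x y, a < x < b -> c < y < d -> cabs (x +i* y) < 1 /\
     k <= cabs (f (x +i* y)) ^+ 2 * W (x +i* y)) ->
  ((k * ((b - a) * (d - c)))%:E <= energy nu 1 f)%E.
Proof.
move=> mf ab cd fb_const H.
pose Q : set T := [set` `]a, b[] `*` [set` `]c, d[].
have mQ : measurable Q by apply: measurableX; exact: measurable_itv.
rewrite EFinM -(area_rect ab cd) -/Q.
rewrite -[leLHS]integral_cst//.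
apply: (@le_trans _ _ (\int[mu]_(p in Q) (cabs (f (pt p)) ^+ 2 * W (pt p))%:E)%E).
  apply: ge0_le_integral => //.
  - apply/measurable_EFinP; apply: (@measurable_funS _ _ _ _ (subdisc 1)); first exact: measurable_subdisc.
      by move=> [x y]; rewrite /Q/= !in_itv/= => -[hx hy]; exact: (H x y hx hy).1.
    exact: measurable_energy.
  - by move=> [x y]; rewrite /Q/= !in_itv/= => -[hx hy]; rewrite lee_fin; exact: (H x y hx hy).2.
apply: ge0_subset_integral => //; first exact: measurable_subdisc.
- by apply/measurable_EFinP; exact: measurable_energy.
- by move=> p _; rewrite lee_fin energy_integrand_ge0.
- by move=> [x y]; rewrite /Q/= !in_itv/= => -[hx hy]; exact: (H x y hx hy).1.
Qed.

(** On the rectangle r < Re z < (1 + r)/2, 0 < Im z < (1 - r)/4 one has |z|^n >= r^n, and the weight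
    is bounded below since |z| <= (3 + r)/4 < 1. This is the slow decay of the moments. *)
Lemma moment_lower_bound r : 0 <= r < 1 ->
  exists2 c : R, 0 < c & forall n, c * (r ^+ n) ^+ 2 <= moment nu 1 n.
Proof.
move=> /andP[r0 r1]; pose s := (3 + r) / 4.
pose k := (1 - s ^+ 2) `^ (2 * nu - 2).
have s1 : s < 1 by rewrite /s; lra.
have s0 : 0 <= s by rewrite /s; lra.
have fb_const : 0 < k.
  by have := @weight_lower_bound s 0; rewrite cabs0 => /(_ s0 s1)/andP[].
exists (k * (((1 + r) / 2 - r) * ((1 - r) / 4 - 0))).
  by rewrite !mulr_gt0//; lra.
move=> n; rewrite mulrAC -lee_fin -energy_expr.
apply: energy_ge_rect; [by apply: cmeasurableX; exact: cmeasurable_id|lra|lra|by rewrite mulr_ge0 ?exprn_ge0// ltW|].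
move=> x y /andP[x1 x2] /andP[y1 y2].
have zs : cabs (x +i* y) <= s.
  apply: le_trans (cabs_le_ReIm _) _; rewrite /= !ger0_norm; rewrite /s; lra.
split; first exact: le_lt_trans zs s1.
rewrite mulrC; apply: ler_pM; rewrite ?exprn_ge0 ?(ltW fb_const)//.
  rewrite ler_sqr ?nnegrE ?exprn_ge0// cabsX lerXn2r ?nnegrE//.
  apply: le_trans (normr_Re _); rewrite /= ger0_norm; lra.
by have /andP[] := weight_lower_bound zs s1.
Qed.

Lemma moment_gt0 n : 0 < moment nu 1 n.
Proof.
have [|c c0 H] := @moment_lower_bound (1 / 2); first by lra.
by apply: lt_le_trans (H n); rewrite mulr_gt0// !exprn_gt0//; lra.
Qed.

(** If f(z0) were nonzero, |f| >= |f(z0)|/2 would hold on a small square about z0, whose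
    contribution to the energy is positive. *)
Lemma energy_eq0 f : analytic_on (@disc R) f -> energy nu 1 f = 0 ->
  forall z, cabs z < 1 -> f z = 0.
Proof.
move=> an Ef z0 z1; apply: contrapT => /eqP; rewrite -cabs_gt0 => fz.
have [|d d0 dP] := analytic_continuous an (_ : disc z0) (divr_gt0 fz (ltr0Sn R 1)).
  exact/disc_cabs.
pose s := (1 + cabs z0) / 2; have s1 : s < 1 by rewrite /s; lra.
pose k := (1 - s ^+ 2) `^ (2 * nu - 2).
have fb_const : 0 < k.
  by have := @weight_lower_bound s z0; rewrite -/k => /(_ _ s1)/andP[]//; rewrite /s; lra.
(* Points of the square are within 2e of z0: the first bound keeps them within [d], the second gives
   |z| <= s. *)
pose e := Num.min (d / 2) ((1 - cabs z0) / 4).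
have e0 : 0 < e by rewrite lt_min !divr_gt0// subr_gt0.
have ed : e <= d / 2 by rewrite /e ge_min lexx.
have ez : e <= (1 - cabs z0) / 4 by rewrite /e ge_min lexx orbT.
have [x0 [y0 z0E]] : exists x0 y0, z0 = x0 +i* y0 by case: (z0) => x0 y0; exists x0, y0.
suff : (((cabs (f z0) / 2) ^+ 2 * k * ((x0 + e - (x0 - e)) * (y0 + e - (y0 - e))))%:E <= energy nu 1 f)%E.
  rewrite Ef lee_fin leNgt => /negP; apply.
  by rewrite !mulr_gt0 ?exprn_gt0 ?divr_gt0//; lra.
apply: energy_ge_rect; [exact: cmeasurable_analytic|lra|lra|by rewrite mulr_ge0 ?exprn_ge0 ?divr_ge0// ltW|].
move=> x y; rewrite -!ltr_distl => hx hy.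
have zz : cabs (x +i* y - z0) < 2 * e.
  rewrite z0E; apply: le_lt_trans (cabs_le_ReIm _) _ => /=; lra.
have zs : cabs (x +i* y) <= s.
  have := cabs_triangle z0 (x +i* y) 0; rewrite !subr0 => /le_trans; apply; rewrite /s; lra.
split; first exact: le_lt_trans zs s1.
apply: ler_pM; rewrite ?exprn_ge0 ?(ltW fb_const) ?divr_ge0//.
  rewrite ler_sqr ?nnegrE ?divr_ge0//.
  have /dP : cabs (x +i* y - z0) < d by lra.
  have := cabs_triangle (f (x +i* y)) (f z0) 0; rewrite !subr0 cabsBC; lra.
by have /andP[] := weight_lower_bound zs s1.
Qed.

(** Integrates (a + b)^2 <= (1 + t) a^2 + (1 + 1/t) b^2. The free parameter, chosen as a ratio of
    norms, yields Minkowski's inequality in [fb_normD]. *)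
Lemma energyD_le f g (t : R) : cmeasurable f -> cmeasurable g -> 0 < t ->
  (energy nu 1 (fun z => f z + g z)%R <=
   (1 + t)%:E * energy nu 1 f + (1 + t^-1)%:E * energy nu 1 g)%E.
Proof.
move=> mf mg t0; have mD := @measurable_subdisc R 1 (lexx _).
have t1 : 0 <= 1 + t by rewrite addr_ge0// ltW.
have t2 : 0 <= 1 + t^-1 by rewrite addr_ge0// invr_ge0 ltW.
rewrite /energy -!ge0_integralZl_EFin//; first last.
- by apply/measurable_EFinP; exact: measurable_energy.
- by move=> p _; rewrite lee_fin energy_integrand_ge0.
- by apply/measurable_EFinP; exact: measurable_energy.
- by move=> p _; rewrite lee_fin energy_integrand_ge0.
rewrite -ge0_integralD//; first last.
- by apply: measurable_funeM; apply/measurable_EFinP; exact: measurable_energy.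
- by move=> p _; rewrite -EFinM lee_fin mulr_ge0// energy_integrand_ge0.
- by apply: measurable_funeM; apply/measurable_EFinP; exact: measurable_energy.
- by move=> p _; rewrite -EFinM lee_fin mulr_ge0// energy_integrand_ge0.
apply: ge0_le_integral => //.
- by move=> p _; rewrite lee_fin; apply: (@energy_integrand_ge0 (fun z => f z + g z)).
- by apply/measurable_EFinP; exact: (measurable_energy (lexx _) (cmeasurableD mf mg)).
- apply: emeasurable_funD; apply: measurable_funeM; apply/measurable_EFinP; exact: measurable_energy.
move=> p _; rewrite -!EFinM -EFinD lee_fin !mulrA -mulrDl ler_wpM2r ?weight_ge0//.
have := cabs_ge0 (f (pt p)); have := cabs_ge0 (g (pt p)).
have := cabsD (f (pt p)) (g (pt p)).
move: (cabs (f _ + _)) (cabs (f _)) (cabs (g _)) (cabs_ge0 (f (pt p) + g (pt p))) => c a b c0 cab b0 a0.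
apply: (@le_trans _ _ ((a + b) ^+ 2)).
  by rewrite ler_sqr ?nnegrE ?addr_ge0.
(* The gap between the two sides is exactly (t a - b)^2 / t. *)
have h : 0 <= t^-1 * (t * a - b) ^+ 2 by rewrite mulr_ge0 ?sqr_ge0// invr_ge0 ltW.
rewrite -subr_ge0; apply: le_trans h _; rewrite le_eqVlt; apply/orP; left; apply/eqP.
by field; rewrite gt_eqF.
Qed.

Lemma energyZ f (c : R[i]) : cmeasurable f ->
  energy nu 1 (fun z => c * f z) = ((cabs c ^+ 2)%:E * energy nu 1 f)%E.
Proof.
move=> mf; have mD := @measurable_subdisc R 1 (lexx _).
rewrite /energy -ge0_integralZl_EFin//; first last.
- exact: exprn_ge0.
- by apply/measurable_EFinP; exact: measurable_energy.
- by move=> p _; rewrite lee_fin energy_integrand_ge0.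
apply: eq_integral => p _; rewrite -EFinM; congr EFin.
by rewrite cabsM exprMn -[LHS]mulrA.
Qed.

Lemma cvg_sqr_cabs (u : nat -> cplx R) (l : cplx R) : u @ \oo --> l ->
  (fun n => cabs (u n) ^+ 2) @ \oo --> cabs l ^+ 2.
Proof.
move=> ul; suff h : (fun n => cabs (u n)) @ \oo --> cabs l.
  by rewrite expr2; under eq_fun do rewrite expr2; exact: cvgM.
move/cvg_cabs/cvgn_distP : ul => ul; apply/cvgn_distP => e /ul[N NP].
exists N => n /NP; rewrite subr0 ger0_norm//; apply: le_lt_trans.
have := cabs_triangle l (u n) 0; have := cabs_triangle (u n) l 0.
by rewrite !subr0 (cabsBC l) => h1 h2; rewrite ler_norml; lra.
Qed.

(** For r < 1 the partial sums are bounded by M / (1 - q) on the whole disc of radius r, which has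
    finite area: dominated convergence with a constant. *)
Lemma cvg_energy_psum (a : nat -> cplx R) r : adm a -> 0 <= r < 1 ->
  (fun N => (\sum_(n < N) cabs (a n) ^+ 2 * moment nu r n)%:E) @ \oo --> energy nu r (psum a).
Proof.
move=> aa /[dup] rr /andP[r0 r1].
have mD := @measurable_subdisc R r (ltW r1).
pose s N z := \sum_(n < N) a n * z ^+ n.
have [M [q [qq aM]]] := adm_geometric aa rr.
have M0 : 0 <= M by have := aM 0%N; rewrite !expr0 !mulr1; apply: le_trans.
have q1 : 0 < 1 - q by case/andP: qq => _; rewrite subr_gt0.
have sB N p : subdisc r p -> cabs (s N (pt p)) <= M / (1 - q).
  rewrite /subdisc/= => zr; apply: le_trans (cabs_sum _ _ _) _.
  apply: (@le_trans _ _ (\sum_(n < N) M * q ^+ n)).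
    apply: ler_sum => n _; rewrite cabsM cabsX; apply: le_trans (aM n).
    by rewrite ler_wpM2l// lerXn2r ?nnegrE// ltW.
  rewrite -mulr_sumr ler_wpM2l//.
  by have := geometric_sum_le 0 N qq; rewrite big_mkord expr0 mul1r.
have ms N : cmeasurable (s N).
  apply: (@cmeasurable_sum _ N (fun n z => a n * z ^+ n)) => n.
  by apply: cmeasurableM; [exact: cmeasurable_cst|apply: cmeasurableX; exact: cmeasurable_id].
have := @dominated_convergence _ T R mu (subdisc r) mD
  (fun N p => (cabs (s N (pt p)) ^+ 2 * W (pt p))%:E)
  (fun p => (cabs (psum a (pt p)) ^+ 2 * W (pt p))%:E)
  (cst ((M / (1 - q)) ^+ 2)%:E).
case.
- by move=> N; apply/measurable_EFinP; exact: (measurable_energy (ltW r1) (ms N)).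
- apply/measurable_EFinP; apply: (measurable_energy (ltW r1)).
  by apply: cmeasurable_analytic; exact: psum_analytic.
- apply: aeW => p Dp; apply/fine_cvgP; split; first by near=> n.
  rewrite /=; apply: cvgMl; apply: cvg_sqr_cabs.
  have z1 : cabs (pt p) < 1 by exact: lt_trans Dp r1.
  rewrite /psum on_discT//.
  have := cvg_csum (adm_geo_dominated aa z1); apply: cvg_trans.
  rewrite (_ : series _ = fun N => s N (pt p))//.
  by apply/funext => N; rewrite /series/= big_mkord.
- by apply: (@integrable_bounded R r `|(M / (1 - q)) ^+ 2| (cst ((M / (1 - q)) ^+ 2)) (ltW r1)).
- apply: aeW => p N Dp; rewrite abse_EFin lee_fin ger0_norm ?energy_integrand_ge0//.
  rewrite -[leRHS]mulr1; apply: ler_pM; rewrite ?exprn_ge0 ?weight_ge0//.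
    by rewrite ler_sqr ?nnegrE ?sB// divr_ge0// ltW.
  by apply: weight_le1 => //; exact: lt_trans Dp r1.
move=> _ _; rewrite -/(energy nu r (psum a)).
rewrite (_ : [sequence _]_n = fun N => energy nu r (s N))//.
by under eq_fun do rewrite energy_poly ?ltW//.
Unshelve. all: by end_near. Qed.

(** Monotone convergence: the discs of radius 1 - 1/(k+1) increase to the open unit disc. *)
Lemma cvg_energy_radius f : cmeasurable f ->
  (fun k => energy nu (1 - k.+1%:R^-1) f) @ \oo --> energy nu 1 f.
Proof.
move=> mf; have k1 (k : nat) : 1 - k.+1%:R^-1 <= 1 :> R by rewrite gerBl invr_ge0.
have DU : subdisc 1 = \bigcup_k @subdisc R (1 - k.+1%:R^-1).
  apply/seteqP; split => [p|p [k _]]; rewrite /subdisc/=; last first.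
    by move=> /lt_le_trans; apply.
  move=> z1; have z0 : 0 < 1 - cabs (pt p) by rewrite subr_gt0.
  have [k _ kP] := near_infty_natSinv_lt (PosNum z0).
  by exists k => //=; rewrite ltrBrDl -ltrBrDr; exact: (kP k (leqnn _)).
rewrite /energy [in X in _ --> X]DU.
apply: ge0_nondecreasing_set_cvg_integral.
- move=> n m nm; apply/subsetPset => p; rewrite /subdisc/= => /lt_le_trans; apply.
  by rewrite lerB// lef_pV2 ?posrE// ler_nat.
- by move=> k; exact: measurable_subdisc.
- by move=> k; apply/measurable_EFinP; exact: measurable_energy.
- by move=> k p _; rewrite lee_fin energy_integrand_ge0.
Qed.

Lemma lee_cvgn (u v : nat -> \bar R) l m : u @ \oo --> l -> v @ \oo --> m ->
  (forall n, (u n <= v n)%E) -> (l <= m)%E.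
Proof.
move=> ul vm uv; rewrite -(cvg_lim (@ereal_hausdorff R) ul) -(cvg_lim (@ereal_hausdorff R) vm).
by apply: lee_lim; [apply: cvgP ul|apply: cvgP vm|apply: nearW].
Qed.

Lemma radius_itv (k : nat) : 0 <= (1 - k.+1%:R^-1 : R) < 1.
Proof. by rewrite subr_ge0 invf_le1 ?ler1n//= gtrBl invr_gt0. Qed.

(** The number of terms tends to infinity at a fixed radius, then the radius tends to 1; moments at
    smaller radii are smaller, so [S] bounds all these sums. *)
Lemma energy_psum_le (a : nat -> cplx R) (S : R) : adm a ->
  (forall N, \sum_(n < N) cabs (a n) ^+ 2 * moment nu 1 n <= S) ->
  (energy nu 1 (psum a) <= S%:E)%E.
Proof.
have cS : (fun _ : nat => S%:E) @ \oo --> S%:E by exact: cvg_cst.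
move=> aa aS; have mpa := cmeasurable_analytic (psum_analytic aa).
apply: (lee_cvgn (cvg_energy_radius mpa) cS) => k.
have /andP[fb_const k1] := radius_itv k.
apply: (lee_cvgn (cvg_energy_psum aa (radius_itv k)) cS) => N.
rewrite lee_fin; apply: le_trans (aS N); apply: ler_sum => n _.
by rewrite ler_wpM2l ?exprn_ge0// moment_le// ltW.
Qed.

(** At a fixed radius r < 1 the terms after the first [N] only add to the limit; letting r tend to 1
    keeps the inequality. *)
Lemma energy_psum_ge (a : nat -> cplx R) N : adm a ->
  ((\sum_(n < N) cabs (a n) ^+ 2 * moment nu 1 n)%:E <= energy nu 1 (psum a))%E.
Proof.
move=> aa; have mpa := cmeasurable_analytic (psum_analytic aa).
have ms : cmeasurable (fun z : cplx R => \sum_(n < N) a n * z ^+ n).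
  apply: (@cmeasurable_sum _ N (fun n z => a n * z ^+ n)) => n.
  by apply: cmeasurableM; [exact: cmeasurable_cst|apply: cmeasurableX; exact: cmeasurable_id].
rewrite -energy_poly//.
apply: (lee_cvgn (cvg_energy_radius ms) (cvg_energy_radius mpa)) => k.
have /andP[fb_const k1] := radius_itv k; rewrite energy_poly ?(ltW k1)//.
have h := cvg_energy_psum aa (radius_itv k); rewrite -(cvg_lim (@ereal_hausdorff R) h).
apply: lime_ge; first exact: cvgP h.
pose F n := cabs (a n) ^+ 2 * moment nu (1 - k.+1%:R^-1) n.
exists N => // n /= Nn; rewrite lee_fin.
rewrite -[leLHS](big_mkord xpredT F) -[leRHS](big_mkord xpredT F).
rewrite [leRHS](big_cat_nat (n := N))//= lerDl; apply: sumr_ge0 => i _.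
by rewrite mulr_ge0 ?exprn_ge0 ?moment_ge0.
Qed.

End Energy.

(** * Positivity of Gamma, which makes each [bbP nu n] a nonzero multiple of z^n on the disc *)

Section GammaPositive.
Variable R : realType.
Local Notation mu := (@lebesgue_measure R).

(** From ln x < x at x = t/(2c) one gets c ln t <= t/2 + c ln(2c), so half of the exponential decay
    pays for the power. The factor 2 cancels the 1/2 of the exponential density of rate 1/2. *)
Lemma Gamma_integrand_le (c t : R) : 0 < c -> 0 < t ->
  t `^ c * expR (- t) <= 2 * expR (c * ln (2 * c)) * exponential_pdf (1 / 2) t.
Proof.
move=> c0 t0; rewrite exponential_pdfE ?(ltW t0)//.
have -> : 2 * expR (c * ln (2 * c)) * (1 / 2 * expR (- (1 / 2) * t)) =
    expR (c * ln (2 * c)) * expR (- (1 / 2) * t) by field.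
rewrite /powR gt_eqF// -!expRD ler_expR.
have c2 : 0 < 2 * c by rewrite mulr_gt0.
have h : ln t < t / (2 * c) + ln (2 * c).
  rewrite -ltrBlDr -ln_div ?posrE//; apply: ln_sublinear.
  by rewrite divr_gt0.
have : c * ln t <= c * (t / (2 * c) + ln (2 * c)) by rewrite ler_pM2l// ltW.
have -> : c * (t / (2 * c) + ln (2 * c)) = t / 2 + c * ln (2 * c).
  by field; rewrite gt_eqF.
lra.
Qed.

Lemma integrable_Gamma (s : R) : 1 < s ->
  mu.-integrable `]0, +oo[ (EFin \o (fun t => t `^ (s - 1) * expR (- t))).
Proof.
move=> s1; pose C := 2 * expR ((s - 1) * ln (2 * (s - 1))).
have s0 : 0 < s - 1 by rewrite subr_gt0.
have ie : mu.-integrable setT (EFin \o exponential_pdf (1 / 2 : R)).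
  apply/integrableP; split; first by apply/measurable_EFinP; exact: measurable_exponential_pdf.
  under eq_integral do rewrite /= ger0_norm ?exponential_pdf_ge0//.
  by rewrite integral_exponential_pdf// ltry.
have iC : mu.-integrable `]0, +oo[ (fun t => C%:E * (EFin \o exponential_pdf (1 / 2)) t)%E.
  apply: integrableZl => //; apply: integrableS ie => //.
apply: le_integrable iC => //.
- apply/measurable_EFinP; apply: measurable_funTS; apply: measurable_funM.
    exact: measurable_powR.
  by apply: measurableT_comp.
move=> t; rewrite /= in_itv/= andbT => t0; rewrite lee_fin !ger0_norm.
- exact: Gamma_integrand_le.
- by rewrite mulr_ge0 ?exponential_pdf_ge0// mulr_ge0// expR_ge0.
- by rewrite mulr_ge0 ?powR_ge0 ?expR_ge0.
Qed.

(** On [1, 2] the integrand is at least e^(-2). *)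
Lemma Gamma_gt0 (s : R) : 1 < s -> 0 < Gamma s.
Proof.
move=> s1; have iG := integrable_Gamma s1.
have mG : measurable_fun setT (fun t : R => t `^ (s - 1) * expR (- t)).
  by apply: measurable_funM; [exact: measurable_powR|apply: measurableT_comp].
have m12 : measurable (`[1, 2] : set (measurableTypeR R)) by exact: measurable_itv.
rewrite /Gamma /Rintegral fine_gt0//; apply/andP; split; last first.
  by rewrite -ge0_fin_numE ?integral_ge0//; [exact: integrable_fin_num|move=> t _; rewrite lee_fin mulr_ge0 ?powR_ge0 ?expR_ge0].
apply: (@lt_le_trans _ _ (\int[mu]_(t in `[1%R, 2%R]) (expR (- 2))%:E)%E).
  rewrite integral_cst// -[X in (_ * X)%E]/(mu [set` `[1%R, 2%R]]).
  rewrite lebesgue_measure_itv/= lte_fin ltr1n -EFinB -EFinM lte_fin.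
  by rewrite mulr_gt0 ?expR_gt0//; lra.
apply: (@le_trans _ _ (\int[mu]_(t in `[1%R, 2%R]) (t `^ (s - 1) * expR (- t))%:E)%E).
  apply: ge0_le_integral => //.
  - by apply: measurable_funTS; apply/measurable_EFinP; exact: mG.
  move=> t; rewrite /= in_itv/= => /andP[t1 t2]; rewrite lee_fin.
  rewrite -[leLHS]mul1r; apply: ler_pM; rewrite ?expR_ge0//; last by rewrite ler_expR lerN2.
  rewrite -[leLHS](congr1 (fun f => f (s - 1)) (powR1 R)).
  by apply: ge0_ler_powR; rewrite ?nnegrE//; [lra|apply: le_trans t1].
apply: ge0_subset_integral => //.
- by apply: (measurable_int mu); exact: iG.
- by move=> t _; rewrite lee_fin mulr_ge0 ?powR_ge0 ?expR_ge0.
- by move=> t /=; rewrite !in_itv/= andbT => /andP[t1 _]; apply: lt_le_trans t1.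
Qed.

Lemma poch_gt0 (s : R) n : 1 < s -> 0 < poch s n.
Proof.
by move=> s1; rewrite /poch divr_gt0 ?Gamma_gt0// (lt_le_trans s1)// lerDl.
Qed.

End GammaPositive.

(** * The coefficient model of the Fock-Bargmann space *)

Section FockCoefficients.
Variables (R : realType) (nu : R).
Hypothesis hnu : 1 < nu.
Local Notation g := (moment nu 1).
Implicit Types (a b : nat -> cplx R) (f : cplx R -> cplx R).

Definition l2w a := exists S : R, forall N, \sum_(n < N) cabs (a n) ^+ 2 * g n <= S.

Definition fb_const : R := (2 * nu - 1) / pi.

Lemma fb_const_gt0 : 0 < fb_const.
Proof. by rewrite divr_gt0 ?pi_gt0//; move: hnu; lra. Qed.

Lemma fb_normE f : fb_norm nu f = Num.sqrt (fb_const * fine (energy nu 1 f)).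
Proof.
rewrite /fb_norm /fb_inner -/fb_const; congr Num.sqrt.
have -> (x : R) (z : R[i]) : complex.Re (x%:C * z) = x * complex.Re z.
  by case: z => u v; simpc.
rewrite /disc_integral /= preimage_disc; congr (_ * fine _).
apply: eq_integral => p _; congr EFin.
rewrite cabs_sqr_conj; move: (f _ * _) (weight _ _) => [u v] w.
by simpc.
Qed.

(** [fine] sends +oo to 0, so [fb_norm] is treated as a seminorm on this class only; it contains
    [FB] and every [psum a] with [a] in [l2w]. *)
Definition fin_energy f := cmeasurable f /\ (energy nu 1 f < +oo)%E.

Lemma fin_energy_fine f : fin_energy f -> energy nu 1 f = (fine (energy nu 1 f))%:E.
Proof. by move=> [_ h]; rewrite fineK// ge0_fin_numE// energy_ge0. Qed.

Lemma fb_norm_ge0 f : 0 <= fb_norm nu f.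
Proof. exact: sqrtr_ge0. Qed.

Lemma fine_energy_ge0 f : 0 <= fine (energy nu 1 f).
Proof. by rewrite fine_ge0// energy_ge0. Qed.

Lemma fb_norm_sqr f : fb_norm nu f ^+ 2 = fb_const * fine (energy nu 1 f).
Proof. by rewrite fb_normE sqr_sqrtr// mulr_ge0 ?fine_energy_ge0 ?(ltW fb_const_gt0). Qed.

Lemma fin_energyZ (c : R[i]) f : fin_energy f -> fin_energy (fun z => c * f z).
Proof.
move=> ff; have [mf _] := ff; split; first by apply: cmeasurableM => //; exact: cmeasurable_cst.
by rewrite energyZ// fin_energy_fine// -EFinM ltry.
Qed.

Lemma fin_energyD f h : fin_energy f -> fin_energy h -> fin_energy (fun z => f z + h z).
Proof.
move=> ff fh; have [mf _] := ff; have [mh _] := fh; split; first exact: cmeasurableD.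
apply: le_lt_trans (energyD_le nu mf mh ltr01) _.
by rewrite (fin_energy_fine ff) (fin_energy_fine fh) -!EFinM -EFinD ltry.
Qed.

Lemma fb_normZ (c : R[i]) f : fin_energy f ->
  fb_norm nu (c *: f) = cabs c * fb_norm nu f.
Proof.
move=> ff; rewrite !fb_normE [energy nu 1 _](energyZ _ c ff.1) (fin_energy_fine ff) -EFinM/=.
rewrite mulrCA sqrtrM ?exprn_ge0// sqrtr_sqr ger0_norm//.
Qed.

(** Minkowski's inequality from [energyD_le] with t = Y/X, by the identity (1 + Y/X) X^2 + (1 + X/Y)
    Y^2 = (X + Y)^2. Enlarging the two norms by [d] keeps X and Y positive. *)
Lemma fb_normD f h : fin_energy f -> fin_energy h ->
  fb_norm nu (f + h) <= fb_norm nu f + fb_norm nu h.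
Proof.
move=> ff fh; apply/ler_addgt0Pr => e e0.
pose d := e / 2; have d0 : 0 < d by rewrite divr_gt0.
pose X := fb_norm nu f + d; pose Y := fb_norm nu h + d.
have X0 : 0 < X by rewrite ltr_wpDl// fb_norm_ge0.
have Y0 : 0 < Y by rewrite ltr_wpDl// fb_norm_ge0.
suff : fb_norm nu (f + h) <= X + Y.
  move=> /le_trans; apply; rewrite /X /Y addrACA lerD2l /d; lra.
have XY0 : 0 <= X + Y by rewrite addr_ge0// ltW.
rewrite -(ler_pXn2r (n := 2))// ?nnegrE ?fb_norm_ge0//.
have t0 : 0 < Y / X by rewrite divr_gt0.
have := energyD_le nu ff.1 fh.1 t0.
rewrite (fin_energy_fine ff) (fin_energy_fine fh) -[energy nu 1 _]/(energy nu 1 (f + h)).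
have ffh : fin_energy (f + h) := fin_energyD ff fh.
rewrite (fin_energy_fine ffh) -!EFinM -EFinD lee_fin fb_norm_sqr => H.
apply: le_trans (ler_wpM2l (ltW fb_const_gt0) H) _.
rewrite mulrDr mulrCA -fb_norm_sqr [fb_const * (_ * _)]mulrCA -fb_norm_sqr invf_div.
have -> : (X + Y) ^+ 2 = (1 + Y / X) * X ^+ 2 + (1 + X / Y) * Y ^+ 2.
  by field; rewrite !gt_eqF.
have x1 : fb_norm nu f ^+ 2 <= X ^+ 2.
  by rewrite ler_sqr ?nnegrE ?fb_norm_ge0 ?(ltW X0)// lerDl ltW.
have y1 : fb_norm nu h ^+ 2 <= Y ^+ 2.
  by rewrite ler_sqr ?nnegrE ?fb_norm_ge0 ?(ltW Y0)// lerDl ltW.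
by apply: lerD; apply: ler_wpM2l => //; rewrite addr_ge0// divr_ge0// ltW.
Qed.

Lemma fb_normBC f h : fin_energy f -> fin_energy h -> fb_norm nu (f - h) = fb_norm nu (h - f).
Proof.
move=> ff fh; rewrite -opprB -scaleN1r fb_normZ ?cabsN ?cabs1 ?mul1r//.
by have := fin_energyD fh (fin_energyZ (-1) ff); under eq_fun do rewrite mulN1r.
Qed.

Lemma fin_energyB f h : fin_energy f -> fin_energy h -> fin_energy (f - h).
Proof.
by move=> ff fh; have := fin_energyD ff (fin_energyZ (-1) fh); under eq_fun do rewrite mulN1r.
Qed.

Lemma fb_norm_triangle f h l : fin_energy f -> fin_energy h -> fin_energy l ->
  fb_norm nu (f - l) <= fb_norm nu (f - h) + fb_norm nu (h - l).
Proof.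
move=> ff fh fl; have -> : f - l = (f - h) + (h - l) by rewrite addrA subrK.
by apply: fb_normD; exact: fin_energyB.
Qed.

Lemma fin_energy_FB f : FB nu f -> fin_energy f.
Proof.
move=> [_ an]; rewrite /square_integrable preimage_disc => /integrableP[_ h].
split; first exact: cmeasurable_analytic.
apply: le_lt_trans h; apply: ge0_le_integral; first exact: measurable_subdisc.
- by move=> p _; rewrite lee_fin energy_integrand_ge0.
- apply/measurable_EFinP; apply: measurable_energy => //; exact: cmeasurable_analytic.
- apply: measurableT_comp => //; apply/measurable_EFinP; apply: measurable_energy => //; exact: cmeasurable_analytic.
by move=> p _; rewrite abse_EFin lee_fin ler_norm.
Qed.

Lemma FB_of_fin_energy f : on_disc f = f -> analytic_on (@disc R) f -> (energy nu 1 f < +oo)%E -> FB nu f.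
Proof.
move=> fd an Ef; split => //; rewrite /square_integrable preimage_disc; apply/integrableP; split.
  by apply/measurable_EFinP; apply: (measurable_energy nu (lexx _) (cmeasurable_analytic an)).
apply: le_lt_trans Ef; rewrite le_eqVlt; apply/orP; left; apply/eqP.
by apply: eq_integral => p _; rewrite abse_EFin ger0_norm// (energy_integrand_ge0 nu f).
Qed.

(** Uses the slow decay of the moments: |a_n|^2 g_n <= S and g_n >= c r^(2n) give x^2 <= S/c for x =
    |a_n| r^n, and x <= 1 + x^2 bounds x itself. *)
Lemma l2w_adm a : l2w a -> adm a.
Proof.
move=> [S aS] r rr; have [c c0 H] := moment_lower_bound hnu rr.
exists (1 + S / c) => n.
have r0 : 0 <= r ^+ n by rewrite exprn_ge0// (andP rr).1.
have h : cabs (a n) ^+ 2 * g n <= S.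
  apply: le_trans (aS n.+1); rewrite big_ord_recr/= lerDr; apply: sumr_ge0 => i _.
  by rewrite mulr_ge0 ?exprn_ge0 ?moment_ge0.
set x := cabs (a n) * r ^+ n.
have x0 : 0 <= x by rewrite mulr_ge0.
have x2 : x ^+ 2 <= S / c.
  rewrite ler_pdivlMr//; apply: le_trans h; rewrite /x exprMn -mulrA [_ * c]mulrC.
  by rewrite ler_wpM2l ?exprn_ge0.
have := sqr_ge0 (x - 1); move: x2; rewrite sqrrB1 !expr2; nra.
Qed.

Lemma energy_psum_l2w a (S : R) : (forall N, \sum_(n < N) cabs (a n) ^+ 2 * g n <= S) ->
  (energy nu 1 (psum a) <= S%:E)%E.
Proof. by move=> aS; apply: energy_psum_le => //; apply: l2w_adm; exists S. Qed.

Lemma l2w_fin a : l2w a -> fin_energy (psum a).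
Proof.
move=> la; split; first by apply: cmeasurable_analytic; apply: psum_analytic; exact: l2w_adm.
by have [S aS] := la; apply: le_lt_trans (energy_psum_l2w aS) _; rewrite ltry.
Qed.

Lemma fin_l2w a : adm a -> (energy nu 1 (psum a) < +oo)%E -> l2w a.
Proof.
move=> aa Ea; exists (fine (energy nu 1 (psum a))) => N; rewrite -lee_fin fineK.
  exact: energy_psum_ge.
by rewrite ge0_fin_numE// energy_ge0.
Qed.

Lemma FB_psum a : l2w a -> FB nu (psum a).
Proof.
move=> la; apply: FB_of_fin_energy; first exact: on_disc_idem.
  by apply: psum_analytic; exact: l2w_adm.
by case: (l2w_fin la).
Qed.

Lemma FB_psum_l2w a : adm a -> FB nu (psum a) -> l2w a.
Proof. by move=> aa /fin_energy_FB[_]; exact: fin_l2w. Qed.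

Lemma fb_norm_psum_le a (B : R) : 0 <= B ->
  (forall N, fb_const * \sum_(n < N) cabs (a n) ^+ 2 * g n <= B ^+ 2) ->
  fb_norm nu (psum a) <= B.
Proof.
move=> B0 aB; rewrite -(ler_pXn2r (n := 2))// ?nnegrE ?fb_norm_ge0// fb_norm_sqr.
have aS N : \sum_(n < N) cabs (a n) ^+ 2 * g n <= B ^+ 2 / fb_const.
  by rewrite ler_pdivlMr ?fb_const_gt0// mulrC.
have la : l2w a by exists (B ^+ 2 / fb_const).
rewrite mulrC -ler_pdivlMr ?fb_const_gt0// -lee_fin -(fin_energy_fine (l2w_fin la)).
exact: energy_psum_l2w.
Qed.

Lemma fb_norm_psum_ge a N : l2w a ->
  fb_const * \sum_(n < N) cabs (a n) ^+ 2 * g n <= fb_norm nu (psum a) ^+ 2.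
Proof.
move=> la; rewrite fb_norm_sqr ler_wpM2l ?(ltW fb_const_gt0)// -lee_fin.
by rewrite -(fin_energy_fine (l2w_fin la)); apply: energy_psum_ge => //; exact: l2w_adm.
Qed.

Lemma fb_norm_coef a n : l2w a -> fb_const * (cabs (a n) ^+ 2 * g n) <= fb_norm nu (psum a) ^+ 2.
Proof.
move=> la; apply: le_trans (fb_norm_psum_ge n.+1 la); rewrite ler_wpM2l ?(ltW fb_const_gt0)//.
rewrite big_ord_recr/= lerDr; apply: sumr_ge0 => i _.
by rewrite mulr_ge0 ?exprn_ge0 ?moment_ge0.
Qed.

Lemma l2w_lin (c : R[i]) a b : l2w a -> l2w b -> l2w (fun n => c * a n + b n).
Proof.
move=> [S aS] [S' bS]; exists (2 * cabs c ^+ 2 * S + 2 * S') => N.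
apply: (@le_trans _ _ (\sum_(n < N) (2 * cabs c ^+ 2 * (cabs (a n) ^+ 2 * g n) +
    2 * (cabs (b n) ^+ 2 * g n)))).
  apply: ler_sum => n _; rewrite !mulrA -mulrDl ler_wpM2r ?moment_ge0//.
  have := cabsD (c * a n) (b n); rewrite cabsM.
  move: (cabs _) (cabs c) (cabs (a n)) (cabs (b n)) (cabs_ge0 (c * a n + b n)) => x u v w x0 h.
  apply: (@le_trans _ _ ((u * v + w) ^+ 2)).
    by rewrite ler_sqr ?nnegrE//; apply: le_trans h.
  have := sqr_ge0 (u * v - w); rewrite !expr2; nra.
rewrite big_split/= -!mulr_sumr; apply: lerD; apply: ler_wpM2l.
- by rewrite mulr_ge0 ?exprn_ge0.
- exact: aS.
- exact: ler0n.
- exact: bS.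
Qed.

Lemma l2w0 : l2w (fun=> 0).
Proof. by exists 0 => N; rewrite big1// => n _; rewrite cabs0 expr0n mul0r. Qed.

Lemma psumB a b : l2w a -> l2w b -> psum (fun n => a n - b n) = psum a - psum b.
Proof.
move=> /l2w_adm aa /l2w_adm ab.
rewrite (_ : (fun n => a n - b n) = fun n => -1 * b n + a n).
  by rewrite psum_lin// scaleN1r addrC.
by apply/funext => n; rewrite mulN1r addrC.
Qed.

Lemma l2wB a b : l2w a -> l2w b -> l2w (fun n => a n - b n).
Proof.
move=> la lb; have := l2w_lin (-1) lb la.
by under eq_fun do rewrite mulN1r addrC.
Qed.

Lemma fb_norm_psum_eq0 a : l2w a -> fb_norm nu (psum a) = 0 -> forall n, a n = 0.
Proof.
move=> la h n; have := fb_norm_coef n la; rewrite h expr0n/=.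
rewrite pmulr_rle0 ?fb_const_gt0// pmulr_lle0 ?moment_gt0// => h2.
apply/eqP; rewrite -cabs_eq0 -sqrf_eq0 eq_le h2 exprn_ge0//.
Qed.

Lemma fb_norm0 : fb_norm nu 0 = 0.
Proof.
rewrite -psum0; apply/eqP; rewrite eq_le fb_norm_ge0 andbT.
apply: fb_norm_psum_le => // N; rewrite big1 ?mulr0 ?expr0n//.
by move=> n _; rewrite cabs0 expr0n mul0r.
Qed.

(** The norm controls each coefficient, and the difference has norm 0. *)
Lemma psum_inj a b : l2w a -> l2w b -> psum a = psum b -> a = b.
Proof.
move=> la lb ab; apply/funext => n.
have := fb_norm_psum_eq0 (l2wB la lb); rewrite psumB// ab subrr fb_norm0.
by move=> /(_ erefl n) /eqP; rewrite subr_eq0 => /eqP.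
Qed.

Lemma l2w_tail a (e : R) : l2w a -> 0 < e ->
  exists M, forall m N, (M <= m)%N -> \sum_(m <= n < N) cabs (a n) ^+ 2 * g n <= e.
Proof.
move=> [S aS] e0; pose F n := cabs (a n) ^+ 2 * g n.
have F0 n : 0 <= F n by rewrite mulr_ge0 ?exprn_ge0 ?moment_ge0.
pose A := [set \sum_(0 <= n < N) F n | N in [set: nat]].
have supA : has_sup A.
  split; first by exists (\sum_(0 <= n < 0) F n), 0%N.
  by exists S => _ [N _ <-]; rewrite big_mkord.
have [_ [M _ <-] hM] := sup_adherent e0 supA.
exists M => m N Mm; have [Nm|mN] := leqP N m; first by rewrite big_geq// ltW.
have : \sum_(0 <= n < N) F n <= sup A by apply: sup_upper_bound => //; exists N.
rewrite (big_cat_nat (n := M) (p := N))//=; last exact: leq_trans Mm (ltnW mN).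
rewrite (big_cat_nat (m := M) (n := m) (p := N))//=; last exact: ltnW.
have : 0 <= \sum_(M <= i < m) F i by apply: sumr_ge0.
rewrite -/F; lra.
Qed.

End FockCoefficients.

(** * Completeness, and FB_(nu,p) as a space of coefficient sequences *)

Section FockSpace.
Variables (R : realType) (nu : R).
Hypothesis hnu : 1 < nu.
Local Notation g := (moment nu 1).
Local Notation fb_const := (fb_const nu).
Local Notation l2w := (@l2w R nu).
Implicit Types (a b : nat -> cplx R) (f : cplx R -> cplx R).

Lemma cauchy_cvg_real (u : nat -> R) :
  (forall e : R, 0 < e -> exists N, forall m n, (N <= m)%N -> (N <= n)%N -> `|u m - u n| < e) ->
  exists l : R, u @ \oo --> l.
Proof.
move=> cu; suff cv : cvgn u by exists (limn u).
apply: cauchy_cvg; apply: cauchy_exP => e e0; have [N NP] := cu e e0.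
exists (u N); exists N => // n Nn; exact: NP.
Qed.

Lemma cauchy_cvg_cplx (u : nat -> cplx R) :
  (forall e : R, 0 < e -> exists N, forall m n, (N <= m)%N -> (N <= n)%N -> cabs (u m - u n) < e) ->
  exists l : cplx R, u @ \oo --> l.
Proof.
move=> cu.
have [x ux] : exists x : R, (fun n => complex.Re (u n)) @ \oo --> x.
  apply: cauchy_cvg_real => e /cu[N NP]; exists N => m n Nm Nn.
  apply: le_lt_trans (NP m n Nm Nn); have := normr_Re (u m - u n).
  by case: (u m) => ? ?; case: (u n).
have [y uy] : exists y : R, (fun n => complex.Im (u n)) @ \oo --> y.
  apply: cauchy_cvg_real => e /cu[N NP]; exists N => m n Nm Nn.
  apply: le_lt_trans (NP m n Nm Nn); have := normr_Im (u m - u n).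
  by case: (u m) => ? ?; case: (u n).
by exists (x +i* y); exact: cvg_complex.
Qed.

(** Coefficientwise limits exist since the norm controls each coefficient; the Cauchy bound passes
    to the limit in finite sums, uniformly in their length. Coefficientwise convergence is returned
    too, because it carries supports to the limit. *)
Lemma l2w_complete (b : nat -> nat -> cplx R) : (forall k, l2w (b k)) ->
  norm_cauchy (fb_norm nu) (fun k => psum (b k)) ->
  exists a, [/\ l2w a, norm_cvg (fb_norm nu) (fun k => psum (b k)) (psum a) &
    forall n, (fun k => b k n) @ \oo --> a n].
Proof.
move=> lb cb.
have lbB k l : l2w (fun n => b k n - b l n) by exact: l2wB.
have kg n : 0 < fb_const * g n by rewrite mulr_gt0 ?fb_const_gt0 ?moment_gt0.
have cn n : exists l : cplx R, (fun k => b k n) @ \oo --> l.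
  apply: cauchy_cvg_cplx => e e0.
  have e1 : 0 < e * Num.sqrt (fb_const * g n) by rewrite mulr_gt0// sqrtr_gt0.
  have [N NP] := cb _ e1; exists N => k l Nk Nl.
  have := NP k l Nk Nl; rewrite -(psumB hnu)// => h.
  rewrite -(ltr_pXn2r (n := 2))// ?nnegrE ?(ltW e0)//.
  rewrite -(ltr_pM2l (kg n)).
  apply: (@le_lt_trans _ _ (fb_norm nu (psum (fun n => b k n - b l n)) ^+ 2)).
    by rewrite -mulrA [g n * _]mulrC; exact: (fb_norm_coef hnu n (lbB k l)).
  have -> : fb_const * g n * e ^+ 2 = (e * Num.sqrt (fb_const * g n)) ^+ 2.
    by rewrite exprMn sqr_sqrtr ?(ltW (kg n))// mulrC.
  by rewrite ltr_pXn2r// ?nnegrE ?fb_norm_ge0// ltW.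
pose a n := projT1 (cid (cn n)).
have an n : (fun k => b k n) @ \oo --> a n by rewrite /a; case: cid.
have H e : 0 < e -> exists K, forall k, (K <= k)%N ->
    forall N, fb_const * \sum_(n < N) cabs (b k n - a n) ^+ 2 * g n <= e ^+ 2.
  move=> e0; have [K KP] := cb _ e0; exists K => k Kk N.
  have cv : (fun l => fb_const * \sum_(n < N) cabs (b k n - b l n) ^+ 2 * g n) @ \oo -->
      fb_const * \sum_(n < N) cabs (b k n - a n) ^+ 2 * g n.
    apply: cvgMr; elim: N => [|N IH].
      rewrite big_ord0; under eq_fun do rewrite big_ord0; exact: cvg_cst.
    rewrite big_ord_recr/=; under eq_fun do rewrite big_ord_recr/=.
    apply: cvgD => //; apply: cvgMl; apply: cvg_sqr_cabs.
    by apply: cvgcB => //; exact: cvg_cst.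
  rewrite -(cvg_lim (@Rhausdorff R) cv); apply: limr_le; first exact: cvgP cv.
  exists K => // l /= Kl.
  apply: le_trans (fb_norm_psum_ge hnu N (lbB k l)) _.
  rewrite ler_pXn2r ?nnegrE ?fb_norm_ge0 ?(ltW e0)//.
  by rewrite (psumB hnu)//; apply: ltW; exact: KP.
(* [a] is b_K minus b_K - a, and the latter is in [l2w] by the bound just obtained. *)
have la : l2w a.
  have [K KP] := H 1 ltr01.
  have lba : l2w (fun n => b K n - a n).
    exists (1 ^+ 2 / fb_const) => N; rewrite ler_pdivlMr ?fb_const_gt0// mulrC; exact: KP.
  have := l2wB (lb K) lba.
  by under eq_fun do rewrite opprB addrC subrK.
exists a; split => //.
apply/cvgn_distP => e e0; have e2 : 0 < e / 2 by rewrite divr_gt0.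
have [K KP] := H _ e2; exists K => k Kk.
rewrite subr0 ger0_norm ?fb_norm_ge0// -(psumB hnu)//.
apply: le_lt_trans (_ : e / 2 < e); last by lra.
by apply: fb_norm_psum_le => //; [exact: ltW|exact: KP].
Qed.

Definition bbP_coef n : R := Num.sqrt (poch (2 * nu) n / n`!%:R).

Lemma bbP_coef_gt0 n : 0 < bbP_coef n.
Proof.
rewrite sqrtr_gt0 divr_gt0 ?poch_gt0// ?ltr0n ?fact_gt0//; move: hnu; lra.
Qed.

Definition delta m (c : R[i]) : nat -> cplx R := fun n => if n == m then c else 0.

Lemma l2w_finite a M : (forall n, (M <= n)%N -> a n = 0) -> l2w a.
Proof.
move=> aM; exists (\sum_(n < M) cabs (a n) ^+ 2 * g n) => N.
pose F n := cabs (a n) ^+ 2 * g n.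
have F0 n : 0 <= F n by rewrite mulr_ge0 ?exprn_ge0 ?moment_ge0.
rewrite -(big_mkord xpredT F) -[leRHS](big_mkord xpredT F).
have [NM|/ltnW MN] := leqP N M.
  by rewrite [leRHS](big_cat_nat (n := N))//= lerDl sumr_ge0.
rewrite [leLHS](big_cat_nat (n := M))//= [X in _ + X]big1_seq ?addr0// => n.
by rewrite mem_index_iota => /andP[_ /andP[Mn _]]; rewrite /F aM// cabs0 expr0n mul0r.
Qed.

Lemma l2w_delta m c : l2w (delta m c).
Proof.
by apply: (@l2w_finite _ m.+1) => n; rewrite /delta; case: eqP => // ->; rewrite ltnn.
Qed.

Lemma bbP_psum n : bbP nu n = psum (delta n (bbP_coef n)%:C).
Proof.
apply: on_disc_ext => z z1; apply/esym/csumE/cvg_cabs/cvgn_distP => e e0.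
exists n.+1 => m nm; rewrite /series/= (bigD1_seq n) ?iota_uniq//=; last first.
  by rewrite mem_index_iota.
rewrite big1 => [|i /negbTE ni]; last by rewrite /delta ni mul0r.
by rewrite /delta eqxx addr0 subrr cabs0 subr0 normr0.
Qed.

Definition span_coef p (c : nat -> R[i]) m : nat -> cplx R :=
  fun n => if (p <= n < p + m)%N then c (n - p)%N * (bbP_coef n)%:C else 0.

Lemma l2w_span_coef p c m : l2w (span_coef p c m).
Proof.
by apply: (@l2w_finite _ (p + m)) => n; rewrite /span_coef leqNgt => /negbTE ->; rewrite andbF.
Qed.

Lemma span_psum p (c : nat -> R[i]) m :
  \sum_(n < m) c n *: bbP nu (p + n) = psum (span_coef p c m).
Proof.
elim: m => [|m IH].
  rewrite big_ord0 -psum0; congr psum; apply/funext => n.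
  by rewrite /span_coef addn0; case: ifP => // /andP[pn]; rewrite ltnNge pn.
rewrite big_ord_recr/= IH bbP_psum addrC -psum_lin; first last.
- exact: l2w_adm (l2w_span_coef _ _ _).
- exact: l2w_adm (l2w_delta _ _).
congr psum; apply/funext => n; rewrite /span_coef /delta.
have [->|npm] := eqVneq n (p + m)%N.
  by rewrite ltnn andbF addr0 leq_addr addnS ltnS leqnn/= addnC addnK.
rewrite mulr0 add0r addnS ltnS [(n <= _)%N]leq_eqVlt (negbTE npm)//.
Qed.

Definition trunc M a : nat -> cplx R := fun n => if (n < M)%N then a n else 0.

Lemma l2w_trunc M a : l2w (trunc M a).
Proof. by apply: (@l2w_finite _ M) => n; rewrite /trunc ltnNge => ->. Qed.

Lemma fb_norm_trunc a (e : R) : l2w a -> 0 < e ->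
  exists M, forall m, (M <= m)%N -> fb_norm nu (psum a - psum (trunc m a)) < e.
Proof.
move=> la e0; have e2 : 0 < (e / 2) ^+ 2 / fb_const.
  by rewrite divr_gt0 ?fb_const_gt0// exprn_gt0// divr_gt0.
have [M MP] := l2w_tail la e2; exists M => m Mm.
rewrite -(psumB hnu)//; last exact: l2w_trunc.
apply: le_lt_trans (_ : e / 2 < e); last by lra.
apply: fb_norm_psum_le => // [|N]; first by rewrite divr_ge0// ltW.
rewrite mulrC -ler_pdivlMr ?fb_const_gt0//; apply: le_trans (MP m N Mm).
pose F n := cabs (a n - trunc m a n) ^+ 2 * g n.
rewrite -[leLHS](big_mkord xpredT F).
have F0 n : (n < m)%N -> F n = 0.
  by move=> nm; rewrite /F /trunc nm subrr cabs0 expr0n mul0r.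
have FE n : (m <= n)%N -> F n = cabs (a n) ^+ 2 * g n.
  by rewrite /F /trunc ltnNge => ->; rewrite subr0.
have [Nm|/ltnW mN] := leqP N m.
  rewrite big1_seq ?sumr_ge0// => n; first by rewrite mulr_ge0 ?exprn_ge0 ?moment_ge0.
  by rewrite mem_index_iota => /andP[_ /andP[_ nN]]; rewrite F0// (leq_trans nN).
rewrite (big_cat_nat (n := m))//= big1_seq ?add0r => [|n].
  by rewrite le_eqVlt; apply/orP; left; apply/eqP; apply: eq_big_nat => n /andP[mn _]; exact: FE.
by rewrite mem_index_iota => /andP[_ /andP[_ nN]]; rewrite F0.
Qed.

Lemma analytic_onB (U : set (cplx R)) f h :
  analytic_on U f -> analytic_on U h -> analytic_on U (f - h).
Proof.
move=> af ah z0 Uz; have [c cf] := af _ Uz; have [d dh] := ah _ Uz.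
exists (fun k => c k - d k); move: cf dh => /nbhs_cabs[e e0 eP] /nbhs_cabs[e' e'0 eP'].
apply/nbhs_cabs; exists (Num.min e e'); first by rewrite lt_min e0.
move=> z; rewrite lt_min => /andP[/eP cf /eP' ch].
have := cvgcB cf ch; rewrite (_ : (fun n => _) = series (fun k => (c k - d k) * (z - z0) ^+ k))//.
by apply/funext => n; rewrite /series/= -sumrB; apply: eq_bigr => i _; rewrite mulrBl.
Qed.

Lemma FB_eq f h : FB nu f -> FB nu h -> fb_norm nu (f - h) = 0 -> f = h.
Proof.
move=> Ff Fh fh0; have [fd af _] := Ff; have [hd ah _] := Fh.
rewrite -fd -hd; apply: on_disc_ext => z z1; apply/eqP; rewrite -subr_eq0; apply/eqP.
have ff := fin_energyB (fin_energy_FB Ff) (fin_energy_FB Fh).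
apply: (energy_eq0 hnu (analytic_onB af ah) _ z1).
rewrite (fin_energy_fine ff); congr EFin; have := fb_norm_sqr hnu (f - h).
rewrite fh0 expr0n/= => /esym/eqP; rewrite mulf_eq0 gt_eqF ?fb_const_gt0//= => /eqP //.
Qed.

Definition supp_ge p a := forall n, (n < p)%N -> a n = 0.

Lemma FBpP p f : FBp nu p f <-> exists a, [/\ l2w a, supp_ge p a & f = psum a].
Proof.
split => [[Ff fap]|[a [la pa ->]]]; last first.
  split; first exact: FB_psum.
  move=> e e0; have [M MP] := fb_norm_trunc la e0.
  (* The normalising factor of [bbP] is divided out; it is positive, so truncations of [psum a] are
     finite combinations of the family. *)
  pose c n := a (p + n)%N / (bbP_coef (p + n))%:C.
  exists M, c; rewrite (span_psum p c M) (_ : span_coef _ _ _ = trunc (p + M) a); first by apply: MP; exact: leq_addl.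
  apply/funext => n; rewrite /span_coef /trunc; have [np|pn] /= := ltnP n p.
    by rewrite pa//; case: ifP.
  case: ifP => // _; rewrite /c subnKC// divfK// -[0]/((0 : R)%:C) (inj_eq (@complexI R)).
  by rewrite gt_eqF// bbP_coef_gt0.
have ff := fin_energy_FB Ff.
have hb k : exists b, [/\ l2w b, supp_ge p b & fb_norm nu (f - psum b) < k.+1%:R^-1].
  have [|m [c mc]] := fap (k.+1%:R^-1); first by rewrite invr_gt0.
  exists (span_coef p c m); split; last by rewrite -span_psum.
    exact: l2w_span_coef.
  by move=> n np; rewrite /span_coef leqNgt np.
pose b k := projT1 (cid (hb k)).
have bP k : [/\ l2w (b k), supp_ge p (b k) & fb_norm nu (f - psum (b k)) < k.+1%:R^-1].
  by rewrite /b; case: cid.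
have lb k : l2w (b k) by case: (bP k).
have fb k : fin_energy nu (psum (b k)) by exact: l2w_fin.
have small (e : R) : 0 < e -> exists K, forall k, (K <= k)%N -> fb_norm nu (f - psum (b k)) < e.
  move=> e0; have [K _ KP] := near_infty_natSinv_lt (PosNum e0).
  by exists K => k /KP /=; apply: lt_trans; case: (bP k).
have [|a [la ca pa]] := @l2w_complete b lb.
  move=> e e0; have [K KP] := small _ (divr_gt0 e0 (ltr0Sn R 1)).
  exists K => k l Kk Kl; have h1 := KP k Kk; have h2 := KP l Kl.
  have h3 : fb_norm nu (psum (b k) - f) < e / 2.
    by apply: le_lt_trans h1; rewrite (fb_normBC (fb k) ff).
  apply: le_lt_trans (fb_norm_triangle hnu (fb k) ff (fb l)) _.
  by rewrite (splitr e); exact: ltrD.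
exists a; split => //.
  move=> n np; have /cvg_lim <- := pa n; last exact: norm_hausdorff.
  apply: cvg_lim; first exact: norm_hausdorff.
  rewrite (_ : (fun k => b k n) = cst 0); first exact: cvg_cst.
  by apply/funext => k; case: (bP k) => _ /(_ n np).
apply: FB_eq => //; first exact: FB_psum.
apply/eqP; rewrite eq_le fb_norm_ge0 andbT; apply/ler_addgt0Pr => e e0; rewrite add0r.
have [K KP] := small _ (divr_gt0 e0 (ltr0Sn R 1)).
move/cvgn_distP : ca => /(_ _ (divr_gt0 e0 (ltr0Sn R 1)))[K' KP'].
have h1 := KP (maxn K K') (leq_maxl _ _).
have := KP' (maxn K K') (leq_maxr _ _); rewrite subr0 ger0_norm ?fb_norm_ge0// => h2.
apply: le_trans (fb_norm_triangle hnu ff (fb (maxn K K')) (l2w_fin hnu la)) _.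
by rewrite (splitr e); apply: lerD; exact: ltW.
Qed.

End FockSpace.

(** * The operator as a weighted backward shift *)

Section ShiftOperator.
Variables (R : realType) (nu : R).
Hypothesis hnu : 1 < nu.
Variable p : nat.
Local Notation g := (moment nu 1).
Local Notation fb_const := (fb_const nu).
Local Notation l2w := (@l2w R nu).
Local Notation supp_ge := (@supp_ge R p).
Local Notation X := (FBp nu p).
Local Notation N := (fb_norm nu).
Local Notation D := (dom_opH nu p).
Local Notation H := (opH nu p).
Implicit Types (a b : nat -> cplx R) (f : cplx R -> cplx R).

(** A^(p+1) sends z^(n+1) to the falling factorial times z^(n-p), and p applications of [opAstar]
    bring this back to z^n with the product as factor. In the basis of monomials this is omega_(n,p)
    times sqrt((n+1)/(2 nu + n)) for n >= p, the ratio of the normalisations of P_n and P_(n+1). *)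
Definition shift_weight n : R :=
  (\prod_(j < p) ((n - p)%:R + j%:R + 2 * nu)) * (n.+1 ^_ p.+1)%:R.

Lemma shift_weight_lt n : (n < p)%N -> shift_weight n = 0.
Proof. by move=> np; rewrite /shift_weight ffact_small ?mulr0. Qed.

(** The falling factorial supplies the factor n + 1; its other factors are positive integers, and
    those of the product exceed 1 as 2 nu > 1. *)
Lemma shift_weight_ge n : (p <= n)%N -> n.+1%:R <= shift_weight n.
Proof.
move=> pn; rewrite /shift_weight ffactSS natrM mulrC -[leLHS]mulr1.
rewrite -mulrA ler_pM2l ?ltr0n//.
have h1 : 1 <= (n ^_ p)%:R :> R by rewrite ler1n ffact_gt0.
apply: le_trans h1 _; rewrite ler_peMr// ?ler0n//.
rewrite big_seq; elim/big_ind : _ => // [x y x1 y1|j _]; first by rewrite mulr_ege1.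
have : 0 <= (n - p)%:R + j%:R :> R by rewrite addr_ge0.
by move: hnu; lra.
Qed.

Lemma shift_weight_ge0 n : 0 <= shift_weight n.
Proof. by have [/shift_weight_lt ->//|/shift_weight_ge] := ltnP n p; apply: le_trans. Qed.

Definition shiftc a n : cplx R := (shift_weight n)%:C * a n.+1.

Definition shift_prod l m : R := \prod_(i < m) shift_weight (l + i).

Lemma iter_shiftc m a n : iter m shiftc a n = (shift_prod n m)%:C * a (n + m)%N.
Proof.
elim: m n => [|m IH] n; first by rewrite /shift_prod big_ord0 mul1r addn0.
rewrite iterS /shiftc IH /shift_prod big_ord_recl/= addn0 mulrA -rmorphM/= addSnnS.
congr ((_ * _)%:C * _); apply: eq_bigr => i _.
by rewrite /bump/= addnA addn1.
Qed.

(** The factor of index i is at least l + i + 1 >= i + 1. This is where the factorial comes from. *)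
Lemma shift_prod_fact l m : (p <= l)%N -> m`!%:R <= shift_prod l m.
Proof.
move=> pl; elim: m => [|m IH]; first by rewrite /shift_prod big_ord0 fact0.
rewrite /shift_prod big_ord_recr/= factS natrM mulrC ler_pM//.
apply: le_trans (shift_weight_ge _); last exact: leq_trans pl (leq_addr _ _).
by rewrite ler_nat ltnS leq_addl.
Qed.

Lemma shift_prod_ge1 l m : (p <= l)%N -> 1 <= shift_prod l m.
Proof. by move=> pl; apply: le_trans (shift_prod_fact m pl); rewrite ler1n fact_gt0. Qed.

Lemma shift_prod_add l m n : shift_prod l (m + n) = shift_prod l m * shift_prod (l + m) n.
Proof.
elim: n => [|n IH]; first by rewrite addn0 /shift_prod big_ord0 mulr1.
by rewrite addnS /shift_prod !big_ord_recr/= -/(shift_prod _ _) IH mulrA addnA.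
Qed.

Lemma shift_prod_lt l m : (l < p)%N -> (0 < m)%N -> shift_prod l m = 0.
Proof. by case: m => // m lp _; rewrite /shift_prod big_ord_recl/= addn0 shift_weight_lt// mul0r. Qed.

Lemma opA_iter k a : adm a ->
  adm (fun n => ((n + k) ^_ k)%:R * a (n + k)%N) /\
  iter k (@opA R) (psum a) = psum (fun n => ((n + k) ^_ k)%:R * a (n + k)%N).
Proof.
move=> aa; elim: k => [|k [IH1 IH2]].
  have e : (fun n => ((n + 0) ^_ 0)%:R * a (n + 0)%N) = a.
    by apply/funext => n; rewrite addn0 ffactn0 mul1r.
  by rewrite e.
have e : (fun n => ((n + k.+1) ^_ k.+1)%:R * a (n + k.+1)%N) =
    (fun n => n.+1%:R * (((n.+1 + k) ^_ k)%:R * a (n.+1 + k)%N)).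
  apply/funext => n; rewrite addnS ffactnSr mulnC natrM -mulrA.
  by rewrite -addSn addnK.
by rewrite e iterS IH2 opA_psum//; split=> //; exact: (adm_deriv IH1).
Qed.

Lemma opAstar_iter k b : adm b ->
  let c n := if (n < k)%N then 0 else
    (\prod_(j < k) ((n - k)%:R + j%:R + 2 * nu))%:C * b (n - k)%N in
  adm c /\ iter k (opAstar nu) (psum b) = psum c.
Proof.
have nu0 : 0 <= nu by move: hnu; lra.
move=> ab; elim: k => [|k /= [IH1 IH2]].
  rewrite /= (_ : (fun n => _) = b)//.
  by apply/funext => n; rewrite big_ord0 mul1r subn0.
set c := (fun n => _); rewrite IH2 opAstar_psum//.
set c' := (fun n => _) in IH1 IH2 *.
suff e : c = astar nu c' by rewrite e; split => //; exact: adm_astar.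
apply/funext => -[|n]; rewrite /c /astar//= ltnS /c'.
case: ltnP => nk; first by rewrite mulr0.
rewrite subSS big_ord_recr/= -natrD subnK// rmorphM/= -mulrA.
exact: mulrCA.
Qed.

Lemma opH_psum a : adm a -> adm (shiftc a) /\ H (psum a) = psum (shiftc a).
Proof.
move=> aa; have [a1 e1] := opA_iter p.+1 aa.
have [a2 e2] := opAstar_iter p a1.
rewrite /opH e1 e2.
suff <- : (fun n => if (n < p)%N then 0 else
    (\prod_(j < p) ((n - p)%:R + j%:R + 2 * nu))%:C *
    (((n - p + p.+1) ^_ p.+1)%:R * a (n - p + p.+1)%N)) = shiftc a by [].
apply/funext => n; rewrite /shiftc; case: ltnP => np; first by rewrite shift_weight_lt// mul0r.
have natC (x : R) k : (x * k%:R)%:C = x%:C * k%:R by rewrite rmorphM rmorph_nat.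
by rewrite /shift_weight natC addnS subnK// [LHS]mulrA.
Qed.

Lemma iter_opH m a : adm a -> adm (iter m shiftc a) /\ iter m H (psum a) = psum (iter m shiftc a).
Proof.
move=> aa; elim: m => [|m [IH1 IH2]]//.
by rewrite !iterS IH2; have [] := opH_psum IH1.
Qed.

Lemma supp_shiftc a : supp_ge (shiftc a).
Proof. by move=> n np; rewrite /shiftc shift_weight_lt// mul0r. Qed.

Lemma supp_iter_shiftc m a : supp_ge a -> supp_ge (iter m shiftc a).
Proof. by case: m => // m _; exact: supp_shiftc. Qed.

Lemma FBp_coefP f : X f <-> exists a, [/\ l2w a, supp_ge a & f = psum a].
Proof. exact: (FBpP hnu). Qed.

Lemma dom_opHP f : D f <-> exists a, [/\ l2w a, supp_ge a, l2w (shiftc a) & f = psum a].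
Proof.
split=> [[[_ Fh] /FBp_coefP[a [la sa fa]]]|[a [la sa lh ->]]].
  exists a; split => //; move: Fh; rewrite fa; have [aa ->] := opH_psum (l2w_adm hnu la).
  exact: FB_psum_l2w.
split; last by apply/FBp_coefP; exists a.
split; first exact: FB_psum.
by have [_ ->] := opH_psum (l2w_adm hnu la); exact: FB_psum.
Qed.

(** [pow_dom] unfolds to conditions on the image of f, whose coefficients are identified with
    [shiftc a] by uniqueness. *)
Lemma pow_domP m f : pow_dom X D H m f <->
  exists a, [/\ l2w a, supp_ge a, forall i, (i <= m)%N -> l2w (iter i shiftc a) & f = psum a].
Proof.
elim: m f => [|m IH] f /=.
  split=> [/FBp_coefP[a [la sa fa]]|[a [la sa _ fa]]]; last by apply/FBp_coefP; exists a.
  by exists a; split => // i; rewrite leqn0 => /eqP ->.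
split => [[/dom_opHP[a [la sa lh fa]] /IH[b [lb sb hb fb]]]|[a [la sa ha fa]]].
  exists a; split => // -[//|i] im; rewrite iterSr.
  have -> : shiftc a = b; last exact: hb.
  apply: (psum_inj hnu) => //; rewrite -fb fa.
  by have [] := opH_psum (l2w_adm hnu la).
split; first by apply/dom_opHP; exists a; split => //; exact: (ha 1%N).
apply/IH; exists (shiftc a); split.
- exact: (ha 1%N).
- exact: supp_shiftc.
- by move=> i im; rewrite -iterSr; exact: ha.
- by rewrite fa; have [] := opH_psum (l2w_adm hnu la).
Qed.

(** Lets the last iterate decide about all earlier ones. Up to finitely many entries, compare entry
    d + j of the i-th iterate with entry p + j of the n-th: both are multiples of a_(p+j+n), the
    second carries n - i more weights, all at least 1, and the moment at the smaller index is at
    least as large. *)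
Lemma l2w_iter_le a i n : l2w a -> (i <= n)%N -> l2w (iter n shiftc a) -> l2w (iter i shiftc a).
Proof.
move=> la ni [S hS]; pose d := (p + (n - i))%N.
pose F j := cabs (iter i shiftc a j) ^+ 2 * g j.
pose G j := cabs (iter n shiftc a j) ^+ 2 * g j.
have F0 j : 0 <= F j by rewrite mulr_ge0 ?exprn_ge0 ?moment_ge0.
have G0 j : 0 <= G j by rewrite mulr_ge0 ?exprn_ge0 ?moment_ge0.
have g_le j k : g (j + k)%N <= g j.
  elim: k => [|k IHk]; first by rewrite addn0.
  by rewrite addnS; apply: le_trans IHk; exact: moment_dec.
have FG j : F (d + j)%N <= G (p + j)%N.
  rewrite /F /G !iter_shiftc !cabsM !cabs_real.
  have -> : (d + j + i = p + j + n)%N by rewrite /d; lia.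
  have -> : (d + j = p + j + (n - i))%N by rewrite /d; lia.
  apply: ler_pM; [by rewrite exprn_ge0// mulr_ge0|exact: moment_ge0| |exact: g_le].
  rewrite ler_sqr ?nnegrE ?mulr_ge0 ?normr_ge0// ler_wpM2r//.
  have pj : (p <= p + j)%N by exact: leq_addr.
  have -> : shift_prod (p + j) n = shift_prod (p + j) (n - i) * shift_prod (p + j + (n - i)) i.
    by rewrite -shift_prod_add subnK.
  rewrite normrM ler_peMl ?normr_ge0// ger0_norm ?shift_prod_ge1//.
  exact: le_trans ler01 (shift_prod_ge1 _ pj).
exists (\sum_(0 <= j < d) F j + S) => M.
rewrite -(big_mkord xpredT F).
have [Md|/ltnW dM] := leqP M d.
  rewrite (big_cat_nat (n := M) (p := d))//= -addrA lerDl addr_ge0 ?sumr_ge0//.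
  by have := hS 0%N; rewrite big_ord0.
rewrite (big_cat_nat (n := d))//= lerD2l -{1}(add0n d) big_addn.
apply: le_trans (hS (M - d + p)%N); rewrite -(big_mkord xpredT G).
rewrite [leRHS](big_cat_nat (n := p)) ?leq_addl//=.
apply: ler_wpDl; first exact: sumr_ge0.
rewrite [leRHS](_ : _ = \sum_(0 <= j < M - d) G (j + p)%N); last first.
  by rewrite -{1}[p]add0n big_addn addnK.
apply: ler_sum => j _.
by rewrite addnC [(j + p)%N]addnC; exact: FG.
Qed.

Lemma psumZD (c : R[i]) a b : l2w a -> l2w b ->
  c *: psum a + psum b = psum (fun n => c * a n + b n).
Proof. by move=> /(l2w_adm hnu) aa /(l2w_adm hnu) ab; rewrite psum_lin. Qed.

Lemma supp_lin (c : R[i]) a b : supp_ge a -> supp_ge b -> supp_ge (fun n => c * a n + b n).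
Proof. by move=> sa sb n np; rewrite sa// sb// mulr0 addr0. Qed.

Lemma FBp_subspace : Defs.subspace X.
Proof.
split; first by apply/FBp_coefP; exists (fun=> 0); split => //; [exact: l2w0|rewrite psum0].
move=> c _ _ /FBp_coefP[a [la sa ->]] /FBp_coefP[b [lb sb ->]]; apply/FBp_coefP.
exists (fun n => c * a n + b n); split; first exact: l2w_lin.
  exact: supp_lin.
exact: psumZD.
Qed.

Lemma FBp_norm : norm_on X N.
Proof.
split.
- move=> _ /FBp_coefP[a [la sa ->]] /(fb_norm_psum_eq0 hnu la) a0.
  by rewrite -psum0; congr psum; apply/funext.
- by move=> c _ /FBp_coefP[a [la _ ->]]; apply: fb_normZ => //; exact: l2w_fin.
- by move=> _ _ /FBp_coefP[a [la _ ->]] /FBp_coefP[b [lb _ ->]]; apply: fb_normD => //; exact: l2w_fin.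
Qed.

Lemma choose_coefs (P : set (cplx R -> cplx R)) (Q : (nat -> cplx R) -> Prop)
    (u : nat -> cplx R -> cplx R) :
  (forall f, P f -> exists a, Q a /\ f = psum a) -> (forall k, P (u k)) ->
  exists b : nat -> nat -> cplx R, (forall k, Q (b k)) /\ u = fun k => psum (b k).
Proof.
move=> PQ Pu; have h k := PQ _ (Pu k).
exists (fun k => projT1 (cid (h k))); split => [k|]; first by case: cid => ? [].
by apply/funext => k; case: cid => ? [].
Qed.

Lemma FBp_banach : banach_space X N.
Proof.
split; [exact: FBp_subspace|exact: FBp_norm|move=> u Xu cu].
have [|b [bQ ub]] := @choose_coefs X (fun a => l2w a /\ supp_ge a) u _ Xu.
  by move=> f /FBp_coefP[a [la sa fa]]; exists a.
have lb k : l2w (b k) by case: (bQ k).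
have [|a [la ca pa]] := @l2w_complete R nu hnu b lb; first by rewrite -ub.
exists (psum a); last by rewrite ub.
apply/FBp_coefP; exists a; split => // n np.
have /cvg_lim <- := pa n; last exact: norm_hausdorff.
apply: cvg_lim; first exact: norm_hausdorff.
rewrite (_ : (fun k => b k n) = cst 0); first exact: cvg_cst.
by apply/funext => k; case: (bQ k) => _ /(_ n np).
Qed.

Lemma shiftc_lin (c : R[i]) a b : shiftc (fun n => c * a n + b n) = fun n => c * shiftc a n + shiftc b n.
Proof. by apply/funext => n; rewrite /shiftc mulrDr mulrCA. Qed.

Lemma opH_linear : linear_operator X D H.
Proof.
split.
- split.
    apply/dom_opHP; exists (fun=> 0); split; rewrite ?psum0//; first exact: l2w0.
    by rewrite (_ : shiftc _ = fun=> 0); [exact: l2w0|apply/funext => n; rewrite /shiftc mulr0].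
  move=> c _ _ /dom_opHP[a [la sa ha ->]] /dom_opHP[b [lb sb hb ->]]; apply/dom_opHP.
  exists (fun n => c * a n + b n); split; [exact: l2w_lin|exact: supp_lin| |exact: psumZD].
  by rewrite shiftc_lin; exact: l2w_lin.
- by move=> f [].
- move=> _ /dom_opHP[a [la sa ha ->]]; apply/FBp_coefP; exists (shiftc a); split => //; first exact: supp_shiftc.
  by have [] := opH_psum (l2w_adm hnu la).
- move=> c _ _ /dom_opHP[a [la sa ha ->]] /dom_opHP[b [lb sb hb ->]].
  have [_ ->] := opH_psum (l2w_adm hnu la); have [_ ->] := opH_psum (l2w_adm hnu lb).
  rewrite !psumZD//; have [_ ->] := opH_psum (l2w_adm hnu (l2w_lin c la lb)).
  by rewrite shiftc_lin.
Qed.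

Lemma iter_shiftc_finite m M a : (forall n, (M <= n)%N -> a n = 0) -> l2w (iter m shiftc a).
Proof.
move=> aM; apply: (@l2w_finite _ _ _ M) => n Mn.
by rewrite iter_shiftc aM ?mulr0// (leq_trans Mn)// leq_addr.
Qed.

Lemma supp_trunc M a : supp_ge a -> supp_ge (trunc M a).
Proof. by move=> sa n np; rewrite /trunc sa//; case: ifP. Qed.

Lemma dom_opH_dense : dense_in X N D.
Proof.
split; first by move=> f [].
move=> _ e /FBp_coefP[a [la sa ->]] e0; have [M MP] := fb_norm_trunc hnu la e0.
exists (psum (trunc M a)); last exact: MP.
apply/dom_opHP; exists (trunc M a); split => //; [exact: l2w_trunc|exact: supp_trunc|].
apply: (@iter_shiftc_finite 1 M) => n Mn; by rewrite /trunc ltnNge Mn.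
Qed.

(** Tested on z^(n+1): its image is w_n z^n with w_n >= n + 1, and z^n has at least the norm of
    z^(n+1). *)
Lemma opH_unbounded : unbounded N D H.
Proof.
move=> [M HM].
have [n0 n0M] : exists n : nat, `|M| < n%:R by exists (Num.truncn `|M|).+1; exact: truncnS_gt.
(* The summand [p] makes the weight nonzero, [n0] makes it exceed |M|. *)
pose n := (p + n0)%N; pose a : nat -> cplx R := delta n.+1 1.
have la : l2w a by exact: l2w_delta.
have ha : l2w (shiftc a).
  apply: (@iter_shiftc_finite 1 n.+2) => k kn.
  by rewrite /a /delta gtn_eqF.
have sa : supp_ge a.
  by move=> k kp; rewrite /a /delta ltn_eqF// ltnS (leq_trans (ltnW kp))// leq_addr.
have [_ e] := opH_psum (l2w_adm hnu la).
have := HM (psum a); rewrite e => /(_ _)/wrap[|h]; first by apply/dom_opHP; exists a.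
have kg : 0 < fb_const * g n.+1 by rewrite mulr_gt0 ?fb_const_gt0 ?moment_gt0.
have Na : N (psum a) <= Num.sqrt (fb_const * g n.+1).
  apply: fb_norm_psum_le => // K.
  rewrite sqr_sqrtr ?(ltW kg)// ler_pM2l ?fb_const_gt0//.
  have [Kn|nK] := leqP K n.+1.
    rewrite big1 ?moment_ge0// => i _; rewrite /a /delta ltn_eqF ?cabs0 ?expr0n ?mul0r//.
    exact: leq_trans (ltn_ord i) Kn.
  rewrite (bigD1 (Ordinal nK))//= big1 ?addr0 => [|i ni].
    by rewrite /a /delta eqxx cabs1 expr1n mul1r.
  rewrite /a /delta; case: eqP => [ein|_]; last by rewrite cabs0 expr0n mul0r.
  by move: ni; rewrite -val_eqE/= ein eqxx.
have := fb_norm_coef hnu n ha.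
rewrite /shiftc /a /delta eqxx mulr1 cabs_real ger0_norm ?shift_weight_ge0// => h1.
have h2 : n.+1%:R <= shift_weight n by apply: shift_weight_ge; exact: leq_addr.
have h3 : `|M| < shift_weight n.
  apply: lt_le_trans h2; apply: lt_le_trans n0M _.
  by rewrite ler_nat /n leqW// leq_addl.
have h4 : N (psum (shiftc a)) <= `|M| * Num.sqrt (fb_const * g n.+1).
  apply: le_trans h _; apply: le_trans (ler_wpM2r (fb_norm_ge0 _ _) (ler_norm M)) _.
  by rewrite ler_wpM2l.
have h5 : N (psum (shiftc a)) ^+ 2 <= `|M| ^+ 2 * (fb_const * g n.+1).
  have h6 : 0 <= `|M| * Num.sqrt (fb_const * g n.+1) by rewrite mulr_ge0 ?sqrtr_ge0.
  rewrite -[fb_const * _](sqr_sqrtr (ltW kg)) -exprMn.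
  by rewrite ler_sqr ?nnegrE ?fb_norm_ge0.
have := le_trans h1 h5; apply/negP; rewrite -ltNge.
apply: (@lt_le_trans _ _ (shift_weight n ^+ 2 * (fb_const * g n.+1))).
  by rewrite ltr_pM2r// ltr_sqr ?nnegrE ?shift_weight_ge0.
rewrite mulrCA ler_wpM2l ?(ltW (fb_const_gt0 hnu))// ler_wpM2l ?exprn_ge0 ?shift_weight_ge0//.
exact: moment_dec.
Qed.

Lemma norm_cvg_coef (b : nat -> nat -> cplx R) a n : (forall k, l2w (b k)) -> l2w a ->
  norm_cvg N (fun k => psum (b k)) (psum a) -> (fun k => b k n) @ \oo --> a n.
Proof.
move=> lb la /cvgn_distP cb; apply/cvg_cabs/cvgn_distP => e e0.
have kg : 0 < fb_const * g n by rewrite mulr_gt0 ?fb_const_gt0 ?moment_gt0.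
have e1 : 0 < e * Num.sqrt (fb_const * g n) by rewrite mulr_gt0// sqrtr_gt0.
have [K KP] := cb _ e1; exists K => k /KP; rewrite !subr0 !ger0_norm ?fb_norm_ge0// => h.
have hb := fb_norm_coef hnu n (l2wB (lb k) la).
rewrite -(ltr_pXn2r (n := 2))// ?nnegrE ?(ltW e0)// -(ltr_pM2l kg).
rewrite -[X in X < _]mulrA [g n * _]mulrC; apply: le_lt_trans hb _.
have -> : fb_const * g n * e ^+ 2 = (e * Num.sqrt (fb_const * g n)) ^+ 2.
  by rewrite exprMn sqr_sqrtr ?(ltW kg)// mulrC.
by rewrite (psumB hnu)// ltr_pXn2r// ?nnegrE ?fb_norm_ge0// ltW.
Qed.

(** Limits of coefficients identify the limit of the images with [iter n shiftc a]; it lies in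
    [l2w], and [l2w_iter_le] then supplies the intermediate conditions of [pow_dom]. *)
Lemma iter_opH_closed n : closed_operator X N (pow_dom X D H n) (iter n H).
Proof.
move=> u x y Du /FBp_coefP[a [la sa ->]] /FBp_coefP[c [lc sc ->]] ux uy.
have [|b [bQ ub]] := @choose_coefs (pow_dom X D H n)
    (fun a => [/\ l2w a, supp_ge a & l2w (iter n shiftc a)]) u _ Du.
  by move=> f /pow_domP[b [lb sb hb fb]]; exists b; split => //; split => //; exact: hb.
have lb k : l2w (b k) by case: (bQ k).
have lhb k : l2w (iter n shiftc (b k)) by case: (bQ k).
have uy' : norm_cvg N (fun k => psum (iter n shiftc (b k))) (psum c).
  have -> : (fun k => psum (iter n shiftc (b k))) = (fun k => iter n H (u k)).
    apply/funext => k; rewrite ub; apply: esym.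
    exact: (iter_opH n (l2w_adm hnu (lb k))).2.
  exact: uy.
have ux' : norm_cvg N (fun k => psum (b k)) (psum a) by rewrite ub in ux; exact: ux.
have e : c = iter n shiftc a.
  apply/funext => m; rewrite iter_shiftc.
  have h1 : (fun k => iter n shiftc (b k) m) @ \oo --> c m.
    exact: (norm_cvg_coef (n := m) lhb lc uy').
  have h2 : (fun k => iter n shiftc (b k) m) @ \oo --> ((shift_prod m n)%:C * a (m + n)%N : cplx R).
    under eq_fun do rewrite iter_shiftc.
    exact: (cvgcMl (norm_cvg_coef (n := (m + n)%N) lb la ux')).
  by rewrite -(cvg_lim (@norm_hausdorff _ _) h1) -(cvg_lim (@norm_hausdorff _ _) h2).
split; last by have [_ ->] := iter_opH n (l2w_adm hnu la); rewrite -e.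
apply/pow_domP; exists a; split => // i ni.
by apply: l2w_iter_le ni _ => //; rewrite -e.
Qed.

End ShiftOperator.

(** * Orbits and periodic points *)

Section Dynamics.
Variables (R : realType) (nu : R).
Hypothesis hnu : 1 < nu.
Variable p : nat.
Local Notation g := (moment nu 1).
Local Notation fb_const := (fb_const nu).
Local Notation l2w := (@l2w R nu).
Local Notation supp_ge := (@supp_ge R p).
Local Notation N := (fb_norm nu).
Local Notation shift_prod := (shift_prod nu p).
Local Notation shiftc := (shiftc nu p).
Implicit Types (a b : nat -> cplx R).

(** Since (1/2)^(2l) <= (1/2)^l and g_l <= g_0, this bounds the norm of a series whose l-th
    coefficient is at most (1/2)^l. *)
Definition geo_const : R := Num.sqrt (2 * (fb_const * g 0)).

Lemma geo_const_gt0 : 0 < geo_const.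
Proof. by rewrite sqrtr_gt0 mulr_gt0// mulr_gt0 ?fb_const_gt0 ?moment_gt0. Qed.

Lemma half_geometric_sum (m M : nat) :
  \sum_(m <= n < M) (1 / 2 : R) ^+ n <= 2 * (1 / 2) ^+ m.
Proof.
have h : 0 <= (1 / 2 : R) < 1 by lra.
apply: le_trans (geometric_sum_le m M h) _.
by rewrite (_ : 1 - 1 / 2 = 2^-1 :> R) ?invrK 1?mulrC//; lra.
Qed.

Lemma fb_norm_geometric a (c : R) : 0 <= c ->
  (forall l, cabs (a l) <= c * (1 / 2) ^+ l) ->
  l2w a /\ N (psum a) <= c * geo_const.
Proof.
move=> c0 ac.
have kg : 0 < fb_const * g 0 by rewrite mulr_gt0 ?fb_const_gt0 ?moment_gt0.
have g_le k : g k <= g 0.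
  by elim: k => // k IHk; apply: le_trans IHk; exact: moment_dec.
have S M : fb_const * \sum_(n < M) cabs (a n) ^+ 2 * g n <= (c * geo_const) ^+ 2.
  rewrite exprMn sqr_sqrtr; last by rewrite mulr_ge0// ltW.
  have -> : c ^+ 2 * (2 * (fb_const * g 0)) = fb_const * (2 * (c ^+ 2 * g 0)) by ring.
  rewrite ler_pM2l ?fb_const_gt0//.
  apply: (@le_trans _ _ (\sum_(n < M) (c ^+ 2 * g 0) * (1 / 2) ^+ n)).
    apply: ler_sum => n _.
    have h : (c * (1 / 2) ^+ n) ^+ 2 <= c ^+ 2 * (1 / 2) ^+ n.
      rewrite exprMn ler_wpM2l ?exprn_ge0// expr2 ler_piMl ?exprn_ge0//.
      by rewrite exprn_ile1//; lra.
    rewrite [leRHS]mulrAC; apply: ler_pM; rewrite ?exprn_ge0 ?moment_ge0//.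
    apply: le_trans _ h; rewrite ler_sqr ?nnegrE // mulr_ge0 // exprn_ge0 //; lra.
  rewrite -mulr_sumr mulrC ler_wpM2r ?mulr_ge0 ?exprn_ge0 ?moment_ge0//.
  by have := half_geometric_sum 0 M; rewrite big_mkord expr0 mulr1.
split; last by apply: fb_norm_psum_le => //; rewrite mulr_ge0// ltW// geo_const_gt0.
by exists ((c * geo_const) ^+ 2 / fb_const) => M; rewrite ler_pdivlMr ?fb_const_gt0// mulrC.
Qed.

(** 8^k <= (k + 8)! gives 8^(k-8) <= k!; since 8 is twice 4, a surplus 2^k remains, which outgrows
    [C] times 8^8. *)
Lemma factorial_dominates (C : R) : exists K, forall k, (K <= k)%N -> C * 4 ^+ k <= k`!%:R.
Proof.
have pow2 (x : R) : exists K, x <= 2 ^+ K.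
  exists (Num.truncn x).+1; apply: ltW; apply: lt_le_trans (truncnS_gt x) _.
  by rewrite -(natrX _ 2) ler_nat ltnW// ltn_expl.
have h8 k : (8 ^ k <= (k + 8)`!)%N.
  elim: k => // k IHk; rewrite expnS addSn factS; apply: leq_mul => //.
  by rewrite -addSn leq_addl.
have [K' CK'] := pow2 (C * 8 ^+ 8).
exists (K' + 8)%N => k kK; have k8 : (8 <= k)%N by exact: leq_trans (leq_addl _ _) kK.
apply: (@le_trans _ _ (8 ^ (k - 8))%:R); last first.
  by rewrite ler_nat -[in leqRHS](subnK k8).
rewrite -(ler_pM2r (_ : 0 < 8 ^+ 8 :> R)) ?exprn_gt0// natrX -exprD subnK//.
rewrite mulrAC; have -> : 8 ^+ k = 2 ^+ k * 4 ^+ k :> R by rewrite -exprMn; congr (_ ^+ _); ring.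
rewrite ler_wpM2r ?exprn_ge0//; apply: le_trans CK' _.
by rewrite ler_eXn2l ?ltr1n// (leq_trans _ kK)// leq_addr.
Qed.

(* The coefficients of [S^k b] for the right inverse [S] of the shift. *)
Definition rinv k b l : cplx R :=
  if (k + p <= l)%N then b (l - k)%N / (shift_prod (l - k) k)%:C else 0.

(** The infinite sum of the S^(n_j) q_j. In its uses n_j >= j, so the terms with j > l do not reach
    index [l]. *)
Definition superpose (n : nat -> nat) (q : nat -> nat -> cplx R) l : cplx R := \sum_(j < l.+1) rinv (n j) (q j) l.

Lemma rinv_lt k b l : (l < k + p)%N -> rinv k b l = 0.
Proof. by rewrite ltnNge /rinv => /negbTE ->. Qed.

Lemma superposeE n q l : superpose n q l = \sum_(j < l.+1) rinv (n j) (q j) l.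
Proof. by []. Qed.

Lemma superpose_lt n q l : (l < p)%N -> superpose n q l = 0.
Proof.
move=> lp; apply: big1 => j _; apply: rinv_lt.
by rewrite (leq_trans lp)// leq_addl.
Qed.

Lemma supp_superpose n q : supp_ge (superpose n q).
Proof. move=> l; exact: superpose_lt. Qed.

Lemma shift_prod_neq0 l k : (p <= l)%N -> (shift_prod l k)%:C != 0 :> R[i].
Proof.
move=> pl; rewrite -[0]/((0 : R)%:C) (inj_eq (@complexI R)) gt_eqF//.
exact: lt_le_trans ltr01 (shift_prod_ge1 hnu k pl).
Qed.

(** The product of weights in the denominator splits at [l], and its second half cancels the weights
    of the i-fold shift. *)
Lemma shift_prod_rinv i j k b l : (p <= l)%N -> (k = i + j)%N ->
  (shift_prod l i)%:C * rinv k b (l + i) = rinv j b l.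
Proof.
move=> pl ->; rewrite /rinv.
have -> : (i + j + p <= l + i)%N = (j + p <= l)%N by lia.
case: ifP => [jl|]; last by rewrite mulr0.
have -> : (l + i - (i + j) = l - j)%N by lia.
have pj : (p <= l - j)%N by lia.
rewrite (_ : (i + j = j + i)%N) ?shift_prod_add; last by lia.
have -> : (l - j + j = l)%N by lia.
rewrite rmorphM/= invfM mulrCA; congr (_ * _).
by rewrite mulrCA divff ?mulr1// shift_prod_neq0.
Qed.

Lemma rinv0 b l : (p <= l)%N -> rinv 0 b l = b l.
Proof. by move=> pl; rewrite /rinv add0n pl subn0 /shift_prod big_ord0 divr1. Qed.

Section Superposition.
Variables (n d : nat -> nat) (q : nat -> nat -> cplx R) (eps : R).
Hypothesis eps0 : 0 <= eps.
(** Gaps of at least d_i let the shift erase q_i before the time n_j of any later j. *)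
Hypothesis nd : forall i j, (i < j)%N -> (n i + d i <= n j)%N /\ (n i < n j)%N.
Hypothesis q_supp : forall j, supp_ge (q j).
Hypothesis q_fin : forall j l, (d j <= l)%N -> q j l = 0.

(** With k = n_j - n_i, a nonzero entry l of S^k q_j is an entry of q_j divided by at least k!, and
    l < k + d_j. The factor 2^(k + d_j) thus makes that entry at most eps (1/2)^j (1/2)^l. *)
Definition small_after i := forall j, (i < j)%N -> forall l,
  cabs (q j l) * 2 ^+ (n j - n i + d j) <= eps * (1 / 2) ^+ j * (n j - n i)`!%:R.

Lemma index_le j : (j <= n j)%N.
Proof.
elim: j => // j IHj; apply: leq_ltn_trans IHj _.
by have [] := nd (ltnSn j).
Qed.

(** After n_i shifts the terms j < i are gone, the term i has become q_i, and the terms j > i are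
    S^(n_j - n_i) q_j, controlled by [small_after]. *)
Lemma superpose_shift i l : small_after i ->
  cabs (iter (n i) shiftc (superpose n q) l - q i l) <= eps * (1 / 2) ^+ i * (1 / 2) ^+ l.
Proof.
move=> q_small; have rhs0 : 0 <= eps * (1 / 2) ^+ i * (1 / 2) ^+ l by rewrite !mulr_ge0 ?exprn_ge0//; lra.
have [lp|pl] := ltnP l p.
  rewrite q_supp// subr0 iter_shiftc.
  (* Below [p] the weights kill every positive power; for n_i = 0 the superposition itself vanishes
     there. *)
  case: (n i) => [|m]; first by rewrite addn0 superpose_lt// mulr0 cabs0.
  by rewrite shift_prod_lt// mul0r cabs0.
rewrite iter_shiftc /superpose mulr_sumr.
pose L := (l + n i).+1.
pose F j := (shift_prod l (n i))%:C * rinv (n j) (q j) (l + n i).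
rewrite -(big_mkord xpredT F).
have iL : (i < L)%N by rewrite /L ltnS (leq_trans (index_le i))// leq_addl.
rewrite (big_cat_nat (n := i) (p := L)) ?(ltnW iL)//= big1_seq ?add0r => [|j]; last first.
  rewrite mem_index_iota => /andP[_ /andP[_ ji]]; have [h1 h2] := nd ji.
  rewrite /F /rinv; case: ifP; last by rewrite mulr0.
  by move=> _; rewrite q_fin ?mul0r ?mulr0//; lia.
rewrite big_ltn// {1}/F (@shift_prod_rinv _ 0)// ?addn0// rinv0// addrAC subrr add0r.
apply: le_trans (cabs_sum _ _ _) _.
apply: (@le_trans _ _ (\sum_(i.+1 <= j < L) eps * (1 / 2) ^+ l * (1 / 2) ^+ j)).
  rewrite big_nat_cond [leRHS]big_nat_cond; apply: ler_sum => j /andP[/andP[ij _] _].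
  have [h1 h2] := nd ij.
  rewrite /F (@shift_prod_rinv _ (n j - n i))//; last by rewrite subnKC// ltnW.
  set k := (n j - n i)%N; rewrite /rinv.
  have rj : 0 <= eps * (1 / 2) ^+ l * (1 / 2) ^+ j by rewrite !mulr_ge0 ?exprn_ge0//; lra.
  case: ifP => kl; last by rewrite cabs0.
  have pk : (p <= l - k)%N by lia.
  have [dl|ld] := leqP (d j) (l - k)%N; first by rewrite q_fin// mul0r cabs0.
  have f0 : 0 < k`!%:R :> R by rewrite ltr0n fact_gt0.
  have L1 := shift_prod_fact hnu k pk.
  have L0 : 0 < shift_prod (l - k) k by apply: lt_le_trans L1.
  rewrite cabsM cabsV cabs_real gtr0_norm// ler_pdivrMr//.
  apply: (@le_trans _ _ (eps * (1 / 2) ^+ l * (1 / 2) ^+ j * k`!%:R)); last first.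
    by rewrite ler_wpM2l.
  have p2 : 0 < 2 ^+ (k + d j) :> R by rewrite exprn_gt0.
  rewrite -(ler_pM2r p2); apply: le_trans (q_small _ ij (l - k)%N) _; rewrite -/k.
  have -> : eps * (1 / 2) ^+ l * (1 / 2) ^+ j * k`!%:R * 2 ^+ (k + d j) =
    (eps * (1 / 2) ^+ j * k`!%:R) * ((1 / 2) ^+ l * 2 ^+ (k + d j)) by ring.
  rewrite ler_peMr//.
    by rewrite !mulr_ge0 ?exprn_ge0 ?ler0n//; lra.
  (* Here l < k + d_j, so (1/2)^l 2^(k + d_j) >= 1. *)
  rewrite -(subnKC (_ : l <= k + d j)%N); last by lia.
  rewrite exprD mulrA -exprMn (_ : 1 / 2 * 2 = 1) ?expr1n ?mul1r; last by lra.
  by rewrite exprn_ege1// ler1n.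
rewrite -mulr_sumr [leRHS]mulrAC; apply: ler_wpM2l.
  by rewrite mulr_ge0 ?exprn_ge0//; lra.
(* The sum from i + 1 on is at most 2 (1/2)^(i+1) = (1/2)^i. *)
apply: le_trans (half_geometric_sum _ _) _; rewrite exprS; lra.
Qed.

Lemma l2w_superpose_shift i : small_after i -> l2w (iter (n i) shiftc (superpose n q)).
Proof.
move=> q_small; have e0 : 0 <= eps * (1 / 2) ^+ i by rewrite mulr_ge0 ?exprn_ge0//; lra.
have [h _] := fb_norm_geometric e0 (fun l => superpose_shift l q_small).
have hq : l2w (q i) by apply: (@l2w_finite _ _ _ (d i)) => l; exact: q_fin.
rewrite (_ : iter _ _ _ = fun l => 1 * (iter (n i) shiftc (superpose n q) l - q i l) + q i l).
  exact: l2w_lin.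
by apply/funext => l; rewrite mul1r subrK.
Qed.

Lemma fb_norm_superpose i : small_after i ->
  N (psum (iter (n i) shiftc (superpose n q)) - psum (q i)) <= eps * (1 / 2) ^+ i * geo_const.
Proof.
move=> q_small; have e0 : 0 <= eps * (1 / 2) ^+ i by rewrite mulr_ge0 ?exprn_ge0//; lra.
have [_ h] := fb_norm_geometric e0 (fun l => superpose_shift l q_small).
have hq : l2w (q i) by apply: (@l2w_finite _ _ _ (d i)) => l; exact: q_fin.
by rewrite -(psumB hnu)//; exact: l2w_superpose_shift.
Qed.

End Superposition.

End Dynamics.

(** * Dense periodic points and a dense orbit *)

Section Chaos.
Variables (R : realType) (nu : R).
Hypothesis hnu : 1 < nu.
Variable p : nat.
Local Notation l2w := (@l2w R nu).
Local Notation supp_ge := (@supp_ge R p).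
Local Notation X := (FBp nu p).
Local Notation N := (fb_norm nu).
Local Notation D := (dom_opH nu p).
Local Notation H := (opH nu p).
Local Notation shiftc := (shiftc nu p).
Local Notation geo_const := (geo_const nu).
Local Notation superpose := (superpose nu p).
Local Notation rinv := (rinv nu p).
Implicit Types (a b : nat -> cplx R).

Lemma finite_bound b M : (forall l, (M <= l)%N -> b l = 0) ->
  exists2 B : R, 0 <= B & forall l, cabs (b l) <= B.
Proof.
move=> bM; exists (\sum_(l < M) cabs (b l)); first exact: sumr_ge0.
move=> l; have [lM|Ml] := ltnP l M; last by rewrite bM// cabs0 sumr_ge0.
by rewrite (bigD1 (Ordinal lM))//= lerDl sumr_ge0.
Qed.

(** The m-fold shift kills the term b, supported below M <= m, and lowers S^((j+1)m) b to S^(jm)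
    b. *)
Lemma superpose_periodic b m M : (0 < m)%N -> (M <= m)%N ->
  (forall l, (M <= l)%N -> b l = 0) ->
  let Phi := superpose (fun j => (j * m)%N) (fun=> b) in iter m shiftc Phi = Phi.
Proof.
move=> m0 Mm bM Phi; apply/funext => l; rewrite iter_shiftc.
have [lp|pl] := ltnP l p.
  by rewrite shift_prod_lt// mul0r /Phi superpose_lt.
rewrite /Phi !superposeE mulr_sumr big_ord_recl.
rewrite mul0n rinv0; last by rewrite (leq_trans pl)// leq_addr.
rewrite bM ?mulr0 ?add0r; last by rewrite (leq_trans Mm)// leq_addl.
pose F j := rinv (j * m)%N b l.
rewrite (eq_bigr (fun j : 'I_(l + m) => F j)); last first.
  by move=> j _; rewrite /F -(shift_prod_rinv hnu b pl (_ : (bump 0 j * m = m + j * m)%N))// mulSn.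
rewrite -(big_mkord xpredT F) -(big_mkord xpredT F).
(* The left side has l + m terms, the right side l + 1; those with j > l vanish, as jm >= j. *)
rewrite (big_cat_nat (n := l.+1))//=; last by rewrite -addn1 leq_add2l.
rewrite [X in _ + X]big1_seq ?addr0// => j.
rewrite mem_index_iota => /andP[_ /andP[lj _]]; apply: rinv_lt.
by rewrite (leq_trans lj)// (leq_trans (leq_pmulr j m0))// leq_addr.
Qed.

Lemma opH_periodic_dense : dense_in X N (periodic_points X D H).
Proof.
split.
  by move=> f [m [_ /(pow_domP hnu)[a [la sa _ fa]] _]]; apply/(FBp_coefP hnu); exists a.
move=> _ e /(FBp_coefP hnu)[a [la sa ->]] e0.
have e2 : 0 < e / 2 by rewrite divr_gt0.
have [M MP] := fb_norm_trunc hnu la e2.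
pose b := trunc M a; have lb : l2w b by exact: l2w_trunc.
have bM l : (M <= l)%N -> b l = 0 by move=> Ml; rewrite /b /trunc ltnNge Ml.
have sb : supp_ge b by exact: supp_trunc.
have [B B0 bB] := finite_bound bM.
have C0 := geo_const_gt0 hnu.
(* The norm error eps times [geo_const] is then e / 4, below the half of [e] left after
   truncation. *)
pose eps := e / 4 / geo_const; have eps0 : 0 < eps by rewrite !divr_gt0.
have [K KP] := factorial_dominates (B * 2 ^+ M / eps).
(* m > M lets one period erase [b]; m > K puts every n_j with j > 0 in the range where the factorial
   dominates. *)
pose m := (K + M).+1; pose n j := (j * m)%N.
have nd i j : (i < j)%N -> (n i + M <= n j)%N /\ (n i < n j)%N.
  move=> ij; have : (i.+1 * m <= j * m)%N by rewrite leq_mul2r ij orbT.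
  by rewrite mulSn /n /m; split; lia.
have sm : small_after n (fun=> M) (fun=> b) eps 0.
  move=> j j0 l; rewrite {2 4}/n mul0n subn0.
  have Kj : (K <= n j)%N.
    have : (1 * m <= j * m)%N by rewrite leq_mul2r j0 orbT.
    by rewrite mul1n /n /m; lia.
  have := KP _ Kj; rewrite mulrAC ler_pdivrMr// => h.
  have p2 : 0 < 2 ^+ j :> R by rewrite exprn_gt0.
  rewrite -(ler_pM2r p2).
  have -> : eps * (1 / 2) ^+ j * (n j)`!%:R * 2 ^+ j = (n j)`!%:R * eps.
    have h2 : (1 / 2) ^+ j * 2 ^+ j = 1 :> R by rewrite -exprMn divfK ?expr1n.
    by rewrite -[RHS]mulr1 -[X in _ = _ * X]h2; ring.
  apply: le_trans h.
  (* One 2^(n_j) out of 4^(n_j) matches [small_after], the other dominates 2^j. *)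
  rewrite exprD (_ : 4 = 2 * 2 :> R); last by ring.
  rewrite exprMn.
  have -> : B * 2 ^+ M * (2 ^+ n j * 2 ^+ n j) = B * (2 ^+ n j * 2 ^+ M) * 2 ^+ n j :> R by ring.
  apply: ler_pM; rewrite ?mulr_ge0 ?exprn_ge0//.
    by rewrite ler_wpM2r ?mulr_ge0 ?exprn_ge0.
  by rewrite ler_eXn2l ?ltr1n// /n leq_pmulr.
pose Phi := superpose n (fun=> b).
have per : iter m shiftc Phi = Phi.
  by apply: (superpose_periodic (M := M)) => //; rewrite /m; lia.
have lPhi : l2w Phi := l2w_superpose_shift hnu (ltW eps0) nd (fun=> sb) (fun=> bM) sm.
have NPhi : N (psum Phi - psum b) <= eps * (1 / 2) ^+ 0 * geo_const :=
  fb_norm_superpose hnu (ltW eps0) nd (fun=> sb) (fun=> bM) sm.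
exists (psum Phi).
  exists m; split => //; last by have [_ ->] := iter_opH hnu p m (l2w_adm hnu lPhi); rewrite per.
  apply/(pow_domP hnu); exists Phi; split => //; first exact: supp_superpose.
  by move=> i im; apply: (l2w_iter_le hnu lPhi im); rewrite per.
apply: le_lt_trans (fb_norm_triangle hnu (l2w_fin hnu la) (l2w_fin hnu lb) (l2w_fin hnu lPhi)) _.
rewrite (splitr e); apply: ltrD; first exact: MP.
rewrite (fb_normBC (l2w_fin hnu lb) (l2w_fin hnu lPhi)); apply: le_lt_trans NPhi _.
rewrite expr0 mulr1 /eps divfK ?gt_eqF//; lra.
Qed.

Definition ratc (r : rat * rat) : R[i] := ratr r.1 +i* ratr r.2.

(** Polynomials with Gaussian rational coefficients, coded by lists; entries below [p] are erased to
    stay in FB_(nu,p). *)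
Definition qcoef (s : seq (rat * rat)) l : cplx R := if (l < p)%N then 0 else ratc (nth (0, 0) s l).

Lemma supp_qcoef s : supp_ge (qcoef s).
Proof. by move=> l lp; rewrite /qcoef lp. Qed.

Lemma qcoef_fin s l : (size s <= l)%N -> qcoef s l = 0.
Proof. by move=> sl; rewrite /qcoef nth_default// /ratc !raddf0; case: ifP. Qed.

Lemma ratc_dense (z : R[i]) (e : R) : 0 < e -> exists r, cabs (z - ratc r) <= e.
Proof.
case: z => x y e0; have e2 : 0 < e / 2 by rewrite divr_gt0.
have he (t : R) : t - e / 2 < t + e / 2 by lra.
have [r] := rat_in_itvoo (he x); have [s] := rat_in_itvoo (he y).
rewrite !in_itv/= -!ltr_distl => hs hr; exists (r, s).
apply: le_trans (cabs_le_ReIm _) _.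
rewrite (splitr e); apply: lerD; rewrite /= distrC; exact: ltW.
Qed.

Lemma qcoef_dense a (e : R) : l2w a -> supp_ge a -> 0 < e ->
  exists s, N (psum a - psum (qcoef s)) < e.
Proof.
move=> la sa e0; have e2 : 0 < e / 2 by rewrite divr_gt0.
have [M MP] := fb_norm_trunc hnu la e2.
have C0 := geo_const_gt0 hnu.
pose eta := e / 4 / geo_const; have eta0 : 0 < eta by rewrite !divr_gt0.
(* The accuracy (1/2)^M is uniform and at least as good as the (1/2)^l required for l < M. *)
have h l : exists r, cabs (a l - ratc r) <= eta * (1 / 2) ^+ M.
  by apply: ratc_dense; rewrite mulr_gt0// exprn_gt0//; lra.
pose s := mkseq (fun l => projT1 (cid (h l))) M.
exists s; have lb : l2w (trunc M a) by exact: l2w_trunc.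
have lq : l2w (qcoef s) by apply: (@l2w_finite _ _ _ (size s)) => l; exact: qcoef_fin.
have [l|_ hN] := @fb_norm_geometric R nu hnu (fun l => trunc M a l - qcoef s l) eta (ltW eta0).
  have rhs0 k : 0 <= eta * (1 / 2) ^+ k.
    by rewrite mulr_ge0 ?(ltW eta0)// exprn_ge0//; lra.
  rewrite /trunc; case: ltnP => lM; last first.
    by rewrite qcoef_fin ?size_mkseq// subrr cabs0.
  rewrite /qcoef; case: ltnP => lp; first by rewrite sa// subrr cabs0.
  rewrite nth_mkseq//; case: cid => r /= hr; apply: le_trans hr _.
  rewrite ler_wpM2l ?(ltW eta0)// ler_wiXn2l//; try lra; exact: ltnW.
apply: le_lt_trans (fb_norm_triangle hnu (l2w_fin hnu la) (l2w_fin hnu lb) (l2w_fin hnu lq)) _.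
rewrite (splitr e); apply: ltrD; first exact: MP.
rewrite -(psumB hnu lb lq); apply: le_lt_trans hN _.
rewrite /eta divfK ?gt_eqF//; lra.
Qed.

(* [logn 2 j.+1] takes every value infinitely often. *)
Definition code j : seq (rat * rat) := odflt [::] (unpickle (logn 2 j.+1)).

(** The witness is j + 1 = 2^c (2J + 1): its 2-adic valuation is the code of [s], and the odd factor
    pushes j beyond J. *)
Lemma code_cofinal s J : exists2 j, (J <= j)%N & code j = s.
Proof.
pose c := pickle s; have c0 : (0 < 2 ^ c)%N by rewrite expn_gt0.
have j0 : (0 < 2 ^ c * (2 * J).+1)%N by rewrite muln_gt0 c0.
exists (2 ^ c * (2 * J).+1).-1.
  have : (1 * (2 * J).+1 <= 2 ^ c * (2 * J).+1)%N by rewrite leq_mul2r c0 orbT.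
  by lia.
have l0 : logn 2 (2 * J).+1 = 0%N.
  by rewrite lognE dvdn2 /= mul2n odd_double.
by rewrite /code prednK// lognM// pfactorK// l0 addn0 /c pickleK.
Qed.

Lemma opH_hypercyclic : exists2 x, infty_dom X D H x & dense_in X N (Defs.orbit H x).
Proof.
pose q j := qcoef (code j); pose d j := size (code j).
have q_fin j l : (d j <= l)%N -> q j l = 0 by exact: qcoef_fin.
have hB j := finite_bound (q_fin j).
pose B j := projT1 (cid2 (hB j)).
have B0 j : 0 <= B j by rewrite /B; case: cid2.
have qB j l : cabs (q j l) <= B j by rewrite /B; case: cid2.
have hK j := factorial_dominates (B j * 2 ^+ d j * 2 ^+ j).
pose K j := projT1 (cid (hK j)).
have KP j k : (K j <= k)%N -> B j * 2 ^+ d j * 2 ^+ j * 4 ^+ k <= k`!%:R.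
  by rewrite /K; case: cid => K' /= /(_ k).
(* The gap n_(j+1) - n_j exceeds the length d_j, so that q_j is erased, and the threshold K_(j+1),
   so that the factorial dominates. *)
pose n := fix n j := if j is j'.+1 then (n j' + d j' + K j'.+1).+1 else 0%N.
have nS j : n j.+1 = (n j + d j + K j.+1).+1 by [].
have n_mono i j : (i <= j)%N -> (n i <= n j)%N.
  elim: j => [|j IHj]; first by rewrite leqn0 => /eqP ->.
  by rewrite leq_eqVlt => /orP[/eqP ->//|/IHj]; rewrite nS; lia.
have nd i j : (i < j)%N -> (n i + d i <= n j)%N /\ (n i < n j)%N.
  elim: j => // j IHj; rewrite ltnS leq_eqVlt => /orP[/eqP ->|/IHj []]; rewrite nS; lia.
have nK i j : (i < j)%N -> (K j <= n j - n i)%N.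
  by case: j => // j; rewrite ltnS => /n_mono; rewrite nS; lia.
have q_supp j : supp_ge (q j) by exact: supp_qcoef.
have sm i : small_after n d q 1 i.
  move=> j ij l; set k := (n j - n i)%N; rewrite mul1r.
  have h := KP _ _ (nK _ _ ij); rewrite -/k in h.
  have p2 : 0 < 2 ^+ j :> R by rewrite exprn_gt0.
  rewrite -(ler_pM2r p2).
  have -> : (1 / 2) ^+ j * k`!%:R * 2 ^+ j = k`!%:R :> R.
    have h2 : (1 / 2) ^+ j * 2 ^+ j = 1 :> R by rewrite -exprMn divfK ?expr1n.
    by rewrite -[RHS]mulr1 -[X in _ = _ * X]h2; ring.
  apply: le_trans h; rewrite exprD.
  have -> : B j * 2 ^+ d j * 2 ^+ j * 4 ^+ k = B j * (4 ^+ k * 2 ^+ d j) * 2 ^+ j by ring.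
  rewrite ler_wpM2r ?(ltW p2)//; apply: ler_pM; rewrite ?mulr_ge0 ?exprn_ge0//.
  by rewrite ler_wpM2r ?exprn_ge0// lerXn2r ?nnegrE ?ler_nat.
pose Phi := superpose n q.
have lPhi : l2w Phi := l2w_superpose_shift hnu ler01 nd q_supp q_fin (sm 0%N).
(* As i <= n_i, it is enough that the n_i-th iterate is in [l2w], where it is a small perturbation
   of q_i. *)
have lit i : l2w (iter i shiftc Phi).
  apply: (l2w_iter_le hnu lPhi (index_le nd i)).
  exact: (l2w_superpose_shift hnu ler01 nd q_supp q_fin (sm i)).
have sPhi : supp_ge Phi by exact: supp_superpose.
have itE i := (iter_opH hnu p i (l2w_adm hnu lPhi)).2.
exists (psum Phi); first by move=> m _; apply/(pow_domP hnu); exists Phi; split.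
split.
  move=> _ [i _ <-]; rewrite itE; apply/(FBp_coefP hnu); exists (iter i shiftc Phi); split => //.
  exact: supp_iter_shiftc.
move=> _ e /(FBp_coefP hnu)[a [la sa ->]] e0; have e2 : 0 < e / 2 by rewrite divr_gt0.
have [s hs] := qcoef_dense la sa e2.
have C0 := geo_const_gt0 hnu.
have half1 : `|1 / 2 : R| < 1 by rewrite ger0_norm; lra.
(* The error at time n_j is at most (1/2)^j times [geo_const]; past J it is below e / 2, and
   [code_cofinal] finds the wanted polynomial there. *)
have /cvgn_distP/(_ _ (divr_gt0 e2 C0))[J JP] := cvg_geometric 1 half1.
have [j Jj js] := code_cofinal s J.
exists (iter (n j) H (psum Phi)); first by exists (n j).
have lq : l2w (q j) by apply: (@l2w_finite _ _ _ (d j)) => l; exact: q_fin.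
have hq : N (psum a - psum (q j)) < e / 2 by rewrite /q js.
rewrite itE.
apply: le_lt_trans (fb_norm_triangle hnu (l2w_fin hnu la) (l2w_fin hnu lq) (l2w_fin hnu (lit _))) _.
rewrite (splitr e); apply: ltrD; first exact: hq.
rewrite (fb_normBC (l2w_fin hnu lq) (l2w_fin hnu (lit _))).
apply: le_lt_trans (fb_norm_superpose hnu ler01 nd q_supp q_fin (sm j)) _.
have := JP j Jj; rewrite subr0 /geometric/= ger0_norm; last first.
  by apply: mulr_ge0 => //; apply: exprn_ge0; lra.
by rewrite ltr_pdivlMr.
Qed.

End Chaos.

Theorem theorem4p1 (R : realType) (nu : R) (hnu : 1 < nu) (p : nat) :
  chaotic (FBp nu p) (fb_norm nu) (dom_opH nu p) (opH nu p).
Proof.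
split; [exact: FBp_banach|split|move=> n _; exact: iter_opH_closed|exact: opH_hypercyclic|exact: opH_periodic_dense].
- exact: opH_linear.
- exact: opH_unbounded.
- exact: dom_opH_dense.
Qed.
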